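(* Let $\alpha\in(1,2)$, let $r\in(r_{\min}(\alpha),+\infty)$ with $r_{\min}(\alpha)=\frac{2(\alpha-1)}\alpha$, let $\nu_\alpha$ be a non-degenerate symmetric $\alpha$-stable Lévy measure on $\mathbb{R}^d$, let $\mu_\alpha$ be the associated $\alpha$-stable probability measure with spectral measure $\lambda_1$, let $\mathbf{D}^{\alpha-1}$ be the associated fractional gradient and let $\mathcal{L}^\alpha$ be the generator of the associated stable Ornstein-Uhlenbeck semigroup. Then, for all $p\in(\alpha/(\alpha-1),+\infty)$ and all $f\in L^p(\mu_\alpha)$, $$\big\|\,\|\mathbf{D}^{\alpha-1}\circ(E-\mathcal{L}^\alpha)^{-\frac r2}(f)\|\,\big\|_{L^p(\mu_\alpha)}\le2\gamma_\alpha(q)\,\|K_{\alpha,r}\|_{L^1((0,+\infty),dt)}\,\|f\|_{L^p(\mu_\alpha)},$$ with $q=p/(p-1)$, $$K_{\alpha,r}(t)=\frac1{2\Gamma(\frac r2)}\frac{e^{-\alpha t}}{t^{1-\frac r2}(1-e^{-\alpha t})^{1-\frac1\alpha}},\quad t>0,$$ and $$\gamma_\alpha(q)=\left(\mathbb{E}|Y_\alpha|^q\right)^{1/q}\sup_{z\in\mathbb{R}^d,\ \|z\|=1}\left(\int_{\mathbb{S}^{d-1}}|\langle z;x\rangle|^\alpha\lambda_1(dx)\right)^{1/\alpha},$$ where $Y_\alpha$ is a symmetric real $\alpha$-stable random variable with characteristic function $\exp(-|\xi|^\alpha)$, $\xi\in\mathbb{R}$.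
   Context: $\|\cdot\|$ and $\langle\cdot;\cdot\rangle$ are the Euclidean norm and inner product on $\mathbb{R}^d$; $\mathbb{S}^{d-1}$ is the unit sphere; $\mathcal{S}(\mathbb{R}^d)$ is the Schwartz space; $E$ is the identity operator. A (non-degenerate symmetric) $\alpha$-stable Lévy measure, $\alpha\in(1,2)$: a Lévy measure $\nu_\alpha$ on $\mathbb{R}^d$ (positive Borel measure, $\nu_\alpha(\{0\})=0$, $\int(1\wedge\|u\|^2)\nu_\alpha(du)<\infty$) such that $c^{-\alpha}T_c(\nu_\alpha)=\nu_\alpha$ for all $c>0$, where $T_c(\nu_\alpha)(B)=\nu_\alpha(B/c)$. Equivalently, in polar coordinates $u=ry$, $\nu_\alpha(du)=\mathbf 1_{(0,\infty)}(r)\mathbf 1_{\mathbb{S}^{d-1}}(y)\frac{dr}{r^{\alpha+1}}\sigma(dy)$ with $\sigma$ a finite positive measure on $\mathbb{S}^{d-1}$. Symmetric means $\sigma$ is symmetric. The associated probability measure $\mu_\alpha$ has characteristic function $$\hat\mu_\alpha(\xi)=\exp\Big(\int_{\mathbb{R}^d}(e^{i\langle u;\xi\rangle}-1-i\langle\xi;u\rangle)\nu_\alpha(du)\Big)=\exp\Big(-\int_{\mathbb{S}^{d-1}}|\langle y;\xi\rangle|^\alpha\lambda_1(dy)\Big),$$ where the spectral measure $\lambda_1$ is a symmetric finite positive measure on $\mathbb{S}^{d-1}$ proportional to $\sigma$. Non-degenerate means $\inf_{y\in\mathbb{S}^{d-1}}\int_{\mathbb{S}^{d-1}}|\langle y;x\rangle|^\alpha\lambda_1(dx)\neq0$.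 Operators: $D^{\alpha-1}(f)(x)=\int_{\mathbb{R}^d}(f(x+u)-f(x))u\,\nu_\alpha(du)$, $(D^{\alpha-1})^*(f)(x)=\int_{\mathbb{R}^d}(f(x-u)-f(x))u\,\nu_\alpha(du)$, $\mathbf{D}^{\alpha-1}=\frac12(D^{\alpha-1}-(D^{\alpha-1})^* )$ (which equals $D^{\alpha-1}$ by symmetry; $\mathbb{R}^d$-valued). The stable Ornstein-Uhlenbeck semigroup is $P^{\nu_\alpha}_t(f)(x)=\int_{\mathbb{R}^d}f(xe^{-t}+(1-e^{-\alpha t})^{1/\alpha}y)\mu_\alpha(dy)$, with generator, on $\mathcal{S}(\mathbb{R}^d)$, $\mathcal{L}^\alpha(f)(x)=-\langle x;\nabla f(x)\rangle+\int_{\mathbb{R}^d}\langle\nabla f(x+u)-\nabla f(x);u\rangle\nu_\alpha(du)$, and $(E-\mathcal{L}^\alpha)^{-r/2}f=\frac1{\Gamma(r/2)}\int_0^\infty\frac{e^{-t}}{t^{1-r/2}}P^{\nu_\alpha}_t(f)\,dt$. The composed operator $\mathbf{D}^{\alpha-1}\circ(E-\mathcal{L}^\alpha)^{-r/2}$ is initially defined on $\mathcal{S}(\mathbb{R}^d)$; on $L^p(\mu_\alpha)$ it denotes the continuous extension from $\mathcal{S}(\mathbb{R}^d)$. *)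

(* Defs.v *)
From HB Require Import structures.
From mathcomp Require Import all_boot all_order all_algebra.
From mathcomp Require Import complex.
From mathcomp Require Import all_classical all_reals all_analysis.
Import Order.TTheory GRing.Theory Num.Theory.
Import numFieldNormedType.Exports.

Set Implicit Arguments.
Unset Strict Implicit.
Unset Printing Implicit Defensive.

Local Open Scope classical_set_scope.
Local Open Scope ring_scope.
Local Open Scope complex_scope.

(* Borel sigma-algebra of the usual topology, so that 'rV[R]_d is both the
   normed space and the measurable space R^d.  The norm `|x| that the library
   puts on 'rV[R]_d is the sup norm: the Euclidean norm is [enorm] below. *)
HB.instance Definition _ (R : realType) (m n : nat) :=
  @isMeasurable.Build (sigma_display (@open 'M[R]_(m, n))) 'M[R]_(m, n)
    <<s @open 'M[R]_(m, n) >>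
    (@sigma_algebra0 _ setT _) (@sigma_algebraC _ _)
    (@sigma_algebra_bigcup _ setT _).

Section euclidean.
Context {R : realType} {d : nat}.
Implicit Types x y : 'rV[R]_d.

Definition dotp x y : R := \sum_i x ord0 i * y ord0 i.
Definition enorm x : R := Num.sqrt (dotp x x).
Definition sphere : set 'rV[R]_d := [set y | enorm y = 1].

End euclidean.

Section complex_integral.
Context {R : realType}.

Definition cexp (z : R[i]) : R[i] :=
  (expR (complex.Re z) * cos (complex.Im z)) +i*
  (expR (complex.Re z) * sin (complex.Im z)).

Definition cintegral d (T : measurableType d) (m : {measure set T -> \bar R})
    (f : T -> R[i]) : R[i] :=
  (\int[m]_x complex.Re (f x)) +i* (\int[m]_x complex.Im (f x)).

End complex_integral.

Definition char_fun {R : realType} {d : nat}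
    (m : {measure set 'rV[R]_d -> \bar R}) (xi : 'rV[R]_d) : R[i] :=
  cintegral m (fun x => cexp (0 +i* dotp x xi)).

Section stable_measures.
Context {R : realType} {d : nat}.
Implicit Types (nu : {measure set 'rV[R]_d -> \bar R})
  (s l : {finite_measure set 'rV[R]_d -> \bar R}).

Definition levy_measure nu : Prop :=
  nu [set 0] = 0%E /\
  (\int[nu]_u (Num.min 1 (enorm u ^+ 2))%:E < +oo)%E.

Definition stable_levy_measure (alpha : R) nu : Prop :=
  levy_measure nu /\
  forall c, 0 < c -> forall B : set 'rV[R]_d, measurable B ->
    ((c `^ (- alpha))%:E * nu [set c^-1 *: u | u in B])%E = nu B.

(* A finite measure on the unit sphere is a finite measure on R^d which does
   not charge the complement of the sphere. *)
Definition on_sphere s : Prop := s (~` sphere) = 0%E.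

Definition symmetric_measure s : Prop :=
  forall B : set 'rV[R]_d, measurable B -> s [set - y | y in B] = s B.

Definition polar_decomposition (alpha : R) nu s : Prop :=
  forall B : set 'rV[R]_d, measurable B ->
    nu B = (\int[s]_(y in sphere)
              \int[lebesgue_measure]_(r in `]0%R, +oo[)
                (\1_B (r *: y) / r `^ (alpha + 1))%:E)%E.

Definition symmetric_stable (alpha : R) nu s : Prop :=
  [/\ stable_levy_measure alpha nu, on_sphere s, symmetric_measure s
    & polar_decomposition alpha nu s].

Definition stable_law nu (mu : probability 'rV[R]_d R) : Prop :=
  forall xi, char_fun mu xi =
    cexp (cintegral nu
      (fun u => cexp (0 +i* dotp u xi) - 1 - (0 +i* dotp xi u))).

Definition spectral_measure (alpha : R) s (mu : probability 'rV[R]_d R) l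
    : Prop :=
  [/\ on_sphere l, symmetric_measure l,
      exists2 c : R, 0 < c & forall B : set 'rV[R]_d, measurable B -> l B = (c%:E * s B)%E
    & forall xi, char_fun mu xi =
        cexp ((- \int[l]_(y in sphere) `|dotp y xi| `^ alpha) +i* 0)].

Definition non_degenerate (alpha : R) l : Prop :=
  ereal_inf [set (\int[l]_(x in sphere) (`|dotp y x| `^ alpha)%:E)%E
            | y in sphere] <> 0%E.

End stable_measures.

Section schwartz.
Context {R : realType} {d : nat}.
Implicit Types f : 'rV[R]_d -> R.

Definition partials (s : seq 'I_d) f : 'rV[R]_d -> R :=
  foldr (fun i g => 'D_(delta_mx ord0 i) g) f s.

Definition schwartz f : Prop :=
  (forall s x, differentiable (partials s f) x) /\
  (forall s (k : nat), exists C : R,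
     forall x, (1 + enorm x) ^+ k * `|partials s f x| <= C).

End schwartz.

Section operators.
Context {R : realType} {d : nat}.
Implicit Types (f : 'rV[R]_d -> R) (x : 'rV[R]_d).

Definition Dfrac (nu : {measure set 'rV[R]_d -> \bar R}) f x : 'rV[R]_d :=
  \row_j \int[nu]_u ((f (x + u) - f x) * u ord0 j).

Definition Dfrac_adj (nu : {measure set 'rV[R]_d -> \bar R}) f x
    : 'rV[R]_d :=
  \row_j \int[nu]_u ((f (x - u) - f x) * u ord0 j).

Definition frac_grad (nu : {measure set 'rV[R]_d -> \bar R}) f x : 'rV[R]_d :=
  2^-1 *: (Dfrac nu f x - Dfrac_adj nu f x).

Definition stable_OU (alpha : R) (mu : probability 'rV[R]_d R) (t : R) f x : R :=
  \int[mu]_y f (expR (- t) *: x + (1 - expR (- (alpha * t))) `^ alpha^-1 *: y).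

Definition Gamma (s : R) : R :=
  \int[lebesgue_measure]_(t in `]0, +oo[) (t `^ (s - 1) * expR (- t)).

(* (E - L^alpha)^(-r/2), where L^alpha is the generator of [stable_OU]; the
   operator is defined by this integral over the semigroup. *)
Definition bessel_potential (alpha r : R) (mu : probability 'rV[R]_d R) f x : R :=
  (Gamma (r / 2))^-1 *
  \int[lebesgue_measure]_(t in `]0, +oo[)
    (expR (- t) / t `^ (1 - r / 2) * stable_OU alpha mu t f x).

Definition frac_riesz (alpha r : R) (nu : {measure set 'rV[R]_d -> \bar R})
    (mu : probability 'rV[R]_d R) f : 'rV[R]_d -> 'rV[R]_d :=
  frac_grad nu (bessel_potential alpha r mu f).

End operators.

Section extension.
Context {R : realType} {d : nat} (mu : probability 'rV[R]_d R) (p : R).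

Definition vLnorm (F : 'rV[R]_d -> 'rV[R]_d) : \bar R :=
  ('N[mu]_(p%:E)[EFin \o (enorm \o F)])%E.

(* [T] represents, on functions instead of a.e. classes, the continuous
   extension to L^p(mu) of the operator [T0] given on the Schwartz space;
   continuity makes [T] compatible with a.e. equality. *)
Definition continuous_extension
    (T0 T : ('rV[R]_d -> R) -> 'rV[R]_d -> 'rV[R]_d) : Prop :=
  [/\ forall f, f \in Lfun mu p%:E ->
        measurable_fun setT (T f) /\ (vLnorm (T f) < +oo)%E,
      forall f, schwartz f -> {ae mu, forall x, T f x = T0 f x}
    & forall f, f \in Lfun mu p%:E ->
        forall e : R, 0 < e -> exists2 del : R, 0 < del &
          forall g, g \in Lfun mu p%:E ->
            ('N[mu]_(p%:E)[EFin \o (g \- f)%R] < del%:E)%E ->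
            (vLnorm (T g \- T f)%R < e%:E)%E].

End extension.

Section constants.
Context {R : realType}.

Definition r_min (alpha : R) : R := 2 * (alpha - 1) / alpha.

Definition K_kernel (alpha r t : R) : R :=
  (2 * Gamma (r / 2))^-1 *
  (expR (- (alpha * t)) /
   (t `^ (1 - r / 2) * (1 - expR (- (alpha * t))) `^ (1 - alpha^-1))).

Definition K_L1norm (alpha r : R) : \bar R :=
  (\int[lebesgue_measure]_(t in `]0%R, +oo[) `|(K_kernel alpha r t)%:E|)%E.

Definition standard_stable (alpha : R) dO (O : measurableType dO)
    (P : probability O R) (Y : {RV P >-> R}) : Prop :=
  forall xi : R, cintegral P (fun w => cexp (0 +i* (xi * Y w))) =
    (expR (- (`|xi| `^ alpha))) +i* 0.

(* Extended-real valued, so that no convention is needed for an infinite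
   moment. *)
Definition gamma_const d (alpha q : R) dO (O : measurableType dO)
    (P : probability O R) (Y : {RV P >-> R})
    (l : {finite_measure set 'rV[R]_d -> \bar R}) : \bar R :=
  (('E_P[fun w => (`|Y w| `^ q)%R]) `^ q^-1 *
   ereal_sup [set (\int[l]_(x in sphere) (`|dotp z x| `^ alpha)%:E) `^ alpha^-1
             | z in sphere])%E.

End constants.

(* Main.v *)
Require Import Defs.
From HB Require Import structures.
From mathcomp Require Import all_boot all_order all_algebra.
From mathcomp Require Import complex ring lra finmap.
From mathcomp Require Import all_classical all_reals all_analysis.
From mathcomp Require Import measurable_realfun.
Import Order.TTheory GRing.Theory Num.Theory.
Import numFieldNormedType.Exports.

Set Implicit Arguments.
Unset Strict Implicit.
Unset Printing Implicit Defensive.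
Local Open Scope classical_set_scope.
Local Open Scope ring_scope.

(** Notation: psi is [spectral_exponent], so that mu has Fourier transform exp(-psi); b(t) = (1 -
    e^(-alpha t))^(1/alpha); K is [K_kernel].

    The core is an explicit formula ([frac_riesz_kernel_transform]), valid for Schwartz f and in
    fact for every bounded Lipschitz f: the fractional Riesz transform of f at x equals the integral
    over t > 0 of 2 K(t) times the mu(dy)-integral of y f(e^(-t) x + b(t) y). The right-hand side,
    [kernel_transform], still makes sense almost everywhere for f in L^p(mu), and it is the
    extension [T] exhibited by the theorem.

    The formula comes from Fubini and an integration by parts for the stable law
    ([levy_gradient_ibp]): the mu-mean of the symmetrised nu-difference of h at the point b y with
    increments c u is (c/b)^(alpha-1) times the mu-mean of y h(b y). For h a cosine both sides are
    computed from the gradient of psi, which is the nu-integral of u sin<u,xi> and is homogeneous of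
    degree alpha - 1 ([law_coord_sin], [levy_sine_momentZ]). The identity passes to bounded
    Lipschitz h by [trigonometric_induction]: such functions are reached from cosines by linear
    combinations and pointwise limits under uniform bounds. With c = e^(-t) and b = b(t), the weight
    e^(-t) t^(r/2-1) of the Bessel potential is turned into 2 K(t) ([kernel_ratio]), and r > r_min
    makes K integrable at 0.

    The bound is a Hoelder inequality for the measure 2 K(t) dt mu(dy), after testing the vector
    against a unit vector z ([kernel_hoelder]). One factor is controlled by the L^q(mu) norm of
    <.,z>. The other, integrated in x, is 2 ||K||_1 times the p-th power of ||f||_p, because mu is
    invariant under the Ornstein-Uhlenbeck semigroup ([OU_invariant], a consequence of
    [fourier_unique]). Under mu, <.,z> is distributed as psi(z)^(1/alpha) Y, so the first factor is
    at most gamma ([gamma_const_real]); p > alpha/(alpha-1) means q < alpha, the range where these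
    moments are finite and are computed from the characteristic function ([stable_abs_moment]).

    Uniqueness of the extension follows from the density of Schwartz functions in L^p(mu)
    ([schwartz_dense]). Density and Fourier uniqueness rest on the same device: indicators of cubes
    are pointwise limits of Schwartz functions exp(-Q) with Q a polynomial. *)

Section row_norm.
Context {R : realType} {d : nat}.
Implicit Types (x y : 'rV[R]_d).

(** * Coordinates, sup norm and inner product of row vectors *)

Lemma normr_coord x i : `|x ord0 i| <= `|x|.
Proof.
rewrite [leRHS]/Num.Def.normr/= mx_normrE.
exact: (le_bigmax _ (fun ij : 'I_1 * 'I_d => `|x ij.1 ij.2|) (ord0, i)).
Qed.

Lemma row_norm_le x (e : R) : 0 <= e -> (forall i, `|x ord0 i| <= e) -> `|x| <= e.
Proof.
move=> e0 xe; rewrite /Num.Def.normr/= mx_normrE.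
by apply/bigmax_leP; split => // -[i j] _ /=; rewrite ord1.
Qed.

Definition set_coord (k : 'I_d) (s : R) x : 'rV[R]_d :=
  \row_j (if j == k then s else x ord0 j).

Lemma set_coord_dist k s s' x y :
  `|set_coord k s x - set_coord k s' y| <= `|s - s'| + `|x - y|.
Proof.
apply: row_norm_le => [|i]; first by rewrite addr_ge0.
rewrite !mxE; case: eqP => _; first by rewrite lerDl.
by have := normr_coord (x - y) i; rewrite !mxE => /le_trans; apply; rewrite lerDr.
Qed.

Lemma dotpDl x y z : dotp (x + y) z = dotp x z + dotp y z.
Proof.
by rewrite /dotp -big_split; apply: eq_bigr => i _; rewrite mxE mulrDl.
Qed.

Lemma dotpZl (a : R) x z : dotp (a *: x) z = a * dotp x z.
Proof. by rewrite /dotp mulr_sumr; apply: eq_bigr => i _; rewrite mxE mulrA. Qed.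

Lemma dotpC x z : dotp x z = dotp z x.
Proof. by apply: eq_bigr => i _; rewrite mulrC. Qed.

Lemma dotpDr x y z : dotp z (x + y) = dotp z x + dotp z y.
Proof. by rewrite dotpC dotpDl !(dotpC z). Qed.

Lemma dotpZr (a : R) x z : dotp z (a *: x) = a * dotp z x.
Proof. by rewrite dotpC dotpZl (dotpC z). Qed.

Lemma dotp_delta x i : dotp x (delta_mx ord0 i) = x ord0 i.
Proof.
rewrite /dotp (bigD1 i)//= big1 ?mxE ?eqxx ?mulr1 ?addr0// => j ji.
by rewrite mxE eqxx/= (negbTE ji) mulr0.
Qed.

Lemma dotp_norm_le x y : `|dotp x y| <= (\sum_i `|y ord0 i|) * `|x|.
Proof.
rewrite /dotp mulr_suml; apply: (le_trans (ler_norm_sum _ _ _)).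
apply: ler_sum => i _; rewrite normrM mulrC.
by rewrite ler_wpM2l ?normr_ge0 ?normr_coord.
Qed.

End row_norm.

(** * Bounded Lipschitz functions and elementary trigonometric bounds *)

Section bounded_lipschitz.
Context {R : realType} {d : nat}.
Implicit Types (f g : 'rV[R]_d -> R).

(** The constants are parameters because limits are taken along sequences that share them. Distances
    are in the sup norm of the matrix space. *)
Definition bounded_lipschitz (M L : R) f :=
  (forall x, `|f x| <= M) /\ (forall x y, `|f x - f y| <= L * `|x - y|).

Lemma bounded_lipschitzM M1 L1 M2 L2 f g :
  bounded_lipschitz M1 L1 f -> bounded_lipschitz M2 L2 g ->
  bounded_lipschitz (M1 * M2) (M1 * L2 + L1 * M2) (fun x => f x * g x).
Proof.
move=> [f1 f2] [g1 g2]; split => [x|x y].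
  by rewrite normrM ler_pM.
have -> : f x * g x - f y * g y = f x * (g x - g y) + (f x - f y) * g y by ring.
rewrite [leRHS]mulrDl (le_trans (ler_normD _ _))// !normrM lerD//.
  by rewrite -mulrA ler_pM.
by rewrite mulrAC ler_pM.
Qed.

Lemma cos_lipschitz (a b : R) : `|cos a - cos b| <= `|a - b|.
Proof.
wlog ab : a b / a < b => [hw|].
  have [/hw//|/hw|->] := ltgtP a b; last by rewrite !subrr.
  by rewrite distrC (distrC b).
have [c _ cE] := @MVT R cos (fun x => - sin x) a b ab
  (fun x _ => is_derive_cos x) (continuous_subspaceT (@continuous_cos R)).
rewrite distrC cE normrM (distrC a) ler_piMl// normrN ler_norml.
by rewrite sin_geN1 sin_le1.
Qed.

Lemma sin_lipschitz (a b : R) : `|sin a - sin b| <= `|a - b|.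
Proof.
have := cos_lipschitz (a - pi / 2) (b - pi / 2).
by rewrite !cosBpihalf opprB addrA addrNK.
Qed.

(** A crude second-order bound: it is applied at y = x/n and multiplied by n, which leaves an error
    of order 1/n. *)
Lemma sin_sub_id_le (y : R) : `|sin y - y| <= y ^+ 2.
Proof.
wlog y0 : y / 0 < y => [hw|].
  have [/hw//|y0|<-] := ltgtP 0 y; last by rewrite sin0 subrr normr0 expr0n.
  have := hw (- y); rewrite oppr_gt0 => /(_ y0).
  by rewrite sinN -opprB normrN opprK addrC sqrrN.
have [c /andP[]] := @MVT R sin cos 0 y y0
  (fun x _ => is_derive_sin x) (continuous_subspaceT (@continuous_sin R)).
rewrite !bnd_simp => c0 cy; rewrite sin0 !subr0 => ->.
have -> : cos c * y - y = (cos c - cos 0) * y by rewrite cos0; ring.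
rewrite normrM (gtr0_norm y0) expr2 ler_wpM2r ?(ltW y0)//.
by rewrite (le_trans (cos_lipschitz _ _))// subr0 gtr0_norm// ltW.
Qed.

Lemma bounded_lipschitz_cos (xi : 'rV[R]_d) (c : R) :
  bounded_lipschitz 1 (\sum_i `|xi ord0 i|) (fun x => cos (dotp x xi + c)).
Proof.
split => [x|x y]; first by rewrite ler_norml cos_geN1 cos_le1.
rewrite (le_trans (cos_lipschitz _ _))// opprD addrACA subrr addr0.
rewrite -mulN1r -dotpZl -dotpDl scaleN1r; exact: dotp_norm_le.
Qed.

End bounded_lipschitz.

(** * Quantitative Bernstein approximation *)

(* [bernstein_sum p h phi n s] is the mean of [phi (s + h * S)] for [S]
   binomial of parameters [n] and [p], i.e. a Bernstein polynomial in [p]. *)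
Section bernstein.
Context {R : realType}.
Implicit Types (p h s : R) (phi psi : R -> R).

Fixpoint bernstein_sum p h phi n s :=
  if n is m.+1 then
    p * bernstein_sum p h phi m (s + h) + (1 - p) * bernstein_sum p h phi m s
  else phi s.

Lemma convex_norm_le p (a b e e' : R) : 0 <= p <= 1 -> `|a| <= e -> `|b| <= e' ->
  `|p * a + (1 - p) * b| <= p * e + (1 - p) * e'.
Proof.
move=> /andP[p0 p1] ae be; have p1' : 0 <= 1 - p by rewrite subr_ge0.
rewrite (le_trans (ler_normD _ _))// !normrM (ger0_norm p0) (ger0_norm p1').
by rewrite lerD// ler_wpM2l.
Qed.

Lemma bernstein_sum_dist p h phi psi n s e : 0 <= p <= 1 ->
  (forall s, `|phi s - psi s| <= e) ->
  `|bernstein_sum p h phi n s - bernstein_sum p h psi n s| <= e.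
Proof.
move=> p01 fg; elim: n s => [//|n IH] s /=.
set a := bernstein_sum _ _ phi n _; set b := bernstein_sum _ _ phi n _.
set a' := bernstein_sum _ _ psi n _; set b' := bernstein_sum _ _ psi n _.
have -> : p * a + (1 - p) * b - (p * a' + (1 - p) * b') =
          p * (a - a') + (1 - p) * (b - b') by ring.
rewrite (le_trans (convex_norm_le p01 (IH _) (IH _)))//.
by rewrite -mulrDl subrKC mul1r.
Qed.

Lemma bernstein_sum_norm p h phi n s M : 0 <= p <= 1 ->
  (forall s, `|phi s| <= M) -> `|bernstein_sum p h phi n s| <= M.
Proof.
move=> p01 fM; have {}fM t : `|phi t - 0| <= M by rewrite subr0.
rewrite -[X in `|X|]subr0.
have <- : bernstein_sum p h (fun=> 0) n s = 0.
  by elim: n s => //= n IH s; rewrite !IH !mulr0 addr0.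
exact: bernstein_sum_dist.
Qed.

Lemma bernstein_sum_lipschitz p h phi n L : 0 <= p <= 1 ->
  (forall s t, `|phi s - phi t| <= L * `|s - t|) ->
  forall s t, `|bernstein_sum p h phi n s - bernstein_sum p h phi n t|
    <= L * `|s - t|.
Proof.
move=> p01 fL; elim: n => [//|n IH] s t /=.
set a := bernstein_sum _ _ _ _ (s + h); set b := bernstein_sum _ _ _ _ s.
set a' := bernstein_sum _ _ _ _ (t + h); set b' := bernstein_sum _ _ _ _ t.
have -> : p * a + (1 - p) * b - (p * a' + (1 - p) * b') =
          p * (a - a') + (1 - p) * (b - b') by ring.
rewrite (le_trans (convex_norm_le p01 (IH _ _) (IH _ _)))//.
have -> : s + h - (t + h) = s - t by ring.
by rewrite -mulrDl subrKC mul1r.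
Qed.

(** Changing the parameter in a single Bernoulli step moves the mean by p - p' times an increment
    over one step h; the n steps add up. *)
Lemma bernstein_sum_lipschitz_param p p' h phi n s L : 0 <= p <= 1 -> 0 <= p' <= 1 ->
  (forall s t, `|phi s - phi t| <= L * `|s - t|) ->
  `|bernstein_sum p h phi n s - bernstein_sum p' h phi n s|
    <= n%:R * (`|p - p'| * (L * `|h|)).
Proof.
move=> p01 p'01 fL; elim: n s => [|n IH] s /=.
  by rewrite subrr normr0 mul0r.
set a := bernstein_sum p _ _ _ (s + h); set b := bernstein_sum p _ _ _ s.
set a' := bernstein_sum p' _ _ _ (s + h); set b' := bernstein_sum p' _ _ _ s.
have -> : p * a + (1 - p) * b - (p' * a' + (1 - p') * b') =
  (p * (a - a') + (1 - p) * (b - b')) + (p - p') * (a' - b') by ring.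
rewrite (le_trans (ler_normD _ _))// -natr1 [in leRHS]mulrDl mul1r lerD//.
  rewrite (le_trans (convex_norm_le p01 (IH _) (IH _)))//.
  by rewrite -mulrDl subrKC mul1r.
rewrite normrM ler_wpM2l//.
have -> : `|h| = `|s + h - s| by rewrite addrAC subrr add0r.
exact: bernstein_sum_lipschitz.
Qed.

(** A quadratic majorant is integrated exactly by the binomial law: squared bias plus the variance n
    h^2 p (1 - p). *)
Lemma bernstein_sum_second_moment p h phi n s (A a b c : R) : 0 <= p <= 1 ->
  (forall s, `|phi s - A| <= a + b * (s - c) ^+ 2) ->
  `|bernstein_sum p h phi n s - A| <=
    a + b * ((s + n%:R * (h * p) - c) ^+ 2 + n%:R * (h ^+ 2 * (p * (1 - p)))).
Proof.
move=> p01 fA; elim: n s => [|n IH] s /=.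
  by rewrite !mul0r !addr0.
set u := bernstein_sum _ _ _ _ (s + h); set v := bernstein_sum _ _ _ _ s.
have -> : p * u + (1 - p) * v - A = p * (u - A) + (1 - p) * (v - A) by ring.
rewrite (le_trans (convex_norm_le p01 (IH _) (IH _)))//.
by rewrite le_eqVlt; apply/orP; left; apply/eqP; rewrite -natr1; ring.
Qed.

(** Chebyshev's argument: w <= e + w^2 / e replaces the Lipschitz bound by a quadratic one centred
    at the mean, which the second moment evaluates. *)
Lemma bernstein_sum_mean p h phi n s L e : 0 <= p <= 1 -> 0 < e -> 0 <= L ->
  (forall s t, `|phi s - phi t| <= L * `|s - t|) ->
  `|bernstein_sum p h phi n s - phi (s + n%:R * (h * p))| <=
    L * (e + n%:R * h ^+ 2 / e).
Proof.
move=> p01 e0 L0 fL; set c := s + _.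
have fA t : `|phi t - phi c| <= L * e + L / e * (t - c) ^+ 2.
  rewrite (le_trans (fL _ _))// -mulrA -mulrDr ler_wpM2l//.
  rewrite -(ler_pM2l e0) mulrDr mulrA divff ?gt_eqF// mul1r -real_normK ?num_real//.
  have := normr_ge0 (t - c); move: `|_| => w w0; nra.
rewrite (le_trans (bernstein_sum_second_moment h n s p01 fA))//.
rewrite -/c subrr expr0n/= add0r [leRHS]mulrDr lerD2l -[leLHS]mulrA ler_wpM2l//.
rewrite mulrC ler_wpM2r ?invr_ge0 ?(ltW e0)// ler_wpM2l// ler_piMr ?sqr_ge0//.
by case/andP: p01 => p0 p1; nra.
Qed.

End bernstein.

(** * Reaching bounded Lipschitz functions from cosines *)

Section trigonometric_induction.
Context {R : realType} {d : nat}.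
Variable V : ('rV[R]_d -> R) -> Prop.
Hypothesis V_lin : forall (a : R) f g, V f -> V g -> V (fun x => a * f x + g x).
Hypothesis V_cos : forall xi (c : R), V (fun x => cos (dotp x xi + c)).
Hypothesis V_lim : forall M L (f_ : nat -> 'rV[R]_d -> R) f,
  (forall n, V (f_ n)) -> (forall n, bounded_lipschitz M L (f_ n)) ->
  (forall x, f_ n x @[n --> \oo] --> f x) -> V f.

Let V_scale (a : R) f : V f -> V (fun x => a * f x).
Proof.
move=> Vf; have V0 : V (fun=> 0).
  rewrite (_ : (fun=> 0) = (fun x => -1 * f x + f x)); first exact: V_lin.
  by apply/funext => x; rewrite mulN1r addNr.
rewrite (_ : (fun _ => _) = (fun x => a * f x + (fun=> 0) x)); first exact: V_lin.
by apply/funext => x; rewrite addr0.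
Qed.

Let tail k (g : 'rV[R]_d -> R) := forall x y : 'rV[R]_d,
  (forall j : 'I_d, (k <= j)%N -> x ord0 j = y ord0 j) -> g x = g y.

(** The induction invariant, from k = d, where g is constant, down to k = 0, where g is arbitrary.
    The cosine factor is carried along in order to absorb the trigonometric polynomials produced in
    each new coordinate. *)
Let Vtail k := forall M L g, 0 <= L -> bounded_lipschitz M L g -> tail k g ->
  forall xi c, V (fun x => g x * cos (dotp x xi + c)).

Section step.
Variable k : 'I_d.
Hypothesis Vk1 : Vtail k.+1.
Variables (M L : R) (g : 'rV[R]_d -> R).
Hypotheses (L0 : 0 <= L) (gML : bounded_lipschitz M L g) (gk : tail k g).

(** The success probability of a binomial walk which starts at -l and makes n+1 steps of length
    2l/(n+1): its mean is l sin(x_k / l), while its dependence on x is trigonometric. *)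
Let prm (l : R) (x : 'rV[R]_d) := (1 + sin (x ord0 k / l)) / 2.

Let prm01 l x : 0 <= prm l x <= 1.
Proof.
have := sin_geN1 (x ord0 k / l); have := sin_le1 (x ord0 k / l).
by rewrite /prm => s1 sN1; apply/andP; split; lra.
Qed.

Let mean_prm l x (n : nat) :
  0 < l -> - l + n.+1%:R * (2 * l / n.+1%:R * prm l x) = l * sin (x ord0 k / l).
Proof.
by move=> l0; rewrite /prm; field; rewrite addrC natr1 pnatr_eq0.
Qed.

(** Each unfolding of the Bernstein recursion freezes the coordinate k and multiplies by [prm] or 1
    - [prm], i.e. by a sine up to constants; products of a sine and a cosine are sums of cosines, so
    the invariant applies with shifted frequencies. *)
Let V_bernstein l h n s xi c :
  V (fun x => bernstein_sum (prm l x) h (fun s => g (set_coord k s x)) n s *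
              cos (dotp x xi + c)).
Proof.
elim: n s xi c => [|n IH] s xi c /=.
  apply: (Vk1 (M := M) L0).
    case: gML => g1 g2; split => // x y; apply: (le_trans (g2 _ _)).
    rewrite ler_wpM2l//; have := set_coord_dist k s s x y.
    by rewrite subrr normr0 add0r.
  move=> x y xy; apply: gk => j kj; rewrite !mxE; case: eqP => // /eqP jk.
  by apply: xy; rewrite ltn_neqAle kj andbT eq_sym.
pose B x t := bernstein_sum (prm l x) h (fun s => g (set_coord k s x)) n t.
pose F x := B x (s + h); pose G x := B x s.
rewrite -[X in V X]/(fun x => (prm l x * F x + (1 - prm l x) * G x) * cos (dotp x xi + c)).
(* The frequency for which [dotp x eta] is x_k / l; the product formulas shift xi by plus or minus
   eta, and sines are cosines with phase - pi / 2. *)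
pose eta : 'rV[R]_d := l^-1 *: delta_mx ord0 k.
have eta_dotp x : dotp x eta = x ord0 k / l by rewrite dotpZr dotp_delta mulrC.
have eta_dotpN x : dotp x (- eta) = - (x ord0 k / l).
  by rewrite -scaleN1r dotpZr eta_dotp mulN1r.
have -> : (fun x => (prm l x * F x + (1 - prm l x) * G x) * cos (dotp x xi + c)) =
  (fun x => 2^-1 * (F x * cos (dotp x xi + c)) + (2^-1 * (G x * cos (dotp x xi + c)) +
   (4^-1 * (F x * cos (dotp x (xi + eta) + (c - pi / 2))) +
   (- 4^-1 * (F x * cos (dotp x (xi - eta) + (c - pi / 2))) +
   (- 4^-1 * (G x * cos (dotp x (xi + eta) + (c - pi / 2))) +
    4^-1 * (G x * cos (dotp x (xi - eta) + (c - pi / 2)))))))).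
  apply/funext => x.
  rewrite /prm !dotpDr eta_dotpN eta_dotp !addrA !cosBpihalf.
  rewrite !(addrAC _ _ c) sinD sinB.
  by field.
repeat apply: V_lin; exact: IH || exact/V_scale/IH.
Qed.

Let bl_bernstein l n :
  0 < l -> bounded_lipschitz M (L + L) (fun x =>
    bernstein_sum (prm l x) (2 * l / n.+1%:R) (fun s => g (set_coord k s x)) n.+1 (- l)).
Proof.
move=> l0; case: gML => g1 g2; split => [x|x y].
  exact: bernstein_sum_norm.
set h := _ / _; pose B x y := bernstein_sum (prm l x) h (fun s => g (set_coord k s y)) n.+1 (- l).
rewrite -[X in `|X|]/(B x x - B y y).
have -> : B x x - B y y = (B x x - B x y) + (B x y - B y y) by ring.
rewrite (le_trans (ler_normD _ _))// mulrDl lerD//.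
  apply: bernstein_sum_dist => // s; apply: (le_trans (g2 _ _)); rewrite ler_wpM2l//.
  by have := set_coord_dist k s s x y; rewrite subrr normr0 add0r.
apply: le_trans (_ : n.+1%:R * (`|prm l x - prm l y| * (L * `|h|)) <= _).
  apply: bernstein_sum_lipschitz_param => // s t.
  apply: (le_trans (g2 _ _)); rewrite ler_wpM2l//.
  by have := set_coord_dist k s t y y; rewrite subrr normr0 addr0.
have h0 : 0 < h by rewrite divr_gt0 ?mulr_gt0.
rewrite (gtr0_norm h0) /h.
have -> : n.+1%:R * (`|prm l x - prm l y| * (L * (2 * l / n.+1%:R))) =
  L * (2 * l * `|prm l x - prm l y|).
  by field; rewrite addrC natr1 pnatr_eq0.
rewrite ler_wpM2l//.
have -> : prm l x - prm l y = (sin (x ord0 k / l) - sin (y ord0 k / l)) / 2.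
  by rewrite /prm; ring.
rewrite normrM (@gtr0_norm _ 2^-1) ?invr_gt0// mulrC.
have -> : `|sin (x ord0 k / l) - sin (y ord0 k / l)| / 2 * (2 * l) =
  `|sin (x ord0 k / l) - sin (y ord0 k / l)| * l by field.
rewrite -ler_pdivlMr// (le_trans (sin_lipschitz _ _))//.
rewrite -mulrBl normrM (@gtr0_norm _ l^-1) ?invr_gt0// ler_pM2r ?invr_gt0//.
by have := normr_coord (x - y) k; rewrite !mxE.
Qed.

Let V_sin l xi c : 0 < l ->
  V (fun x => g (set_coord k (l * sin (x ord0 k / l)) x) * cos (dotp x xi + c)).
Proof.
move=> l0; case: (gML) => g1 g2.
apply: (V_lim (f_ := fun n x => bernstein_sum (prm l x) (2 * l / n.+1%:R)
   (fun s => g (set_coord k s x)) n.+1 (- l) * cos (dotp x xi + c))).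
- by move=> n; exact: V_bernstein.
- move=> n; apply: bounded_lipschitzM; [exact: bl_bernstein|exact: bounded_lipschitz_cos].
move=> x; apply: cvgMl => /=.
apply/cvgrPdist_le => /= e e0.
(* The Bernstein estimate is L (e1 + 4 l^2 / (e1 (n+1))), at most 2 L e1 <= e for large n; L + 1
   avoids a division by zero when L = 0. *)
pose e1 := e / (2 * (L + 1)).
have e10 : 0 < e1 by rewrite divr_gt0// mulr_gt0// ltr_wpDl.
near=> n; rewrite distrC -(mean_prm x n l0).
have phiL s t : `|g (set_coord k s x) - g (set_coord k t x)| <= L * `|s - t|.
  apply: (le_trans (g2 _ _)); rewrite ler_wpM2l//.
  by have := set_coord_dist k s t x x; rewrite subrr normr0 addr0.
apply: (le_trans (bernstein_sum_mean (2 * l / n.+1%:R) n.+1 (- l)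
  (prm01 l x) e10 L0 phiL)).
have -> : n.+1%:R * (2 * l / n.+1%:R) ^+ 2 / e1 = (4 * l ^+ 2) / e1 / n.+1%:R.
  have : n.+1%:R != 0 :> R by rewrite pnatr_eq0.
  by move: n.+1%:R => N N0; field; rewrite N0 gt_eqF.
apply: le_trans (_ : L * (e1 + e1) <= _).
  rewrite ler_wpM2l// lerD2l ler_pdivrMr// [leRHS]mulrC -ler_pdivrMr//.
  apply: (@le_trans _ _ n%:R); last by rewrite ler_nat.
  near: n; exact: nbhs_infty_ger.
have -> : L * (e1 + e1) = e * (L / (L + 1)).
  by rewrite /e1; field; rewrite gt_eqF// ltr_wpDl.
by rewrite ler_piMr ?ltW// ltr_pdivrMr ?mul1r ?ltrDl// ltr_wpDl.
Unshelve. all: end_near. Qed.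

(** Lets the period go to infinity: l sin(x_k / l) tends to x_k for l = n+1, with Lipschitz
    constants that stay bounded because t -> l sin(t / l) is 1-Lipschitz. *)
Lemma trig_step xi c : V (fun x => g x * cos (dotp x xi + c)).
Proof.
case: (gML) => g1 g2.
apply: (V_lim (f_ := fun n x => g (set_coord k (n.+1%:R * sin (x ord0 k / n.+1%:R)) x)
   * cos (dotp x xi + c))).
- by move=> n; exact: V_sin.
- move=> n; apply: bounded_lipschitzM; last exact: bounded_lipschitz_cos.
  split => [x|x y]; first exact: g1.
  apply: le_trans (_ : (L + L) * `|x - y| <= _); last by [].
  apply: (le_trans (g2 _ _)); rewrite mulrDl -mulrDr ler_wpM2l//.
  rewrite (le_trans (set_coord_dist _ _ _ _ _))// lerD2r.
  rewrite -mulrBr normrM ger0_norm// mulrC -ler_pdivlMr//.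
  rewrite (le_trans (sin_lipschitz _ _))//.
  rewrite -mulrBl normrM (@gtr0_norm _ n.+1%:R^-1) ?invr_gt0// ler_pM2r ?invr_gt0//.
  by have := normr_coord (x - y) k; rewrite !mxE.
move=> x; apply: cvgMl => /=.
have xE : x = set_coord k (x ord0 k) x.
  by apply/rowP => j; rewrite mxE; case: eqP => [->|].
have nsin : n.+1%:R * sin (x ord0 k / n.+1%:R) @[n --> \oo] --> x ord0 k.
  apply/cvgrPdist_le => /= e e0; near=> n.
  set y := x ord0 k / n.+1%:R.
  have -> : x ord0 k - n.+1%:R * sin y = - (n.+1%:R * (sin y - y)).
    by rewrite mulrBr opprB [_ * y]mulrC /y divfK ?pnatr_eq0.
  rewrite normrN normrM ger0_norm//.
  apply: (@le_trans _ _ (n.+1%:R * y ^+ 2)).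
    by rewrite ler_wpM2l// sin_sub_id_le.
  have -> : n.+1%:R * y ^+ 2 = x ord0 k ^+ 2 / n.+1%:R.
    have : n.+1%:R != 0 :> R by rewrite pnatr_eq0.
    by rewrite /y; move: n.+1%:R => N N0; field.
  rewrite ler_pdivrMr// [leRHS]mulrC -ler_pdivrMr//.
  apply: (@le_trans _ _ n%:R); last by rewrite ler_nat.
  near: n; exact: nbhs_infty_ger.
apply/cvgrPdist_le => /= e e0; near=> n.
rewrite [in X in g X - _]xE (le_trans (g2 _ _))//.
apply: (@le_trans _ _ ((L + 1) * `|x ord0 k - n.+1%:R * sin (x ord0 k / n.+1%:R)|)).
  have := set_coord_dist k (x ord0 k) (n.+1%:R * sin (x ord0 k / n.+1%:R)) x x.
  rewrite subrr normr0 addr0 => /(ler_wpM2l L0)/le_trans; apply.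
  by rewrite ler_wpM2r// lerDl.
rewrite mulrC -ler_pdivlMr ?ltr_wpDl//.
near: n; move/cvgrPdist_le : nsin; apply.
by rewrite divr_gt0// ltr_wpDl.
Unshelve. all: end_near. Qed.

End step.

(** An induction principle: a property closed as in the section hypotheses holds for all bounded
    Lipschitz functions. It is used both for Fourier uniqueness and for the integration by parts. *)
Lemma trigonometric_induction M L f : bounded_lipschitz M L f -> V f.
Proof.
move=> fML.
have L0 : 0 <= `|L| by [].
have {}fML : bounded_lipschitz M `|L| f.
  case: fML => f1 f2; split => // x y; apply: (le_trans (f2 _ _)).
  by rewrite ler_wpM2r// ler_norm.
have Vd k : (k <= d)%N -> Vtail (d - k)%N.
  elim: k => [_|k IH kd] M' L' g L'0 gML gk xi c.
    rewrite (_ : (fun _ => _) = (fun x => g 0 * cos (dotp x xi + c))); last first.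
      apply/funext => x; congr (_ * _); apply: gk => j.
      by rewrite subn0 leqNgt ltn_ord.
    exact/V_scale/V_cos.
  have kd' : (d - k.+1 < d)%N by rewrite ltn_subrL (leq_trans _ kd).
  apply: (@trig_step (Ordinal kd') _ M' L' g L'0 gML gk).
  by rewrite /= subnSK//; apply: IH; exact: ltnW.
have := Vd d (leqnn _) _ _ f L0 fML.
(* Frequency and phase zero turn the auxiliary cosine factor into 1. *)
rewrite subnn => /(_ _ 0 0).
rewrite (_ : (fun _ => _) = f); first by apply=> x y xy; congr f; apply/rowP => j; exact: xy.
apply/funext => x.
by rewrite dotpC /dotp big1 ?addr0 ?cos0 ?mulr1// => i _; rewrite mxE mul0r.
Qed.

End trigonometric_induction.

(** * The Borel sigma-algebra of R^d through cubes *)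

Section row_borel.
Context {R : realType} {d : nat}.
Implicit Types (x a : 'rV[R]_d).

Definition cube a (e : R) : set 'rV[R]_d :=
  [set x | forall i, `|x ord0 i - a ord0 i| < e].

(** Rational centres and radii 1/(n+1) make the union countable; a point is caught by taking a
    radius below half of its distance margin in the open set. *)
Lemma open_bigcup_cube (U : set 'rV[R]_d) : open U ->
  U = \bigcup_(i in [set i : 'rV[rat]_d * nat |
        cube (map_mx ratr i.1) i.2.+1%:R^-1 `<=` U])
      cube (map_mx ratr i.1) i.2.+1%:R^-1.
Proof.
move=> oU; apply/seteqP; split => [x Ux|x [i /= iU xi]]; last exact: iU.
have /nbhs_ballP[e /= e0 eU] : nbhs x U by apply: open_nbhs_nbhs.
have [N _ Ne] := near_infty_natSinv_lt (PosNum (divr_gt0 e0 (ltr0n R 2))).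
have {Ne}Ne : N.+1%:R^-1 < e / 2 by exact: (Ne N (leqnn N)).
have /choice[q qP] : forall i : 'I_d, exists q : rat,
    x ord0 i - N.+1%:R^-1 < ratr q < x ord0 i + N.+1%:R^-1.
  move=> i; have [|q] := @rat_in_itvoo R (x ord0 i - N.+1%:R^-1) (x ord0 i + N.+1%:R^-1).
    by rewrite ltrBlDr -addrA ltrDl addr_gt0// invr_gt0.
  by rewrite in_itv/= => qi; exists q.
have xq i : `|x ord0 i - ratr (q i)| < N.+1%:R^-1.
  by case/andP: (qP i) => q1 q2; rewrite ltr_distlC q1 q2.
exists (\row_i q i, N) => /=; last by move=> i; rewrite !mxE.
move=> y yq; apply: eU; split => // i j; rewrite ord1.
rewrite -ball_normE/= (le_lt_trans (ler_distD (ratr (q j)) _ _))//.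
rewrite (splitr e) ltrD// (lt_trans _ Ne)//.
by have := yq j; rewrite !mxE distrC.
Qed.

Lemma cube_bigcap a e : cube a e = \bigcap_i [set x | `|x ord0 i - a ord0 i| < e].
Proof. by apply/seteqP; split => [x h i _|x h i]; [exact: h|exact: (h i Logic.I)]. Qed.

(** Open sets are countable unions of cubes, and a cube is a finite intersection of coordinate
    conditions. *)
Lemma measurable_row dT (T : measurableType dT) (f : T -> 'rV[R]_d) :
  (forall i, measurable_fun setT (fun t => f t ord0 i)) -> measurable_fun setT f.
Proof.
move=> mf; apply: (measurability (@open 'rV[R]_d)) => // _ [U oU <-].
rewrite setTI (open_bigcup_cube oU) preimage_bigcup.
have -> : \bigcup_(i in [set i : 'rV[rat]_d * nat |
        cube (map_mx ratr i.1) i.2.+1%:R^-1 `<=` U])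
      f @^-1` cube (map_mx ratr i.1) i.2.+1%:R^-1 =
   \bigcup_i (if `[< cube (map_mx ratr i.1) i.2.+1%:R^-1 `<=` U >] then
      f @^-1` cube (map_mx ratr i.1) i.2.+1%:R^-1 else set0).
  apply/seteqP; split => [t [i iU ti]|t [i _]]; first by exists i => //; rewrite asboolT.
  by case: asboolP => // iU ti; exists i.
apply: countable_bigcupT_measurable; first exact: countableP.
move=> i; case: ifP => // _.
rewrite cube_bigcap preimage_bigcap; apply: fin_bigcap_measurable => //.
move=> j _; rewrite -[X in measurable X]setTI.
have : measurable_fun setT (fun t => `|f t ord0 j - map_mx ratr i.1 ord0 j|).
  by apply: measurableT_comp => //; apply: measurable_funB.
move=> /(_ measurableT [set` `]-oo, i.2.+1%:R^-1[]) .
by apply.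
Qed.

Lemma measurable_fun_continuous (f : 'rV[R]_d -> R) :
  continuous f -> measurable_fun setT f.
Proof.
move=> cf; apply: (measurability _ (RGenOpens.measurableE R)).
move=> _ [_ [a [b ->] <-]]; rewrite setTI; apply: sub_sigma_algebra.
by move/continuousP : cf; apply; exact: interval_open.
Qed.

Lemma measurable_coord i : measurable_fun setT (fun x : 'rV[R]_d => x ord0 i).
Proof. apply: measurable_fun_continuous => x; exact: coord_continuous. Qed.

Lemma measurable_cube a e : measurable (cube a e).
Proof.
rewrite cube_bigcap; apply: fin_bigcap_measurable => // i _.
rewrite -[X in measurable X]setTI.
have : measurable_fun setT (fun x : 'rV[R]_d => `|x ord0 i - a ord0 i|).
  by apply: measurableT_comp => //; apply: measurable_funB => //; exact: measurable_coord.
by move=> /(_ measurableT [set` `]-oo, e[]); apply.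
Qed.

Lemma measurable_rowE (G : set (set 'rV[R]_d)) :
  (forall a e, 0 < e -> G (cube a e)) -> G `<=` measurable ->
  (measurable : set (set 'rV[R]_d)) = <<s G >>.
Proof.
move=> Gc Gm; apply/seteqP; split; last first.
  by apply: smallest_sub => //; exact: sigma_algebra_measurable.
apply: smallest_sub; first exact: smallest_sigma_algebra.
move=> U oU; rewrite (open_bigcup_cube oU).
rewrite bigcup_mkcond.
apply: (@countable_bigcupT_measurable _ (g_sigma_algebraType G)); first exact: countableP.
move=> i; case: ifP => // _; apply: sub_sigma_algebra; apply: Gc.
by rewrite invr_gt0.
Qed.

Lemma bounded_lipschitz_continuous (M L : R) (f : 'rV[R]_d -> R) :
  bounded_lipschitz M L f -> continuous f.
Proof.
move=> [_ fL] x; have FF : Filter (nbhs x) := nbhs_filter x.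
apply/cvgrPdist_le => /= e e0.
have L1 : 0 < `|L| + 1 by rewrite ltr_wpDl.
have e'0 : 0 < e / (`|L| + 1) by rewrite divr_gt0.
apply: filterS (nbhsx_ballx x _ e'0) => y; rewrite -ball_normE/= => xy.
apply: (le_trans (fL _ _)).
apply: (@le_trans _ _ ((`|L| + 1) * `|x - y|)).
  by rewrite ler_wpM2r// (le_trans (ler_norm _))// lerDl.
by rewrite mulrC -ler_pdivlMr// ltW.
Qed.

Lemma bounded_lipschitz_measurable (M L : R) (f : 'rV[R]_d -> R) :
  bounded_lipschitz M L f -> measurable_fun setT f.
Proof. by move=> /bounded_lipschitz_continuous/measurable_fun_continuous. Qed.

Lemma measurable_dotp z : measurable_fun setT (fun x : 'rV[R]_d => dotp x z).
Proof.
apply: measurable_sum => i; apply: measurable_funM => //; exact: measurable_coord.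
Qed.

Lemma measurable_rowD dT (T : measurableType dT) (f g : T -> 'rV[R]_d) :
  measurable_fun setT f -> measurable_fun setT g ->
  measurable_fun setT (fun t => f t + g t).
Proof.
move=> mf mg; apply: measurable_row => i; under eq_fun do rewrite mxE.
by apply: measurable_funD; apply: measurableT_comp (measurable_coord i) _.
Qed.

Lemma measurable_rowZ dT (T : measurableType dT) (a : T -> R) (f : T -> 'rV[R]_d) :
  measurable_fun setT a -> measurable_fun setT f ->
  measurable_fun setT (fun t => a t *: f t).
Proof.
move=> ma mf; apply: measurable_row => i; under eq_fun do rewrite mxE.
by apply: measurable_funM => //; apply: measurableT_comp (measurable_coord i) _.
Qed.

Lemma measurable_enorm : measurable_fun setT (@enorm R d).
Proof.
apply: (measurableT_comp (continuous_measurable_fun (@sqrt_continuous R))).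
by apply: measurable_sum => i; apply: measurable_funM; exact: measurable_coord.
Qed.

End row_borel.

(** * Schwartz functions are bounded and Lipschitz *)

Section schwartz_lipschitz.
Context {R : realType} {d : nat}.
Implicit Types (x v : 'rV[R]_d).

Lemma derive_partials (f : 'rV[R]_d -> R) x v : differentiable f x ->
  'D_v f x = \sum_i v ord0 i * 'D_(delta_mx ord0 i) f x.
Proof.
move=> df; rewrite deriveE// [in LHS](row_sum_delta v) linear_sum.
by apply: eq_bigr => i _; rewrite linearZ /= deriveE.
Qed.

Lemma derivable_along (f : 'rV[R]_d -> R) x v (s : R) :
  differentiable f (x + s *: v) ->
  is_derive s 1 (fun s : R => f (x + s *: v)) ('D_v f (x + s *: v)).
Proof.
move=> df; have dv := @diff_derivable _ _ _ f (x + s *: v) v df.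
have E : (fun h : R => h^-1 *: ((fun s : R => f (x + s *: v)) (h *: 1 + s) - f (x + s *: v))) =
  (fun h : R => h^-1 *: (f (h *: v + (x + s *: v)) - f (x + s *: v))).
  apply/funext => h; congr (_ *: (f _ - _)).
  by rewrite addrCA scalerDl [h *: 1]mulr1.
by apply: DeriveDef; rewrite /derivable/derive /= E.
Qed.

(** Mean value theorem along the segment from y to x; the Lipschitz constant is the sum of the
    bounds of the first partial derivatives. *)
Lemma schwartz_bounded_lipschitz (f : 'rV[R]_d -> R) : schwartz f ->
  exists M L : R, bounded_lipschitz M L f.
Proof.
move=> [fd fb].
have /choice[C CP] : forall s, exists C : R, forall x, `|partials s f x| <= C.
  by move=> s; have [C CP] := fb s 0%N; exists C => x; have := CP x; rewrite expr0 mul1r.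
exists (C [::]), (\sum_i C [:: i]); split => [x|x y]; first exact: (CP [::]).
have cont : {within `[0, 1], continuous (fun s : R => f (y + s *: (x - y)))}.
  apply: continuous_subspaceT => s.
  apply: differentiable_continuous; apply/derivable1_diffP.
  by apply: ex_derive; exact: (derivable_along (fd [::] _)).
have [c _] := @MVT_segment R (fun s : R => f (y + s *: (x - y)))
  (fun s : R => 'D_(x - y) f (y + s *: (x - y))) 0 1 ler01
  (fun s _ => derivable_along (fd [::] _)) cont.
rewrite scale0r addr0 scale1r subrKC subr0 mulr1 => ->.
rewrite derive_partials; last exact: (fd [::]).
rewrite mulr_suml (le_trans (ler_norm_sum _ _ _))// ler_sum// => i _.
by rewrite normrM mulrC ler_pM ?normr_coord//; exact: (CP [:: i]).
Qed.

End schwartz_lipschitz.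

(** * A supply of Schwartz functions: polynomials times exp(-Q) *)

Section gaussians.
Context {R : realType} {d : nat}.
Implicit Types (x v : 'rV[R]_d) (f P Q : 'rV[R]_d -> R).

Inductive polyfun : ('rV[R]_d -> R) -> Prop :=
| polyfun_cst c : polyfun (fun=> c)
| polyfun_coord i : polyfun (fun x => x ord0 i)
| polyfunD P Q : polyfun P -> polyfun Q -> polyfun (P + Q)
| polyfunM P Q : polyfun P -> polyfun Q -> polyfun (P * Q).

Lemma polyfun_sum n (P : 'I_n -> 'rV[R]_d -> R) :
  (forall i, polyfun (P i)) -> polyfun (fun x => \sum_i P i x).
Proof.
elim: n P => [|n IH] P hP.
  by under eq_fun do rewrite big_ord0; exact: polyfun_cst.
under eq_fun do rewrite big_ord_recl.
by apply: polyfunD => //; exact: IH.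
Qed.

Lemma polyfunX P n : polyfun P -> polyfun (fun x => P x ^+ n).
Proof.
move=> hP; elim: n => [|n IH]; first exact: polyfun_cst.
by under eq_fun do rewrite exprS; exact: polyfunM.
Qed.

Lemma polyfun_differentiable P x : polyfun P -> differentiable P x.
Proof.
elim=> [c|i|{}P Q _ dP _ dQ|{}P Q _ dP _ dQ].
- exact: differentiable_cst.
- exact: differentiable_coord.
- exact: differentiableD.
- exact: differentiableM.
Qed.

Lemma derive_coord i v x : 'D_v (fun x : 'rV[R]_d => x ord0 i) x = v ord0 i.
Proof.
rewrite /derive; apply: cvg_lim => //; apply: (@cvg_near_cst _ _ _ _ 0^').
near=> h; rewrite /= !mxE addrK [LHS]mulrA mulVf ?mul1r//.
by near: h; exact: nbhs_dnbhs_neq.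
Unshelve. all: end_near. Qed.

Lemma polyfun_derive P v : polyfun P -> polyfun ('D_v P).
Proof.
elim=> [c|i|{}P Q hP dP hQ dQ|{}P Q hP dP hQ dQ].
- have -> : 'D_v (fun=> c) = (fun=> 0) :> ('rV[R]_d -> R).
    by apply/funext => x; exact: derive_cst.
  exact: polyfun_cst.
- have -> : 'D_v (fun x => x ord0 i) = (fun=> v ord0 i) :> ('rV[R]_d -> R).
    by apply/funext => x; exact: derive_coord.
  exact: polyfun_cst.
- have -> : 'D_v (P + Q) = 'D_v P + 'D_v Q.
    by apply/funext => x; rewrite deriveD//; exact/diff_derivable/polyfun_differentiable.
  exact: polyfunD.
- have -> : 'D_v (P * Q) = P * 'D_v Q + Q * 'D_v P.
    by apply/funext => x; rewrite deriveM//; exact/diff_derivable/polyfun_differentiable.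
  by apply: polyfunD; apply: polyfunM.
Qed.

Lemma polyfun_growth P : polyfun P ->
  exists m (C : R), 0 <= C /\ forall x, `|P x| <= C * (1 + `|x|) ^+ m.
Proof.
have x1 x : 1 <= 1 + `|x| by rewrite lerDl.
have x0 x : 0 <= 1 + `|x| by rewrite (le_trans _ (x1 x)).
elim=> [c|i|{}P Q _ [m [C [C0 PC]]] _ [m' [C' [C'0 QC]]]
  |{}P Q _ [m [C [C0 PC]]] _ [m' [C' [C'0 QC]]]].
- by exists 0%N, `|c|; split => // x; rewrite expr0 mulr1.
- exists 1%N, 1; split => // x; rewrite mul1r expr1.
  by rewrite (le_trans (normr_coord _ _))// lerDr.
- exists (m + m')%N, (C + C'); split => [|x]; first exact: addr_ge0.
  rewrite (le_trans (ler_normD _ _))// mulrDl lerD//.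
    by rewrite (le_trans (PC x))// ler_wpM2l// ler_weXn2l// leq_addr.
  by rewrite (le_trans (QC x))// ler_wpM2l// ler_weXn2l// leq_addl.
- exists (m + m')%N, (C * C'); split => [|x]; first exact: mulr_ge0.
  by rewrite normrM exprD mulrACA ler_pM.
Qed.

(** Linear growth from below suffices: exp(-Q) then decays exponentially and beats every
    polynomial. *)
Definition coercive Q := exists c C : R, 0 < c /\ forall x, c * `|x| - C <= Q x.

Lemma coerciveD Q Q' : coercive Q -> coercive Q' -> coercive (Q + Q').
Proof.
move=> [c [C [c0 QC]]] [c' [C' [c'0 Q'C']]].
exists (c + c'), (C + C'); split=> [|x]; first exact: addr_gt0.
rewrite /GRing.add/= (le_trans _ (lerD (QC x) (Q'C' x)))//.
by rewrite mulrDl opprD addrACA.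
Qed.

(** With k = min(1, c/(n+1)) one has k (1 + s) <= 1 + c s/(n+1) <= exp(c s/(n+1)); raise this to the
    power n. *)
Lemma expR_dominates n (c : R) : 0 < c ->
  exists2 K : R, 0 <= K & forall s, 0 <= s -> (1 + s) ^+ n <= K * expR (c * s).
Proof.
move=> c0; pose k : R := Num.min 1 (c / n.+1%:R).
have k0 : 0 < k by rewrite lt_min ltr01 divr_gt0.
exists (k ^- n); first by rewrite invr_ge0 exprn_ge0// ltW.
move=> s s0; rewrite mulrC ler_pdivlMr ?exprn_gt0// mulrC -exprMn.
have -> : expR (c * s) = expR (c * s / n.+1%:R) ^+ n.+1.
  by rewrite -expRM_natl [n.+1%:R * _]mulrC divfK ?pnatr_eq0.
apply: (@le_trans _ _ (expR (c * s / n.+1%:R) ^+ n)); last first.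
  rewrite ler_weXn2l// -[leLHS]expR0 ler_expR divr_ge0 ?mulr_ge0//; exact: ltW.
rewrite lerXn2r ?nnegrE ?expR_ge0 ?mulr_ge0 ?addr_ge0 ?(ltW k0)//.
apply: (le_trans _ (expR_ge1Dx _)); rewrite mulrDr mulr1 lerD ?ge_min ?lexx//.
by rewrite mulrAC ler_wpM2r// ge_min lexx orbT.
Qed.

Lemma enorm_le_norm x : enorm x <= (1 + d%:R) * `|x|.
Proof.
apply: (@le_trans _ _ (Num.sqrt (((1 + d%:R) * `|x|) ^+ 2))); last first.
  by rewrite sqrtr_sqr ger0_norm// mulr_ge0// addr_ge0.
rewrite /enorm ler_sqrt ?sqr_ge0//.
apply: (@le_trans _ _ (\sum_(i < d) `|x| ^+ 2)).
  apply: ler_sum => i _; rewrite -expr2 -real_normK ?num_real//.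
  by rewrite lerXn2r ?nnegrE// normr_coord.
rewrite sumr_const card_ord -[leLHS]mulr_natl [leRHS]exprMn ler_wpM2r ?sqr_ge0//.
by have : 0 <= d%:R :> R by []; move: d%:R => n; nra.
Qed.

(** Q may have any degree, so these are not only Gaussians. The polynomial prefactor makes the class
    stable under partial derivatives. *)
Definition gaussian f := exists P Q, [/\ polyfun P, polyfun Q, coercive Q
  & f = (fun x => P x * expR (- Q x))].

Let dexp Q x v : polyfun Q -> differentiable (fun x => expR (- Q x)) x /\
  'D_v (fun x => expR (- Q x)) x = - ('D_v Q x) * expR (- Q x).
Proof.
move=> hQ.
have dQ : differentiable (- Q) x by apply: differentiableN; exact: polyfun_differentiable.
have de : differentiable (@expR R) (- Q x) by exact/derivable1_diffP/derivable_expR.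
split; first exact: (@differentiable_comp _ _ _ _ (- Q) expR x dQ de).
rewrite deriveE; last exact: (@differentiable_comp _ _ _ _ (- Q) expR x dQ de).
have dNQ : 'd (- Q) x v = - 'D_v Q x.
  rewrite -deriveE// deriveN//; exact/diff_derivable/polyfun_differentiable.
rewrite (@diff_comp _ _ _ _ (- Q) expR x dQ de)/= dNQ.
by rewrite diff1E//= derive1E derive_val.
Qed.

Lemma gaussian_derive f x v : gaussian f ->
  differentiable f x /\ gaussian ('D_v f).
Proof.
move=> [P [Q [hP hQ cQ ->]]].
have dE y := dexp y v hQ.
split; first by apply: differentiableM; [exact: polyfun_differentiable|exact: (dE x).1].
exists ('D_v P - P * 'D_v Q), Q; split => //.
  apply: polyfunD; first exact: polyfun_derive.
  rewrite -mulrN; apply: polyfunM => //.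
  rewrite -mulN1r; apply: polyfunM; first exact: (polyfun_cst (-1)).
  exact: polyfun_derive.
apply/funext => y.
rewrite (@deriveM _ _ P); last 2 first.
  exact/diff_derivable/polyfun_differentiable.
  exact/diff_derivable/(dE y).1.
rewrite (dE y).2.
change (P y * (- 'D_v Q y * expR (- Q y)) + expR (- Q y) * 'D_v P y =
  ('D_v P y - P y * 'D_v Q y) * expR (- Q y)).
by ring.
Qed.

Lemma gaussian_decay f k : gaussian f ->
  exists C : R, forall x, (1 + enorm x) ^+ k * `|f x| <= C.
Proof.
move=> [P [Q [hP hQ [c [C [c0 QC]]] ->]]].
have [m [K [K0 PK]]] := polyfun_growth hP.
have [K' K'0 eK] := expR_dominates (k + m) c0.
exists ((1 + d%:R) ^+ k * K * (K' * expR C)) => x.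
rewrite normrM (@ger0_norm _ (expR _)) ?expR_ge0//.
apply: (@le_trans _ _ (((1 + d%:R) ^+ k * (1 + `|x|) ^+ k) *
   ((K * (1 + `|x|) ^+ m) * expR (C - c * `|x|)))).
  apply: ler_pM; rewrite ?mulr_ge0 ?expR_ge0 ?exprn_ge0 ?addr_ge0 ?sqrtr_ge0//.
    rewrite -exprMn lerXn2r ?nnegrE ?mulr_ge0 ?addr_ge0 ?sqrtr_ge0//.
    rewrite (le_trans (lerD (lexx _) (enorm_le_norm x)))//.
    by rewrite mulrDr mulr1 lerD2r lerDl.
  rewrite ler_pM ?expR_ge0// ler_expR; have := QC x; lra.
have -> : (1 + d%:R) ^+ k * (1 + `|x|) ^+ k * (K * (1 + `|x|) ^+ m * expR (C - c * `|x|)) =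
  ((1 + d%:R) ^+ k * K) * ((1 + `|x|) ^+ (k + m) * expR (C - c * `|x|)) by rewrite exprD; ring.
rewrite ler_wpM2l ?mulr_ge0 ?exprn_ge0 ?addr_ge0//.
rewrite expRD expRN mulrCA [leRHS]mulrC ler_wpM2l ?expR_ge0//.
by rewrite ler_pdivrMr ?expR_gt0// eK.
Qed.

Lemma gaussian_schwartz f : gaussian f -> schwartz f.
Proof.
move=> gf; have gs s : gaussian (partials s f).
  by elim: s => //= i s IH; exact: (gaussian_derive 0 _ IH).2.
split => s; first by move=> x; exact: (gaussian_derive x 0 (gs s)).1.
by move=> k; exact: gaussian_decay.
Qed.

Lemma expN_schwartz Q : polyfun Q -> coercive Q -> schwartz (fun x => expR (- Q x)).
Proof.
move=> hQ cQ; apply: gaussian_schwartz; exists (fun=> 1), Q; split => //.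
  exact: polyfun_cst.
by apply/funext => x; rewrite mul1r.
Qed.

End gaussians.

(** * Integrals of real-valued functions *)

Section real_integral.
Context dT (T : measurableType dT) (R : realType) (m : {measure set T -> \bar R}).
Implicit Types f g : T -> R.

Lemma integrable_dominated f g : measurable_fun setT f ->
  (forall x, `|f x| <= g x) -> m.-integrable setT (EFin \o g) ->
  m.-integrable setT (EFin \o f).
Proof.
move=> mf fg ig; apply: le_integrable ig => //; first exact/measurable_EFinP.
by move=> x _ /=; rewrite lee_fin (le_trans (fg x))// ler_norm.
Qed.

Lemma integrable_bounded f (M : R) : (m setT < +oo)%E -> measurable_fun setT f ->
  (forall x, `|f x| <= M) -> m.-integrable setT (EFin \o f).
Proof.
move=> mfin mf fM; apply: measurable_bounded_integrable => //.
exists M; split; rewrite ?num_real// => y My x _ /=.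
exact: (le_trans (fM x) (ltW My)).
Qed.

Lemma integrable_lin (a : R) f g : m.-integrable setT (EFin \o f) ->
  m.-integrable setT (EFin \o g) ->
  m.-integrable setT (EFin \o (fun x => a * f x + g x)).
Proof.
move=> fi gi.
have -> : EFin \o (fun x => a * f x + g x) =
  (fun x => a%:E * (EFin \o f) x + (EFin \o g) x)%E by [].
by apply: integrableD => //; exact: integrableZl.
Qed.

Lemma Rintegral_lin (a : R) f g : m.-integrable setT (EFin \o f) ->
  m.-integrable setT (EFin \o g) ->
  \int[m]_x (a * f x + g x) = a * \int[m]_x f x + \int[m]_x g x.
Proof.
move=> fi gi; rewrite RintegralD//; first by rewrite RintegralZl.
exact: integrableZl fi.
Qed.

Lemma integrable_measurable f :
  m.-integrable setT (EFin \o f) -> measurable_fun setT f.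
Proof. by move=> /measurable_int/measurable_EFinP. Qed.

Lemma Rintegral_dominated_cvg (f_ : nat -> T -> R) f g :
  (forall n, measurable_fun setT (f_ n)) ->
  (forall x, f_ n x @[n --> \oo] --> f x) ->
  m.-integrable setT (EFin \o g) -> (forall n x, `|f_ n x| <= g x) ->
  m.-integrable setT (EFin \o f) /\
  \int[m]_x f_ n x @[n --> \oo] --> \int[m]_x f x.
Proof.
move=> mf_ f_f ig fg.
have mf : measurable_fun setT f.
  by apply: (measurable_fun_cvg mf_) => x _; exact: f_f.
have cE x : (f_ n x)%:E @[n --> \oo] --> (f x)%:E.
  by apply/fine_cvgP; split; [exact: nearW|exact: f_f].
have [if_ _ cf] := @dominated_convergence _ _ _ m setT measurableT
  (fun n x => (f_ n x)%:E) (EFin \o f) (EFin \o g)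
  (fun n => (measurable_EFinP _ _).2 (mf_ n)) ((measurable_EFinP _ _).2 mf)
  (aeW _ (fun x _ => cE x))
  ig (aeW _ (fun x n _ => fg n x)).
by split => //; apply: fine_cvg; rewrite fineK// integrable_fin_num.
Qed.

End real_integral.

(** * Indicators of cubes as limits of exp(-Q) *)

Section gaussian_approximation.
Context {R : realType} {d : nat}.
Implicit Types (A : set 'rV[R]_d) (Q : 'rV[R]_d -> R).

Definition gauss_exponent Q := [/\ polyfun Q, coercive Q & forall x, 0 <= Q x].

(** These sets form a pi-system: adding exponents multiplies the approximants, hence intersects the
    sets. Nonnegative exponents keep the approximants between 0 and 1, as dominated convergence
    requires. *)
Definition gauss_approx A := exists Q_ : nat -> 'rV[R]_d -> R,
  (forall n, gauss_exponent (Q_ n)) /\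
  forall x, expR (- Q_ n x) @[n --> \oo] --> (\1_A x : R).

Lemma expN_bound Q x : gauss_exponent Q -> `|expR (- Q x)| <= 1.
Proof.
by move=> [_ _ Q0]; rewrite ger0_norm ?expR_ge0// -expR0 ler_expR oppr_le0.
Qed.

Lemma expN_measurable Q : gauss_exponent Q ->
  measurable_fun setT (fun x => expR (- Q x)).
Proof.
move=> [hQ cQ _]; have [M [L]] := schwartz_bounded_lipschitz (expN_schwartz hQ cQ).
exact: bounded_lipschitz_measurable.
Qed.

Lemma gauss_approxI : setI_closed gauss_approx.
Proof.
move=> A B [Q_ [hQ cQ]] [Q'_ [hQ' cQ']]; exists (fun n => Q_ n + Q'_ n).
split => [n|x].
  have [? ? Q0] := hQ n; have [? ? Q'0] := hQ' n.
  by split; [exact: polyfunD|exact: coerciveD|move=> x; exact: addr_ge0].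
rewrite indicI; apply: cvg_trans (cvgM (cQ x) (cQ' x)).
by apply: near_eq_cvg; near=> n; rewrite /= -expRD -opprD.
Unshelve. all: end_near. Qed.

Lemma gauss_approx_measurable A : gauss_approx A -> measurable A.
Proof.
move=> [Q_ [hQ cQ]]; apply/(measurable_indicP R).
by apply: (measurable_fun_cvg (fun n => expN_measurable (hQ n))) => x _; exact: cQ.
Qed.

(** Amounts to 1 - w^n = (1 - w) (1 + w + ... + w^(n-1)), where each term is at least w^n. It yields
    n w^(2n) <= w^n / (1 - w), hence the convergence to 0 below. *)
Lemma natmul_expr_le (w : R) n : 0 <= w <= 1 -> n%:R * w ^+ n * (1 - w) <= 1 - w ^+ n.
Proof.
move=> /andP[w0 w1]; elim: n => [|n IH]; first by rewrite !mul0r expr0 subrr.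
rewrite -natr1 exprS.
have := exprn_ge0 n w0; have := exprn_ile1 n w0 w1; move: (w ^+ n) IH => u IH u1 u0.
have -> : (n%:R + 1) * (w * u) * (1 - w) = w * (n%:R * u * (1 - w)) + w * u * (1 - w) by ring.
apply: le_trans (lerD (ler_wpM2l w0 IH) (lexx _)) _.
have : 0 <= (1 - w) * (1 - w * u).
  by rewrite mulr_ge0 ?subr_ge0// mulr_ile1.
lra.
Qed.

Lemma natmul_expr_cvg0 (w : R) : 0 <= w < 1 ->
  n.+1%:R * (w ^+ 2) ^+ n.+1 @[n --> \oo] --> (0 : R).
Proof.
move=> /andP[w0 w1].
have c : w ^+ n.+1 / (1 - w) @[n --> \oo] --> 0.
  rewrite -[X in _ --> X](mul0r (1 - w)^-1); apply: cvgMl.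
  have : w ^+ n @[n --> \oo] --> (0 : R) by apply: cvg_expr; rewrite ger0_norm.
  by rewrite -(cvg_shiftS (fun n => w ^+ n)).
apply: (@squeeze_cvgr _ _ _ _ (fun=> 0) (fun n => w ^+ n.+1 / (1 - w))) => //; last exact: cvg_cst.
near=> n; rewrite mulr_ge0 ?exprn_ge0//=.
rewrite -exprM mulnC exprM expr2 mulrA mulrC ler_wpM2l ?exprn_ge0//.
rewrite -[leRHS]mul1r ler_pdivlMr ?subr_gt0//.
apply: (le_trans (natmul_expr_le _ _)); first by rewrite w0 ltW.
by rewrite lerBlDr lerDl exprn_ge0.
Unshelve. all: end_near. Qed.

(** The exponent is (n+1) times the sum of ((x_i - a_i)/e)^(2(n+1)). Inside the open cube every base
    is below 1 in absolute value and the sum tends to 0; outside, some base is at least 1 and the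
    prefactor n+1 forces divergence, on the boundary too. *)
Lemma gauss_approx_cube a (e : R) : 0 < e -> gauss_approx (cube a e).
Proof.
move=> e0.
pose s i (x : 'rV[R]_d) := (e^-1 * (x ord0 i + - a ord0 i)) ^+ 2.
exists (fun n x => n.+1%:R * \sum_i s i x ^+ n.+1).
have s0 i x n : 0 <= s i x ^+ n by rewrite exprn_ge0 ?sqr_ge0.
have sE i x : s i x = (`|x ord0 i - a ord0 i| / e) ^+ 2.
  by rewrite /s !exprMn real_normK ?num_real// mulrC.
have Q0 n x : 0 <= n.+1%:R * \sum_i s i x ^+ n.+1.
  by rewrite mulr_ge0// sumr_ge0.
split => [n|x].
  split => //.
    have pc : polyfun (fun _ : 'rV[R]_d => n.+1%:R : R) by exact: polyfun_cst.
    apply: (polyfunM pc); apply: polyfun_sum => i; apply: polyfunX; apply: polyfunX.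
    apply: (@polyfunM _ _ (fun=> e^-1)); first exact: polyfun_cst.
    by apply: (@polyfunD _ _ _ (fun=> - a ord0 i)); [exact: polyfun_coord|exact: polyfun_cst].
  (* Coercivity: s^(n+1) >= s - 1 for s >= 0, and v^2 >= 2 v - 1 with v = |x_i - a_i| / e. *)
  exists (2 / e), (\sum_i (2 * `|a ord0 i| / e + 2)); split => [|x]; first by rewrite divr_gt0.
  apply: (@le_trans _ _ (\sum_i s i x ^+ n.+1)); last by rewrite ler_peMl ?sumr_ge0// ler1n.
  rewrite lerBlDr -big_split/=.
  apply: (@le_trans _ _ (\sum_i 2 / e * `|x ord0 i|)).
    rewrite -mulr_sumr ler_wpM2l ?divr_ge0 ?(ltW e0)//.
    apply: row_norm_le => [|i]; first by rewrite sumr_ge0.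
    by rewrite (bigD1 i)//= lerDl sumr_ge0.
  apply: ler_sum => i _.
  apply: (@le_trans _ _ (s i x - 1 + (2 * `|a ord0 i| / e + 2))); last first.
    rewrite lerD2r; have [s1|s1] := leP 1 (s i x).
      rewrite (@le_trans _ _ (s i x))// ?gerBl//.
      by rewrite exprS ler_peMr ?sqr_ge0// exprn_ege1.
    by rewrite (le_trans _ (s0 _ _ _))// subr_le0 ltW.
  rewrite sE.
  have -> : 2 / e * `|x ord0 i| = 2 * (`|x ord0 i| / e) by ring.
  have -> : 2 * `|a ord0 i| / e = 2 * (`|a ord0 i| / e) by ring.
  have : `|x ord0 i| / e <= `|x ord0 i - a ord0 i| / e + `|a ord0 i| / e.
    rewrite -mulrDl ler_wpM2r ?invr_ge0 ?(ltW e0)//.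
    by rewrite -{1}(subrK (a ord0 i) (x ord0 i)) ler_normD.
  have := sqr_ge0 (`|x ord0 i - a ord0 i| / e - 1).
  move: (`|x ord0 i - a ord0 i| / e) (`|x ord0 i| / e) (`|a ord0 i| / e) => u v w; lra.
have [xA|xA] := pselect (cube a e x).
  rewrite (_ : \1_(cube a e) x = expR 0 :> R); last by rewrite indicE mem_set// expR0.
  have c0 : \sum_i (n.+1%:R * s i x ^+ n.+1) @[n --> \oo] --> (0 : R).
    have z0 : \sum_(i < d) (0 : R) = 0 by rewrite big1.
    rewrite -[X in _ --> X]z0.
    apply: cvg_big => [|i _]; first exact: add_continuous.
    rewrite sE; apply: natmul_expr_cvg0.
    by rewrite divr_ge0 ?(ltW e0)//= ltr_pdivrMr// mul1r.
  apply: (continuous_cvg _ (@continuous_expR R 0)).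
  under eq_cvg do rewrite mulr_sumr.
  have cN := cvgN c0; rewrite oppr0 in cN.
  exact: cN.
rewrite (_ : \1_(cube a e) x = 0 :> R); last by rewrite indicE memNset.
have [i iA] : exists i, e <= `|x ord0 i - a ord0 i|.
  by apply: contra_notP xA => /forallNP xA i; rewrite ltNge; exact/negP/xA.
have s1 : 1 <= s i x by rewrite sE exprn_ege1// ler_pdivlMr// mul1r.
apply/cvgrPdist_le => /= eps eps0; near=> n.
rewrite sub0r normrN ger0_norm ?expR_ge0//.
rewrite expRN invf_ple ?posrE ?expR_gt0//.
apply: (le_trans _ (expR_ge1Dx _)).
apply: (@le_trans _ _ n%:R).
  near: n; exact: nbhs_infty_ger.
rewrite (bigD1 i)//= mulrDr addrA.
rewrite (@le_trans _ _ (n.+1%:R * s i x ^+ n.+1))//.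
  rewrite (@le_trans _ _ n.+1%:R) ?ler_nat// ler_peMr// exprn_ege1//.
by rewrite addrAC lerDr addr_ge0// mulr_ge0// sumr_ge0.
Unshelve. all: end_near. Qed.

Lemma gauss_approx_generate : (measurable : set (set 'rV[R]_d)) = <<s gauss_approx >>.
Proof.
apply: measurable_rowE => [a e|A]; [exact: gauss_approx_cube|exact: gauss_approx_measurable].
Qed.

End gaussian_approximation.

(** * Finite measures are determined by their Fourier transform *)

Section fourier_uniqueness.
Context {R : realType} {d : nat} (m1 m2 : {measure set 'rV[R]_d -> \bar R}).
Hypotheses (m1fin : (m1 setT < +oo)%E) (m2fin : (m2 setT < +oo)%E).
Hypothesis m12 : forall xi c, \int[m1]_x cos (dotp x xi + c) = \int[m2]_x cos (dotp x xi + c).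

(** Equality on cosines passes to bounded Lipschitz functions by trigonometric induction, in
    particular to exp(-Q), then by dominated convergence to the pi-system [gauss_approx], which
    generates the Borel sets. *)
Lemma fourier_unique A : measurable A -> m1 A = m2 A.
Proof.
pose V (f : 'rV[R]_d -> R) := [/\ measurable_fun setT f, exists M, forall x, `|f x| <= M
  & \int[m1]_x f x = \int[m2]_x f x].
have Vint f : V f -> m1.-integrable setT (EFin \o f) /\ m2.-integrable setT (EFin \o f).
  by move=> [mf [M fM] _]; split; apply: (integrable_bounded (M := M)).
have Vbl M L f : bounded_lipschitz M L f -> V f.
  apply: trigonometric_induction => {M L f}.
  - move=> a f g Vf Vg; have [f1 f2] := Vint _ Vf; have [g1 g2] := Vint _ Vg.
    case: Vf Vg => [mf [M fM] fE] [mg [M' gM'] gE]; split.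
    + by apply: measurable_funD => //; apply: measurable_funM.
    + exists (`|a| * M + M') => x; rewrite (le_trans (ler_normD _ _))// lerD//.
      by rewrite normrM ler_wpM2l.
    + by rewrite !Rintegral_lin// fE gE.
  - move=> xi c; split => //.
      exact: bounded_lipschitz_measurable (bounded_lipschitz_cos xi c).
    by exists 1 => x; exact: (bounded_lipschitz_cos xi c).1.
  - move=> M L f_ f Vf bf cf.
    have mf_ n : measurable_fun setT (f_ n) by case: (Vf n).
    have fM n x : `|f_ n x| <= M by exact: (bf n).1.
    have icst (m : {measure set 'rV[R]_d -> \bar R}) : (m setT < +oo)%E -> m.-integrable setT (EFin \o (fun=> M)).
      by move=> mfin; apply: (integrable_bounded (M := `|M|)).
    have [_ c1] := Rintegral_dominated_cvg mf_ cf (icst _ m1fin) fM.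
    have [_ c2] := Rintegral_dominated_cvg mf_ cf (icst _ m2fin) fM.
    split; first by apply: (measurable_fun_cvg mf_) => x _; exact: cf.
      exists M => x; apply: (cvgr_to_le (cvg_norm (cf x))); apply: nearW => n; exact: fM.
    have E : (fun n => \int[m1]_x f_ n x) = (fun n => \int[m2]_x f_ n x).
      by apply/funext => n; case: (Vf n).
    rewrite E in c1; exact: (cvg_unique _ c1 c2).
move=> mA; apply: (@measure_unique _ _ _ gauss_approx (fun k => cube 0 k.+1%:R)) => //.
- exact: gauss_approx_generate.
- exact: gauss_approxI.
- by move=> i; exact: gauss_approx_cube.
- apply/seteqP; split => // x _.
  exists (Num.bound `|x|) => // i; rewrite mxE subr0.
  rewrite (le_lt_trans (normr_coord _ _))// (lt_trans (archi_boundP _))//.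
  by rewrite ltr_nat.
- move=> B [Q_ [hQ cQ]].
  have mB := gauss_approx_measurable (ex_intro _ Q_ (conj hQ cQ)).
  have E n : \int[m1]_x expR (- Q_ n x) = \int[m2]_x expR (- Q_ n x).
    have [h1 h2 _] := hQ n.
    by have [M [L /Vbl[]]] := schwartz_bounded_lipschitz (expN_schwartz h1 h2).
  have key (m : {measure set 'rV[R]_d -> \bar R}) : (m setT < +oo)%E ->
      \int[m]_x expR (- Q_ n x) @[n --> \oo] --> fine (m B).
    have n1 : 'rV[R]_d -> `|1 : R| <= 1 by rewrite normr1.
    move=> mfin; have [_] := Rintegral_dominated_cvg (m := m) (fun n => expN_measurable (hQ n)) cQ
      (integrable_bounded (M := 1) mfin (measurable_cst _) n1)
      (fun n x => expN_bound x (hQ n)).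
    by rewrite /Rintegral integral_indic// setIT.
  have c1 := key _ m1fin; have c2 := key _ m2fin.
  rewrite (_ : (fun n => \int[m1]_x expR (- Q_ n x)) = (fun n => \int[m2]_x expR (- Q_ n x))) in c1; last exact/funext.
  have fn (m : {measure set 'rV[R]_d -> \bar R}) : (m setT < +oo)%E -> m B \is a fin_num.
    move=> mfin; rewrite ge0_fin_numE// (le_lt_trans _ mfin)// le_measure// ?inE//.
  by rewrite -(fineK (fn _ m1fin)) -(fineK (fn _ m2fin)) (cvg_unique _ c1 c2).
- by move=> k; rewrite (le_lt_trans _ m1fin)// le_measure ?inE//; exact: measurable_cube.
Qed.

End fourier_uniqueness.

(** * L^p norms of real functions and dominated convergence in L^p *)

Lemma powR_cvg_to0 (R : realType) (p : R) (u_ : nat -> R) : 0 < p ->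
  u_ n @[n --> \oo] --> 0 -> `|u_ n| `^ p @[n --> \oo] --> 0.
Proof.
move=> p0 cu; apply/cvgrPdist_lt => /= e e0.
have e'0 : 0 < e `^ p^-1 by exact: powR_gt0.
near=> n; rewrite sub0r normrN ger0_norm ?powR_ge0//.
have -> : e = (e `^ p^-1) `^ p by rewrite -powRrM mulVf ?gt_eqF// powRr1// ltW.
apply: gt0_ltr_powR; rewrite ?nnegrE ?powR_ge0//.
rewrite -normrN -sub0r; near: n; move/cvgrPdist_lt : cu; exact.
Unshelve. all: end_near. Qed.

Section real_Lnorm.
Context dT (T : measurableType dT) (R : realType) (m : {measure set T -> \bar R}).
Variable p : R.
Hypothesis p0 : 0 < p.
Implicit Types f g : T -> R.

Lemma Lnorm_EFin f :
  ('N[m]_(p%:E)[EFin \o f] = (\int[m]_x (`|f x| `^ p)%:E) `^ p^-1)%E.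
Proof. by rewrite unlock /Lnorm. Qed.

Lemma measurable_norm_powR f : measurable_fun setT f ->
  measurable_fun setT (fun x => (`|f x| `^ p)%:E).
Proof.
move=> mf; apply/measurable_EFinP.
by apply: (measurableT_comp (measurable_powR p)) => //; apply: measurableT_comp.
Qed.

Lemma Lnorm_scale (a : R) f : measurable_fun setT f ->
  ('N[m]_(p%:E)[EFin \o (fun x => a * f x)%R] = `|a|%:E * 'N[m]_(p%:E)[EFin \o f])%E.
Proof.
move=> mf; rewrite !Lnorm_EFin.
under eq_integral do rewrite normrM powRM// EFinM.
rewrite ge0_integralZl//; last exact: measurable_norm_powR.
rewrite poweRM ?lee_fin ?powR_ge0//; last by apply: integral_ge0 => x _; rewrite lee_fin powR_ge0.
by rewrite poweR_EFin -powRrM mulfV ?gt_eqF// powRr1.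
Qed.

Lemma Lnorm_lt f (e : R) : 0 < e -> (\int[m]_x (`|f x| `^ p)%:E < (e `^ p)%:E)%E ->
  ('N[m]_(p%:E)[EFin \o f] < e%:E)%E.
Proof.
move=> e0; rewrite Lnorm_EFin.
have : (0 <= \int[m]_x (`|f x| `^ p)%:E)%E.
  by apply: integral_ge0 => x _; rewrite lee_fin powR_ge0.
case: (integral _ _ _) => [s|//|//]; rewrite !lee_fin !lte_fin => s0 se.
have -> : e = (e `^ p) `^ p^-1 by rewrite -powRrM mulfV ?gt_eqF// powRr1// ltW.
by apply: gt0_ltr_powR; rewrite ?invr_gt0// nnegrE ?powR_ge0.
Qed.

Lemma Lnorm_lty f : ('N[m]_(p%:E)[EFin \o f] < +oo)%E ->
  (\int[m]_x (`|f x| `^ p)%:E < +oo)%E.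
Proof. by rewrite Lnorm_EFin; apply: lty_poweRy; rewrite gt_eqF// invr_gt0. Qed.

Lemma Lnorm_dominated_cvg (f_ : nat -> T -> R) f h :
  (forall n, measurable_fun setT (f_ n)) ->
  (forall x, f_ n x @[n --> \oo] --> f x) ->
  measurable_fun setT h -> ('N[m]_(p%:E)[EFin \o h] < +oo)%E ->
  (forall n x, `|f_ n x| <= h x) ->
  forall e : R, 0 < e -> exists n, ('N[m]_(p%:E)[EFin \o (f_ n \- f)%R] < e%:E)%E.
Proof.
move=> mf_ cf mh Nh fh e e0.
have mf : measurable_fun setT f.
  by apply: (measurable_fun_cvg mf_) => x _; exact: cf.
have h0 x : 0 <= h x by exact: le_trans (normr_ge0 _) (fh 0%N x).
have ih : m.-integrable setT (EFin \o (fun x => 2 `^ p * `|h x| `^ p)).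
  apply: (@integrableZl _ _ _ _ _ measurableT _ (fun x => (`|h x| `^ p)%:E)).
  apply/integrableP; split; first exact: measurable_norm_powR.
  under eq_integral do rewrite /= ger0_norm ?powR_ge0//.
  exact: Lnorm_lty.
have mp n : measurable_fun setT (fun x => `|f_ n x - f x| `^ p).
  by apply/measurable_EFinP/measurable_norm_powR/measurable_funB.
have cp x : `|f_ n x - f x| `^ p @[n --> \oo] --> 0.
  by apply: powR_cvg_to0 => //; apply/subr_cvg0; exact: cf.
have bp n x : `| `|f_ n x - f x| `^ p| <= 2 `^ p * `|h x| `^ p.
  rewrite ger0_norm ?powR_ge0// -powRM//.
  apply: ge0_ler_powR; rewrite ?nnegrE ?mulr_ge0// ?(ltW p0)//.
  rewrite (ger0_norm (h0 x)) mulr_natl mulr2n (le_trans (ler_normB _ _))// lerD//.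
  by apply: (cvgr_to_le (cvg_norm (cf x))); apply: nearW => n'; exact: fh.
have [_] := Rintegral_dominated_cvg mp cp ih bp.
rewrite Rintegral_cst// mul0r => /cvgrPdist_lt/(_ _ (powR_gt0 p e0))[N _ /(_ N (leqnn N))].
rewrite /= sub0r normrN => hN; exists N; apply: Lnorm_lt => //.
have iN := integrable_dominated (mp N) (bp N) ih.
rewrite -[ltLHS]fineK; last exact: (integrable_fin_num measurableT iN).
by rewrite lte_fin (le_lt_trans (ler_norm _)).
Qed.

End real_Lnorm.

Import HBNNSimple.

(** * Density of the Schwartz space in L^p(mu) *)

Section schwartz_dense.
Context {R : realType} {d : nat} (mu : probability 'rV[R]_d R) (p : R).
Hypothesis p1 : 1 <= p.
Implicit Types f g : 'rV[R]_d -> R.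

Let p0 : 0 < p. Proof. by rewrite (lt_le_trans ltr01). Qed.

Lemma schwartz_lin (a : R) f g : schwartz f -> schwartz g ->
  schwartz (fun x => a * f x + g x).
Proof.
move=> [fd fb] [gd gb].
have E s : partials s (fun x => a * f x + g x) = a *: partials s f + partials s g.
  elim: s => [|i s IH /=]; first by apply/funext.
  apply/funext => x; rewrite IH.
  rewrite deriveD; last 2 first.
  - by apply/diff_derivable/differentiableZ; exact: fd.
  - by apply/diff_derivable; exact: gd.
  by rewrite deriveZ//; apply/diff_derivable; exact: fd.
split => s.
  by move=> x; rewrite E; apply: differentiableD; [apply: differentiableZ; exact: fd|exact: gd].
move=> k; have [C CP] := fb s k; have [C' C'P] := gb s k.
exists (`|a| * C + C') => x; rewrite E.
have e0 : 0 <= (1 + enorm x) ^+ k by rewrite exprn_ge0// addr_ge0// sqrtr_ge0.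
rewrite (le_trans (ler_wpM2l e0 (ler_normD _ _)))// mulrDr lerD//.
by rewrite normrM mulrCA ler_wpM2l.
Qed.

Lemma schwartz_measurable f : schwartz f -> measurable_fun setT f.
Proof.
by move=> /schwartz_bounded_lipschitz[M [L]]; exact: bounded_lipschitz_measurable.
Qed.

Let approximable f := measurable_fun setT f /\ forall e : R, 0 < e ->
  exists2 g, schwartz g & ('N[mu]_(p%:E)[EFin \o (g \- f)%R] < e%:E)%E.

Let approximable_schwartz f : schwartz f -> approximable f.
Proof.
move=> sf; split=> [|e e0]; first exact: schwartz_measurable.
exists f => //; rewrite (_ : EFin \o _ = cst 0%E); last first.
  by apply/funext => x /=; rewrite subrr.
by rewrite Lnorm0 ?lte_fin// eqe gt_eqF.
Qed.

Let approximable_lin (a : R) f g : approximable f -> approximable g ->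
  approximable (fun x => a * f x + g x).
Proof.
move=> [mf af] [mg ag]; split.
  by apply: measurable_funD => //; apply: measurable_funM.
move=> e e0; have a1 : 0 < `|a| + 1 by rewrite ltr_wpDl.
have [f' sf' ff'] := af (e / 2 / (`|a| + 1)) (divr_gt0 (divr_gt0 e0 (ltr0n R 2)) a1).
have [g' sg' gg'] := ag (e / 2) (divr_gt0 e0 (ltr0n R 2)).
exists (fun x => a * f' x + g' x); first exact: schwartz_lin.
have mf' := schwartz_measurable sf'; have mg' := schwartz_measurable sg'.
rewrite (_ : EFin \o _ = EFin \o ((fun x => a * (f' \- f) x) \+ (g' \- g))%R); last first.
  by apply/funext => x /=; congr EFin; ring.
have mff : measurable_fun setT (f' \- f) by apply: measurable_funB.
apply: (le_lt_trans (minkowski_EFin _ _ _ _)) => //.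
- by apply: measurable_funM.
- by apply: measurable_funB.
rewrite [in ltRHS](splitr e) EFinD lteD//.
rewrite Lnorm_scale//.
apply: (@le_lt_trans _ _ (`|a|%:E * (e / 2 / (`|a| + 1))%:E)%E).
  by rewrite lee_wpmul2l// ltW.
rewrite -EFinM lte_fin mulrCA gtr_pMr ?divr_gt0// ltr_pdivrMr// mul1r.
by rewrite ltrDl.
Qed.

Let approximable_lim h (f_ : nat -> 'rV[R]_d -> R) f :
  (forall n, approximable (f_ n)) -> (forall x, f_ n x @[n --> \oo] --> f x) ->
  measurable_fun setT h -> ('N[mu]_(p%:E)[EFin \o h] < +oo)%E ->
  (forall n x, `|f_ n x| <= h x) -> approximable f.
Proof.
move=> af cf mh Nh fh; have mf_ n := (af n).1.
have mf : measurable_fun setT f by apply: (measurable_fun_cvg mf_) => x _; exact: cf.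
split => // e e0; have e20 := divr_gt0 e0 (ltr0n R 2).
have [n Nn] := Lnorm_dominated_cvg p0 mf_ cf mh Nh fh e20.
have [g sg Ng] := (af n).2 _ e20; exists g => //.
have mg := schwartz_measurable sg.
rewrite (_ : EFin \o _ = EFin \o ((g \- f_ n) \+ (f_ n \- f))%R); last first.
  by apply/funext => x /=; congr EFin; ring.
apply: (le_lt_trans (minkowski_EFin _ _ _ _)) => //.
- by apply: measurable_funB.
- by apply: measurable_funB.
by rewrite [in ltRHS](splitr e) EFinD lteD.
Qed.

Let Lnorm_cst_lty (c : R) : ('N[mu]_(p%:E)[EFin \o (fun=> c)] < +oo)%E.
Proof. by have := Lfun_cst mu c p; rewrite inE => /andP[_]; rewrite inE. Qed.

Let approximable_bounded_lim (M : R) (f_ : nat -> 'rV[R]_d -> R) f :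
  (forall n, approximable (f_ n)) -> (forall x, f_ n x @[n --> \oo] --> f x) ->
  (forall n x, `|f_ n x| <= M) -> approximable f.
Proof.
by move=> af cf; apply: (approximable_lim af cf); [exact: measurable_cst|exact: Lnorm_cst_lty].
Qed.

Let approximable_gauss A : gauss_approx A -> approximable \1_A.
Proof.
move=> [Q_ [hQ cQ]]; apply: (@approximable_bounded_lim 1 _ _ _ cQ).
- by move=> n; have [h1 h2 _] := hQ n; exact/approximable_schwartz/expN_schwartz.
- by move=> n x; exact: expN_bound.
Qed.

Let approximable0 : approximable (fun=> 0).
Proof.
have [Q_ [hQ cQ]] := @gauss_approx_cube R d 0 1 ltr01.
have [h1 h2 _] := hQ 0%N; have := approximable_schwartz (expN_schwartz h1 h2).
move=> aQ; have := approximable_lin (-1) aQ aQ.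
by under eq_fun do rewrite mulN1r addNr.
Qed.

(** The constant 1 is not Schwartz, but it is the bounded limit of indicators of growing cubes, and
    mu is finite. *)
Let approximable1 : approximable (fun=> 1).
Proof.
apply: (@approximable_bounded_lim 1 (fun k => \1_(cube 0 k.+1%:R))).
- by move=> k; apply: approximable_gauss; exact: gauss_approx_cube.
- move=> x; apply: cvg_near_cst; near=> n.
  rewrite indicE mem_set// => i; rewrite mxE subr0.
  rewrite (le_lt_trans (normr_coord _ _))// (lt_trans (archi_boundP _))// ltr_nat ltnS.
  by near: n; exact: nbhs_infty_ge.
- by move=> n x; rewrite indicE normr_nat lern1 leq_b1.
Unshelve. all: end_near. Qed.

Let approximable_sum n (f_ : nat -> 'rV[R]_d -> R) :
  (forall k, approximable (f_ k)) -> approximable (fun x => \sum_(k < n) f_ k x).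
Proof.
move=> af; elim: n => [|n IH].
  by under eq_fun do rewrite big_ord0.
under eq_fun do rewrite big_ord_recr/=.
have := approximable_lin 1 IH (af n).
by under eq_fun do rewrite mul1r.
Qed.

(** Dynkin's argument from the pi-system [gauss_approx]: complements use the constant 1, disjoint
    unions use bounded limits. *)
Let approximable_indic A : measurable A -> approximable \1_A.
Proof.
rewrite gauss_approx_generate; move: A.
apply: dynkin_induction; first exact: gauss_approx_generate.
- exact: gauss_approxI.
- by rewrite indicT.
- by move=> A; exact: approximable_gauss.
- move=> A _ aA.
  have := approximable_lin (-1) aA approximable1; congr approximable.
  by apply/funext => x; rewrite !indicE in_setC mulN1r; case: (x \in A) => /=; ring.
move=> F mF tF aF.
have aS n := approximable_sum n aF.
(* By disjointness the partial sums of indicators take only the values 0 and 1, which gives both the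
   bound 1 and the pointwise convergence. *)
have sumF x : (exists2 k0, F k0 x & forall n, \sum_(k < n) \1_(F k) x = (k0 < n)%N%:R :> R) \/
   ((forall k, ~ F k x) /\ forall n, \sum_(k < n) \1_(F k) x = 0 :> R).
  have [[k0 Fk0]|nF] := pselect (exists k, F k x); [left|right].
    exists k0 => // n; case: ltnP => k0n.
      rewrite (bigD1 (Ordinal k0n))//= indicE mem_set// big1 ?addr0// => i /eqP ik0.
      rewrite indicE memNset// => Fix; apply: ik0; apply/val_inj => /=.
      by apply: tF => //; exists x.
    rewrite big1// => i _; rewrite indicE memNset// => Fix.
    have ik0 : i = k0 :> nat by apply: tF => //; exists x.
    by have := ltn_ord i; rewrite ik0 ltnNge k0n.
  split=> [k Fk|n]; first by apply: nF; exists k.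
  by rewrite big1// => i _; rewrite indicE memNset// => Fi; apply: nF; exists i.
apply: (@approximable_bounded_lim 1 _ _ aS).
- move=> x; have [[k0 Fk0 E]|[nF E]] := sumF x.
    rewrite indicE mem_set; last by exists k0.
    apply: cvg_near_cst; near=> n; rewrite E; case: ltnP => // nk0.
    suff : (k0 < n)%N by rewrite ltnNge nk0.
    by near: n; exact: nbhs_infty_gt.
  rewrite indicE memNset; last by move=> [k _]; exact: nF.
  by apply: cvg_near_cst; near=> n; rewrite E.
- move=> n x; have [[k0 Fk0 ->]|[nF ->]] := sumF x; last by rewrite normr0.
  by rewrite normr_nat lern1 leq_b1.
Unshelve. all: end_near. Qed.

(** Positive and negative parts are limits of simple functions dominated by |f|; simple functions
    are combinations of indicators. *)
Lemma schwartz_dense f : f \in Lfun mu p%:E -> forall e : R, 0 < e ->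
  exists2 g, schwartz g & ('N[mu]_(p%:E)[EFin \o (g \- f)%R] < e%:E)%E.
Proof.
rewrite inE => /andP[]; rewrite inE => mf; rewrite inE /= /finite_norm => Nf.
suff : approximable f by case.
have anneg g : measurable_fun setT g -> (forall x, 0 <= g x) -> (forall x, g x <= `|f x|) ->
    approximable g.
  move=> mg g0 gf; have mEg : measurable_fun setT (EFin \o g) by exact/measurable_EFinP.
  pose g_ := nnsfun_approx measurableT mEg.
  apply: (@approximable_lim (fun x => `|f x|) (fun n (x : 'rV[R]_d) => g_ n x)).
  - move=> n.
    pose s : seq R := fset_set (range (g_ n)).
    have -> : (fun x => g_ n x) = (fun x =>
        \sum_(i < size s) s`_i * \1_(g_ n @^-1` [set s`_i]) x).
      by apply/funext => x; exact: fimfunEord.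
    apply: (@approximable_sum _ (fun k x => s`_k * \1_(g_ n @^-1` [set s`_k]) x)) => k.
    set c := s`_k.
    have mA : measurable (g_ n @^-1` [set c]) by apply: measurable_funPTI.
    have := approximable_lin c (approximable_indic mA) approximable0.
    by under eq_fun do rewrite addr0.
  - move=> x; have := @cvg_nnsfun_approx _ _ _ _ measurableT _ mEg (fun x _ => g0 x) x Logic.I.
    by move=> /fine_cvg.
  - by apply: measurableT_comp.
  - by rewrite -Lnorm_abse in Nf.
  - move=> n x; rewrite ger0_norm//; apply: le_trans (gf x).
    have := @le_approx _ _ _ _ (EFin \o g) n x (fun x _ => g0 x) Logic.I.
    by rewrite /g_ nnsfun_approxE lee_fin.
have fE x : f^\- x + f^\+ x = `|f x|.
  by rewrite addrC -[RHS]/((Num.norm \o f) x) -funrposDneg.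
have an : approximable f^\-.
  apply: anneg; [exact: measurable_funrneg|exact: funrneg_ge0|move=> x].
  by rewrite -fE lerDl funrpos_ge0.
have ap : approximable f^\+.
  apply: anneg; [exact: measurable_funrpos|exact: funrpos_ge0|move=> x].
  by rewrite -fE lerDr funrneg_ge0.
have := approximable_lin (-1) an ap; congr approximable.
by rewrite -[RHS]funrposBneg; apply/funext => x; rewrite mulN1r addrC.
Qed.

End schwartz_dense.

(** * Finiteness of integrals by dyadic layers *)

Section dyadic_layers.
Context {R : realType}.

Lemma dyadic_interval (s : R) : 1 <= s -> exists k, 2 ^+ k <= s < 2 ^+ k.+1.
Proof.
move=> s1.
have ex : exists n, s < 2 ^+ n.
  exists (Num.bound s); rewrite (lt_le_trans (archi_boundP (le_trans ler01 s1)))//.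
  by rewrite -natrX ler_nat ltnW// ltn_expl.
have := ex_minnP ex; case: ex_minnP => -[|k] sk kmin _.
  by move: sk; rewrite expr0 ltNge s1.
exists k; rewrite sk andbT leNgt; apply/negP => /kmin.
by rewrite ltnn.
Qed.

Lemma geometric_lty (a z : R) : 0 <= a -> 0 <= z < 1 ->
  (\sum_(0 <= k <oo) (a * z ^+ k)%:E < +oo)%E.
Proof.
move=> a0 /andP[z0 z1].
have c : series (geometric a z) @ \oo --> a * (1 - z)^-1.
  by apply: cvg_geometric_series; rewrite ger0_norm.
rewrite (_ : (\sum_(0 <= k <oo) _)%E = (a * (1 - z)^-1)%:E) ?ltry//.
apply/cvg_lim => //.
rewrite (_ : (fun n => \sum_(0 <= k < n) _)%E = EFin \o series (geometric a z)); last first.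
  by apply/funext => n /=; rewrite sumEFin.
by apply: cvg_EFin => //; exact: nearW.
Qed.

Context dT (T : measurableType dT) (m : {measure set T -> \bar R}).

(** On D, g is bounded by the sum of the c_k times the indicators of the B_k, since one term already
    dominates it; the integrals of the terms are bounded by a geometric series. The layers may
    overlap. *)
Lemma dyadic_layers_lty (D : set T) (g : T -> R) (B : nat -> set T) (c : nat -> R) (a z : R) :
  measurable D -> measurable_fun D g -> (forall x, D x -> 0 <= g x) ->
  (forall k, measurable (B k)) -> (forall k, 0 <= c k) ->
  (forall x, D x -> exists2 k, B k x & g x <= c k) ->
  0 <= a -> 0 <= z < 1 ->
  (forall k, ((c k)%:E * m (B k) <= (a * z ^+ k)%:E)%E) ->
  (\int[m]_(x in D) (g x)%:E < +oo)%E.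
Proof.
move=> mD mg g0 mB c0 gc a0 z01 cB.
have mcB k : measurable_fun D (fun x => (c k * \1_(B k) x)%:E).
  by apply/measurable_EFinP; apply: measurable_funM => //; exact: measurable_indic.
have cB0 k x : (0 <= (c k * \1_(B k) x)%:E)%E by rewrite lee_fin mulr_ge0.
apply: (@le_lt_trans _ _ (\int[m]_(x in D) \sum_(0 <= k <oo) (c k * \1_(B k) x)%:E)%E).
  apply: ge0_le_integral => //.
  - exact/measurable_EFinP.
  - exact: ge0_emeasurable_sum.
  - move=> x Dx; have [k Bx gk] := gc x Dx.
    apply: (@le_trans _ _ (c k * \1_(B k) x)%:E).
      by rewrite lee_fin indicE mem_set// mulr1.
    by rewrite (@nneseriesD1 _ _ k)//= leeDl// nneseries_ge0.
rewrite integral_nneseries//.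
apply: le_lt_trans (geometric_lty a0 z01).
apply: lee_nneseries => k _; first by move=> _; apply: integral_ge0 => x _; exact: cB0.
apply: le_trans (cB k).
under eq_integral do rewrite EFinM.
rewrite ge0_integralZl ?lee_fin//; last by apply/measurable_EFinP; exact: measurable_indic.
rewrite integral_indic// lee_wpmul2l ?lee_fin// le_measure ?inE//.
exact: measurableI.
Qed.

End dyadic_layers.

Lemma integrable_dominated_in dT (T : measurableType dT) (R : realType)
    (m : {measure set T -> \bar R}) (D : set T) (f g : T -> R) : measurable D ->
  measurable_fun D f -> (forall x, D x -> `|f x| <= g x) ->
  m.-integrable D (EFin \o g) -> m.-integrable D (EFin \o f).
Proof.
move=> mD mf fg; apply: le_integrable => //; first exact/measurable_EFinP.
by move=> x Dx /=; rewrite lee_fin (le_trans (fg x Dx))// ler_norm.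
Qed.

(** * Integrability of powers on the half-line *)

Section power_integrals.
Context {R : realType}.
Local Notation leb := (@lebesgue_measure R).
Local Notation pos := (`]0%R, +oo[%classic : set R).

Lemma powR2_natr (x : R) k : (2 ^+ k) `^ x = (2 `^ x) ^+ k :> R.
Proof. by rewrite -!powR_mulrn ?powR_ge0// -!powRrM mulrC. Qed.

Lemma measurable_powR_fun (D : set R) (x : R) : measurable_fun D (fun t : R => t `^ x).
Proof. by apply: measurable_funTS; exact: measurable_powR. Qed.

Lemma integral_powR_small (a : R) : 0 < a ->
  (\int[leb]_(t in `]0%R, 1%R]) (t `^ (a - 1))%:E < +oo)%E.
Proof.
(* Lowering the exponent to b - 1 <= 0 makes the power nonincreasing on ]0, 1], so that it is
   bounded on each dyadic layer by an endpoint value. *)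
move=> a0; pose b := Num.min a 1; have b0 : 0 < b by rewrite lt_min a0 ltr01.
have b1 : b <= 1 by rewrite ge_min lexx orbT.
have ba : b <= a by rewrite ge_min lexx.
apply: (@dyadic_layers_lty _ _ _ leb _ _ (fun k => `]0%R, 2 ^- k]%classic)
  (fun k => (2 ^+ k.+1) `^ (1 - b)) (2 `^ (1 - b)) (2 `^ (- b))) => //.
- exact: measurable_powR_fun.
- by move=> x _; rewrite powR_ge0.
- move=> t /=; rewrite in_itv/= => /andP[t0 t1].
  have it1 : 1 <= t^-1 by rewrite invf_ge1.
  have [k /andP[k1 k2]] := dyadic_interval it1.
  exists k.
    by rewrite /= in_itv/= t0/= -[t]invrK lef_pV2// posrE ?invr_gt0// exprn_gt0.
  apply: (@le_trans _ _ (t `^ (b - 1))).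
    by apply: ger_powR; rewrite ?t0// lerD2r.
  rewrite -[b - 1]opprB powRN -powR_inv1; last exact: powR_ge0.
  rewrite -powRrM mulrC powRrM powR_inv1 ?(ltW t0)//.
  by apply: ge0_ler_powR; rewrite ?subr_ge0// ?nnegrE ?invr_ge0 ?(ltW t0)// ltW.
- by rewrite powR_ge0/= -[ltRHS](powRr0 2) /powR ?pnatr_eq0/= ltr_expR mulNr mul0r oppr_lt0 mulr_gt0// ln_gt0// ltr1n.
- move=> k /=; rewrite lebesgue_measure_itv/= lte_fin invr_gt0 exprn_gt0// oppr0 adde0.
  rewrite -EFinM lee_fin exprS powRM// -mulrA ler_wpM2l ?powR_ge0//.
  rewrite !powR2_natr -exprVn -exprMn lerXn2r ?nnegrE ?mulr_ge0 ?powR_ge0//.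
  by rewrite -[X in _ * X](@powR_inv1 R 2)// -powRD ?pnatr_eq0 ?implybT// addrAC subrr add0r.
Qed.

Lemma integral_powR_large (a : R) : 0 < a ->
  (\int[leb]_(t in `[1%R, +oo[) (t `^ (- 1 - a))%:E < +oo)%E.
Proof.
move=> a0.
apply: (@dyadic_layers_lty _ _ _ leb _ _ (fun k => `[2 ^+ k, 2 ^+ k.+1]%classic)
  (fun k => (2 ^+ k) `^ (- 1 - a)) 1 (2 `^ (- a))) => //.
- exact: measurable_powR_fun.
- by move=> x _; rewrite powR_ge0.
- move=> t /=; rewrite in_itv/= andbT => t1.
  have [k /andP[k1 k2]] := dyadic_interval t1.
  exists k; first by rewrite /= in_itv/= k1 ltW.
  rewrite -opprD !powRN lef_pV2 ?posrE ?powR_gt0 ?exprn_gt0//; last exact: lt_le_trans t1.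
  by apply: ge0_ler_powR; rewrite ?nnegrE ?addr_ge0 ?(ltW a0)// (le_trans _ t1).
- by rewrite powR_ge0/= -[ltRHS](powRr0 2) /powR ?pnatr_eq0/= ltr_expR mulNr mul0r oppr_lt0 mulr_gt0// ln_gt0// ltr1n.
- move=> k /=; rewrite lebesgue_measure_itv/= lte_fin ltr_eXn2l ?ltr1n// ltnSn.
  rewrite -EFinD -EFinM lee_fin mul1r exprS mulr_natl mulr2n addrK.
  rewrite powR2_natr -exprMn lerXn2r ?nnegrE ?mulr_ge0 ?powR_ge0//.
  by rewrite -[X in _ * X](@powRr1 R 2)// -powRD ?pnatr_eq0 ?implybT// addrAC addNr add0r.
Qed.

(* Criterion used for all the integrals over the half-line below. *)
Lemma integrable_pos_powR (f : R -> R) (C a b : R) : 0 < a -> 0 < b ->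
  measurable_fun pos f ->
  (forall t, 0 < t <= 1 -> `|f t| <= C * t `^ (a - 1)) ->
  (forall t, 1 <= t -> `|f t| <= C * t `^ (- 1 - b)) ->
  leb.-integrable pos (EFin \o f).
Proof.
move=> a0 b0 mf f1 f2.
have U : pos = `]0%R, 1%R] `|` `]1%R, +oo[.
  apply/seteqP; split => t /=; rewrite !in_itv/= !andbT.
    by move=> t0; have [t1|t1] := leP t 1; [left; rewrite t0|right].
  by move=> [/andP[]//|]; exact: lt_trans.
have i1 : leb.-integrable `]0%R, 1%R] (EFin \o f).
  apply: (@integrable_dominated_in _ _ _ leb _ f (fun t => C * t `^ (a - 1))) => //.
  - apply: (measurable_funS _ _ mf) => //.
    by rewrite U; exact: subsetUl.
  - apply: (@integrableZl _ _ _ leb _ _ C (fun t => (t `^ (a - 1))%:E)) => //.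
    apply/integrableP; split; first by apply/measurable_EFinP; exact: measurable_powR_fun.
    under eq_integral do rewrite /= ger0_norm ?powR_ge0//.
    exact: integral_powR_small.
have i2 : leb.-integrable `]1%R, +oo[ (EFin \o f).
  apply: (@integrable_dominated_in _ _ _ leb _ f (fun t => C * t `^ (-1 - b))) => //.
  - apply: (measurable_funS _ _ mf) => //.
    by rewrite U; exact: subsetUr.
  - by move=> t /=; rewrite in_itv/= andbT => /ltW/f2.
  - apply: (@integrableZl _ _ _ leb _ _ C (fun t => (t `^ (-1 - b))%:E)) => //.
    apply/integrableP; split; first by apply/measurable_EFinP; exact: measurable_powR_fun.
    under eq_integral do rewrite /= ger0_norm ?powR_ge0//.
    apply: le_lt_trans (integral_powR_large b0).
    apply: ge0_subset_integral => //.
    - by apply/measurable_EFinP; exact: measurable_powR_fun.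
    - by move=> t _; rewrite lee_fin powR_ge0.
    - by move=> t; rewrite /= !in_itv/= !andbT => /ltW.
move/integrableP : i1 => [m1 l1]; move/integrableP : i2 => [m2 l2].
apply/integrableP; split; first exact/measurable_EFinP.
rewrite U ge0_integral_setU//=.
- exact: lte_add_pinfty.
- by rewrite -U; apply/measurable_EFinP; apply: measurableT_comp.
- apply/disj_setPS => t [/=]; rewrite !in_itv/= andbT => /andP[_ t1].
  by rewrite ltNge t1.
Qed.

End power_integrals.

Lemma Rintegral_probability_cst dT (T : measurableType dT) (R : realType)
  (P : probability T R) (c : R) : \int[P]_w c = c.
Proof.
rewrite Rintegral_cst//; transitivity (c * fine (1%E : \bar R)); last by rewrite mulr1.
congr (_ * fine _); exact: probability_setT.
Qed.

(** * The change of variable t -> c t on the half-line *)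

Section lebesgue_scaling.
Context {R : realType}.
Local Notation leb := (@lebesgue_measure R).
Local Notation pos := (`]0%R, +oo[%classic : set R).

Let measurable_scale (c : R) : measurable_fun setT (fun x : R => c * x).
Proof. by apply: measurable_funM. Qed.

(** The rescaled image measure gives half-open intervals their length, so it is Lebesgue measure by
    uniqueness. *)
Lemma lebesgue_scale (c : R) : 0 < c -> forall A : set R, measurable A ->
  leb A = (c%:E * leb ((fun x => c * x)%R @^-1` A))%E.
Proof.
move=> c0 A mA.
pose phi : measurableTypeR R -> measurableTypeR R := fun x => c * x.
have mphi : measurable_fun setT phi by exact: measurable_scale.
pose pf : {measure set (measurableTypeR R) -> \bar R} :=
  measure_function_pushforward__canonical__measure_function_Measure leb mphi.
pose m' : {measure set (measurableTypeR R) -> \bar R} := mscale (NngNum (ltW c0)) pf.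
have H := @lebesgue_measure_unique R m'.
rewrite H// => X /ocitvP[->|[[a b] /= ab ->]].
  by rewrite !measure0.
rewrite /m' /mscale/= /pushforward /phi.
have -> : (fun x : R => c * x) @^-1` `]a, b]%classic = `](a / c), (b / c)]%classic.
  by apply/seteqP; split => x; rewrite /= !in_itv/= ltr_pdivrMr// ler_pdivlMr// !(mulrC x).
rewrite !lebesgue_measure_itv/= !lte_fin ltr_pM2r ?invr_gt0//; case: ifPn => _; last by rewrite mule0.
by rewrite -!EFinD -EFinM mulrBr !(mulrC c) !divfK ?gt_eqF.
Qed.

Lemma ge0_integral_pos_scale (c : R) (f : R -> \bar R) : 0 < c ->
  measurable_fun setT f -> (forall t, 0 <= f t)%E ->
  (\int[leb]_(t in pos) f t = c%:E * \int[leb]_(t in pos) f (c * t)%R)%E.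
Proof.
move=> c0 mf f0.
pose phi : measurableTypeR R -> measurableTypeR R := fun x => c * x.
have mphi : measurable_fun setT phi by exact: measurable_scale.
pose pf : {measure set (measurableTypeR R) -> \bar R} :=
  measure_function_pushforward__canonical__measure_function_Measure leb mphi.
pose m' : {measure set (measurableTypeR R) -> \bar R} := mscale (NngNum (ltW c0)) pf.
have -> : (\int[leb]_(t in pos) f t = \int[m']_(t in pos) f t)%E.
  by apply: eq_measure_integral => A mA _; exact: lebesgue_scale.
have mfp : measurable_fun pos f by exact: measurable_funTS.
rewrite ge0_integral_mscale//; congr (_ * _)%E.
rewrite /pf ge0_integral_pushforward//.
rewrite (_ : phi @^-1` pos = pos)//.
by apply/seteqP; split => t; rewrite /= !in_itv/= !andbT pmulr_rgt0.
Qed.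

End lebesgue_scaling.

(** * Absolute moments of order q < alpha from the characteristic function *)

Section absolute_moments.
Context {R : realType}.
Local Notation leb := (@lebesgue_measure R).
Local Notation pos := (`]0%R, +oo[%classic : set R).
Variables (alpha q : R).
Hypotheses (q0 : 0 < q) (qa : q < alpha) (a2 : alpha < 2).

Let measurable_cos : measurable_fun setT (@cos R).
Proof. by apply: continuous_measurable_fun; exact: continuous_cos. Qed.

Lemma one_sub_cos_bound (t : R) : 0 <= 1 - cos t <= t ^+ 2.
Proof.
rewrite subr_ge0 cos_le1/=.
have -> : t = (t / 2) *+ 2 by rewrite -mulr_natr divfK.
rewrite cos_mulr2n; have := cos2Dsin2 (t / 2).
have : sin (t / 2) ^+ 2 <= (t / 2) ^+ 2.
  rewrite -(real_normK (num_real (sin _))) -(real_normK (num_real (t / 2))).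
  rewrite lerXn2r ?nnegrE//; have := sin_lipschitz (t / 2) 0.
  by rewrite sin0 !subr0.
have := sqr_ge0 (t / 2).
move: (sin _ ^+ 2) (cos _ ^+ 2) => u v; rewrite exprMn_n; move: ((t / 2) ^+ 2) => w; lra.
Qed.

Let kern (t : R) := t `^ (- 1 - q).
Let kern0 t : 0 <= kern t. Proof. exact: powR_ge0. Qed.
Let mkern : measurable_fun setT kern. Proof. exact: measurable_powR_fun. Qed.

Let cosker (t : R) := (1 - cos t) * kern t.
Let cosker0 t : 0 <= cosker t.
Proof. by rewrite mulr_ge0//; case/andP: (one_sub_cos_bound t). Qed.
Let mcosker : measurable_fun setT cosker.
Proof. by apply: measurable_funM => //; apply: measurable_funB. Qed.

Let c_q := (\int[leb]_(t in pos) (cosker t)%:E)%E.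

Let powR_small (t b : R) : 0 < t -> t `^ b * kern t = t `^ (b - q - 1).
Proof.
move=> t0; rewrite /kern -powRD; last by rewrite (gt_eqF t0) implybT.
by congr powR; ring.
Qed.

(** At 0 the integrand is at most t^(1-q), integrable as q < alpha < 2; at infinity it is at most 2
    t^(-1-q), integrable as q > 0. *)
Let c_q_lty : (c_q < +oo)%E.
Proof.
have : leb.-integrable pos (EFin \o cosker).
  apply: (@integrable_pos_powR _ _ 2 (2 - q) q) => //.
  - by rewrite subr_gt0 (lt_trans qa).
  - exact: measurable_funTS.
  - move=> t /andP[t0 t1]; rewrite ger0_norm// -powR_small//.
    rewrite mulrA ler_wpM2r// powR_mulrn ?(ltW t0)//.
    have /andP[_ h] := one_sub_cos_bound t.
    by rewrite (le_trans h)// ler_peMl ?sqr_ge0// ler1n.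
  - move=> t t1; rewrite ger0_norm// ler_wpM2r//.
    by have := cos_geN1 t; lra.
move=> /integrableP[_]; apply: le_lt_trans; rewrite le_eqVlt; apply/orP; left; apply/eqP.
by apply: eq_integral => t _ /=; rewrite ger0_norm.
Qed.

Let c_q_gt0 : (0 < c_q)%E.
Proof.
have c1 : cos 1 < 1 :> R.
  rewrite -[ltRHS]cos0 ltr_cos ?ltr01// in_itv/= ?lexx ?pi_ge0 ?ler01//=.
  by rewrite (le_trans _ (pi_ge2 R))// ler1n.
(* A lower bound of the integrand on [1, 2]: cos decreases on [0, pi], which contains [1, 2], and
   the power is decreasing. *)
pose k : R := (1 - cos 1) * 2 `^ (- 1 - q).
have k0 : 0 < k by rewrite mulr_gt0 ?subr_gt0 ?powR_gt0.
apply: (@lt_le_trans _ _ (\int[leb]_(t in `[1%R, 2%R]) k%:E)%E).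
  rewrite integral_cst//= lebesgue_measure_itv/= lte_fin ltr1n/=.
  by rewrite -EFinD -EFinM lte_fin mulr_gt0// subr_gt0 ltr1n.
apply: (@le_trans _ _ (\int[leb]_(t in `[1%R, 2%R]) (cosker t)%:E)%E); last first.
  apply: ge0_subset_integral => //.
  - by apply/measurable_EFinP; exact: measurable_funTS.
  - by move=> t _; rewrite lee_fin.
  - by move=> t; rewrite /= !in_itv/= andbT => /andP[t1 _]; exact: lt_le_trans t1.
apply: ge0_le_integral => //.
- by move=> t _; rewrite lee_fin ltW.
- by apply/measurable_EFinP; exact: measurable_funTS.
move=> t; rewrite /= in_itv/= => /andP[t1 t2]; rewrite lee_fin.
have t0 : 0 < t by exact: lt_le_trans t1.
rewrite ler_pM ?powR_ge0 ?subr_ge0 ?cos_le1//.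
  rewrite lerD2l lerN2; move: t1; rewrite le_eqVlt => /predU1P[<-//|t1].
  rewrite ltW// ltr_cos// in_itv/= ?ler01 ?(ltW t0)/=.
    by rewrite (le_trans _ (pi_ge2 R))// ler1n.
  by rewrite (le_trans t2)// pi_ge2.
rewrite /kern -opprD !powRN lef_pV2 ?posrE ?powR_gt0//.
apply: ge0_ler_powR; rewrite ?nnegrE ?addr_ge0 ?(ltW q0) ?(ltW t0)//.
Qed.

(** Substituting t -> |x| t isolates |x|^q: up to the constant [c_q], this expresses |x|^q as a
    mixture of the functions 1 - cos(t x). *)
Let cosker_scale (x : R) :
  (\int[leb]_(t in pos) ((1 - cos (t * x)) * kern t)%:E = (`|x| `^ q)%:E * c_q)%E.
Proof.
have [->|x0] := eqVneq x 0.
  rewrite normr0 powR0 ?gt_eqF// mul0e integral0_eq// => t _.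
  by rewrite mulr0 cos0 subrr mul0r.
have c0 : 0 < `|x| by rewrite normr_gt0.
have mE : measurable_fun setT (fun t => (cosker t)%:E) by exact/measurable_EFinP.
rewrite /c_q (ge0_integral_pos_scale c0 mE); last by move=> t; rewrite lee_fin.
have -> : (\int[leb]_(t in pos) (cosker (`|x| * t))%:E = \int[leb]_(t in pos)
    ((`|x| `^ (- 1 - q))%:E * ((1 - cos (t * x)) * kern t)%:E))%E.
  apply: eq_integral => t; rewrite inE/= in_itv/= andbT => t0; rewrite -EFinM /cosker /kern/=.
  rewrite powRM ?(ltW t0)//.
  have -> : cos (`|x| * t) = cos (t * x).
    rewrite mulrC; have [x1|x1] := leP 0 x; first by rewrite ger0_norm.
    by rewrite ltr0_norm// mulrN cosN.
  by congr EFin; ring.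
rewrite ge0_integralZl ?lee_fin ?powR_ge0//; last 2 first.
- apply/measurable_EFinP; apply: measurable_funTS; apply: measurable_funM => //.
  apply: measurable_funB => //; apply: measurableT_comp => //.
  exact: measurable_funM.
- by move=> t _; rewrite lee_fin mulr_ge0//; case/andP: (one_sub_cos_bound (t * x)).
rewrite !muleA -!EFinM.
have -> : `|x| `^ q * `|x| * `|x| `^ (- 1 - q) = 1.
  rewrite -[X in _ * X * _](powRr1 (normr_ge0 x)) -!powRD ?(gt_eqF c0) ?implybT//.
  by rewrite (_ : q + 1 + (-1 - q) = 0) ?powRr0//; ring.
by rewrite mul1e.
Qed.

Let expker (s t : R) := (1 - expR (- (s * t `^ alpha))) * kern t.

Let expker0 s t : 0 <= s -> 0 <= expker s t.
Proof.
move=> s0; rewrite mulr_ge0// subr_ge0 -expR0 ler_expR oppr_le0.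
by rewrite mulr_ge0 ?powR_ge0.
Qed.

Let mexpker s : measurable_fun setT (expker s).
Proof.
apply: measurable_funM => //; apply: measurable_funB => //.
apply: measurableT_comp => //; apply: measurableT_comp => //.
by apply: measurable_funM => //; exact: measurable_powR_fun.
Qed.

Let J s := (\int[leb]_(t in pos) (expker s t)%:E)%E.

Let J_lty : (J 1 < +oo)%E.
Proof.
have : leb.-integrable pos (EFin \o expker 1).
  apply: (@integrable_pos_powR _ _ 1 (alpha - q) q) => //.
  - by rewrite subr_gt0.
  - exact: measurable_funTS.
  - move=> t /andP[t0 t1]; rewrite ger0_norm ?expker0// -powR_small//.
    rewrite mul1r /expker mul1r ler_wpM2r// lerBlDr.
    by have := expR_ge1Dx (- (t `^ alpha)); lra.
  - by move=> t t1; rewrite ger0_norm ?expker0// /expker ler_wpM2r.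
move=> /integrableP[_]; apply: le_lt_trans; rewrite le_eqVlt; apply/orP; left; apply/eqP.
by apply: eq_integral => t _ /=; rewrite ger0_norm// expker0.
Qed.

Let J_scale s : 0 <= s -> (J s = (s `^ (q / alpha))%:E * J 1)%E.
Proof.
have al0 : 0 < alpha by exact: lt_trans qa.
rewrite le_eqVlt => /predU1P[<-|s0].
  rewrite powR0 ?mulf_neq0 ?invr_neq0 ?gt_eqF// mul0e /J integral0_eq// => t _.
  by rewrite /expker mul0r oppr0 expR0 subrr mul0r.
pose c := s `^ alpha^-1; have c0 : 0 < c by exact: powR_gt0.
have mE : measurable_fun setT (fun t => (expker 1 t)%:E).
  by apply/measurable_EFinP; exact: mexpker.
rewrite {2}/J (ge0_integral_pos_scale c0 mE); last by move=> t; rewrite lee_fin expker0.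
have -> : (\int[leb]_(t in pos) (expker 1 (c * t))%:E = \int[leb]_(t in pos)
    ((c `^ (- 1 - q))%:E * (expker s t)%:E))%E.
  apply: eq_integral => t; rewrite inE/= in_itv/= andbT => t0; rewrite -EFinM /expker /kern/=.
  rewrite !(powRM _ (ltW c0) (ltW t0)) mul1r.
  have -> : c `^ alpha = s by rewrite /c -powRrM mulVf ?gt_eqF// powRr1// ltW.
  by congr EFin; ring.
rewrite ge0_integralZl ?lee_fin ?powR_ge0//; last 2 first.
- by apply/measurable_EFinP; apply: measurable_funTS; exact: mexpker.
- by move=> t _; rewrite lee_fin expker0// ltW.
rewrite !muleA -!EFinM.
have -> : s `^ (q / alpha) = c `^ q by rewrite /c -powRrM mulrC.
have -> : c `^ q * c * c `^ (- 1 - q) = 1.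
  rewrite -[X in _ * X * _](powRr1 (ltW c0)) -!powRD ?(gt_eqF c0) ?implybT//.
  by rewrite (_ : q + 1 + (-1 - q) = 0) ?powRr0//; ring.
by rewrite mul1e.
Qed.

(** The moment E|Y|^q of a real variable with characteristic function exp(-|t|^alpha). *)
Definition stable_moment : R := fine (J 1) / fine c_q.

(** Integrate the representation of |x|^q and exchange integrals by Tonelli: 1 - cos becomes 1 -
    exp(-s t^alpha), and [J_scale] extracts the power of s. All integrands are nonnegative, so
    finiteness of the moment is a conclusion. *)
Lemma stable_abs_moment dT (T : measurableType dT) (P : probability T R) (X : T -> R) (s : R) :
  measurable_fun setT X -> 0 <= s ->
  (forall t, 0 < t -> \int[P]_w cos (t * X w) = expR (- (s * t `^ alpha))) ->
  (\int[P]_w (`|X w| `^ q)%:E = (s `^ (q / alpha) * stable_moment)%:E)%E.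
Proof.
move=> mX s0 cf.
have ekey : (\int[P]_w (`|X w| `^ q)%:E * c_q = (s `^ (q / alpha))%:E * J 1)%E.
  rewrite -J_scale// -ge0_integralZr//; last 2 first.
  - apply/measurable_EFinP; apply: (measurableT_comp (measurable_powR q)) => //.
    exact: measurableT_comp.
  - exact: ltW.
  under eq_integral do rewrite -cosker_scale integral_mkcond.
  (* The restriction to the half-line is moved into the integrand, so that Tonelli is applied on the
     whole product space. *)
  pose F (z : T * R) := (((fun t => ((1 - cos (t * X z.1)) * kern t)%:E) \_ pos) z.2)%E.
  have F0 z : (0 <= F z)%E.
    rewrite /F patchE; case: ifP => // _.
    by rewrite lee_fin mulr_ge0//; case/andP: (one_sub_cos_bound (z.2 * X z.1)).
  have mF : measurable_fun setT F.
    rewrite (_ : F = (fun z => ((1 - cos (z.2 * X z.1)) * kern z.2 * \1_pos z.2)%:E)); last first.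
      apply/funext => z; rewrite /F patchE indicE.
      by case: ifP => _; rewrite ?mulr1 ?mulr0.
    apply/measurable_EFinP; apply: measurable_funM.
      apply: measurable_funM; last by apply: measurableT_comp => //; exact: measurable_snd.
      apply: measurable_funB => //; apply: measurableT_comp => //.
      apply: measurable_funM; first exact: measurable_snd.
      by apply: measurableT_comp => //; exact: measurable_fst.
    apply: measurableT_comp; last exact: measurable_snd.
    exact: measurable_indic.
  rewrite -[LHS]/(\int[P]_w \int[leb]_t F (w, t))%E fubini_tonelli//.
  rewrite /J [RHS]integral_mkcond; apply: eq_integral => t _.
  rewrite /F/= [RHS]patchE; under [LHS]eq_integral do rewrite patchE.
  case: ifPn => [|_]; last by rewrite integral0_eq.
  rewrite inE/= in_itv/= andbT => t0.
  have ic : P.-integrable setT (EFin \o (fun w => cos (t * X w))).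
    apply: (integrable_bounded (M := 1)).
    - by rewrite -ge0_fin_numE// fin_num_measure.
    - by apply: measurableT_comp => //; apply: measurable_funM.
    - by move=> w; rewrite ler_norml cos_geN1 cos_le1.
  have i1 : P.-integrable setT (EFin \o (fun=> 1 : R)) by exact: finite_measure_integrable_cst.
  under eq_integral do rewrite EFinM.
  rewrite integralZr//; last first.
    by under eq_fun do rewrite EFinB; exact: integrableB.
  rewrite /expker EFinM; congr (_ * _)%E.
  have := RintegralB measurableT i1 ic.
  rewrite (cf t t0) Rintegral_probability_cst => <-.
  rewrite fineK//; apply: integrable_fin_num => //.
  by under eq_fun do rewrite EFinB; exact: integrableB.
have cfin : c_q \is a fin_num by rewrite ge0_fin_numE ?ltW.
have Jfin : J 1 \is a fin_num.
  rewrite ge0_fin_numE//; apply: integral_ge0 => t _; rewrite lee_fin.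
  by rewrite expker0.
have cq0 : 0 < fine c_q by rewrite -lte_fin fineK.
rewrite EFinM /stable_moment EFinM muleA fineK//.
rewrite -ekey -[X in (_ * X * _)%E](fineK cfin) -muleA -EFinM divff ?mule1//.
by rewrite gt_eqF.
Qed.

End absolute_moments.

(** * Euclidean norm *)

Section euclidean_norm.
Context {R : realType} {d : nat}.
Implicit Types x : 'rV[R]_d.

Lemma dotp_ge0 x : 0 <= dotp x x.
Proof. by apply: sumr_ge0 => i _; rewrite -expr2 sqr_ge0. Qed.

Lemma enorm_ge0 x : 0 <= enorm x. Proof. exact: sqrtr_ge0. Qed.

Lemma enorm_coord x i : `|x ord0 i| <= enorm x.
Proof.
rewrite -sqrtr_sqr ler_sqrt ?dotp_ge0// /dotp (bigD1 i)//= -expr2 lerDl.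
by apply: sumr_ge0 => j _; rewrite -expr2 sqr_ge0.
Qed.

Lemma norm_le_enorm x : `|x| <= enorm x.
Proof. by apply: row_norm_le => [|i]; [exact: enorm_ge0|exact: enorm_coord]. Qed.

Lemma enormZ (c : R) x : enorm (c *: x) = `|c| * enorm x.
Proof.
rewrite /enorm dotpZl dotpZr mulrA -expr2 sqrtrM ?sqr_ge0//.
by rewrite sqrtr_sqr.
Qed.

Lemma dotp_enorm_le x z : `|dotp x z| <= (\sum_i `|z ord0 i|) * enorm x.
Proof.
rewrite (le_trans (dotp_norm_le _ _))// ler_wpM2l ?norm_le_enorm//.
exact: sumr_ge0.
Qed.

End euclidean_norm.

(** * Integrability and sigma-finiteness of stable Levy measures *)

Section levy_measures.
Context {R : realType} {d : nat} (nu : {measure set 'rV[R]_d -> \bar R}) (alpha : R).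
Hypotheses (a1 : 1 < alpha) (hnu : stable_levy_measure alpha nu).

Let tail (e : R) : set 'rV[R]_d := [set u | e <= enorm u].

Let measurable_tail e : measurable (tail e).
Proof.
rewrite (_ : tail e = setT `&` (@enorm R d) @^-1` `[e, +oo[%classic).
  exact: measurable_enorm.
by rewrite setTI; apply/seteqP; split => u; rewrite /= in_itv/= andbT.
Qed.

(** The common majorant of all nu-integrands below: these are O(|u|) at infinity and O(|u|^2) at the
    origin. *)
Definition levy_weight (u : 'rV[R]_d) : R := enorm u * Num.min 1 (enorm u).

Lemma measurable_levy_weight : measurable_fun setT levy_weight.
Proof.
apply: measurable_funM; first exact: measurable_enorm.
by apply: measurable_minr => //; exact: measurable_enorm.
Qed.

Lemma levy_weight_ge0 u : 0 <= levy_weight u.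
Proof. by rewrite mulr_ge0 ?le_min ?ler01 ?enorm_ge0. Qed.

Let measurable_min : measurable_fun setT (fun u : 'rV[R]_d => Num.min 1 (enorm u ^+ 2)).
Proof. by apply: measurable_minr => //; apply: measurable_funX; exact: measurable_enorm. Qed.

Let min_ge0 (u : 'rV[R]_d) : 0 <= Num.min 1 (enorm u ^+ 2).
Proof. by rewrite le_min ler01 sqr_ge0. Qed.

Let levy_tail_lty e : 0 < e <= 1 -> (nu (tail e) < +oo)%E.
Proof.
move=> /andP[e0 e1]; case: hnu => -[_ hlt] _.
have : ((e ^+ 2)%:E * nu (tail e) < +oo)%E.
  apply: le_lt_trans hlt; rewrite -integral_cst//.
  apply: (@le_trans _ _ (\int[nu]_(u in tail e) (Num.min 1 (enorm u ^+ 2))%:E)%E).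
    apply: ge0_le_integral => //.
    - by move=> u _; rewrite lee_fin sqr_ge0.
    - by apply/measurable_EFinP; exact: measurable_funTS.
    - move=> u /= eu; rewrite lee_fin le_min expr_le1 ?(ltW e0)// e1/=.
      by rewrite lerXn2r ?nnegrE ?enorm_ge0 ?(ltW e0).
  apply: ge0_subset_integral => //; first exact/measurable_EFinP.
  by move=> u _; rewrite lee_fin.
have := measure_ge0 nu (tail e).
case: (nu (tail e)) => [t _ _|_|//]; first by rewrite ltry.
by rewrite gt0_muley ?lte_fin ?exprn_gt0.
Qed.

Let levy_tail_scale k : nu (tail (2 ^+ k)) = (((2 ^+ k) `^ (- alpha))%:E * nu (tail 1))%E.
Proof.
case: hnu => _ hs; have k0 : 0 < 2 ^+ k :> R by rewrite exprn_gt0.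
rewrite -(hs _ k0 _ (measurable_tail (2 ^+ k))); congr (_ * nu _)%E.
apply/seteqP; split => [_ [u /= ku <-]|u /= u1].
  by rewrite /tail/= enormZ gtr0_norm ?invr_gt0// mulrC ler_pdivlMr// mul1r.
exists (2 ^+ k *: u); last by rewrite scalerA mulVf ?scale1r ?gt_eqF.
by rewrite /tail/= enormZ gtr0_norm// ler_peMr// ltW.
Qed.

(** Near the origin this is the Levy condition. On |u| >= 1, scaling gives nu(|u| >= 2^k) =
    2^(-alpha k) nu(|u| >= 1), so the dyadic layers have ratio 2^(1-alpha), below 1 because alpha >
    1. *)
Lemma levy_integrable : nu.-integrable setT (EFin \o levy_weight).
Proof.
have t1 : (nu (tail 1) < +oo)%E by rewrite levy_tail_lty// ltr01 lexx.
have b1 : nu (tail 1) \is a fin_num by rewrite ge0_fin_numE.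
have big : (\int[nu]_(u in tail 1%R) (enorm u)%:E < +oo)%E.
  apply: (@dyadic_layers_lty _ _ _ nu (tail 1) (@enorm R d) (fun k => tail (2 ^+ k))
    (fun k => 2 ^+ k.+1) (2 * fine (nu (tail 1))) (2 `^ (1 - alpha))) => //.
  - by apply: measurable_funTS; exact: measurable_enorm.
  - by move=> u _; exact: enorm_ge0.
  - move=> u /dyadic_interval[k /andP[k1 k2]]; exists k => //; exact: ltW.
  - rewrite powR_ge0/= -[ltRHS](powRr0 2) /powR ?pnatr_eq0/= ltr_expR mul0r.
    by rewrite nmulr_rlt0 ?subr_lt0// ln_gt0// ltr1n.
  - move=> k; rewrite levy_tail_scale -{1}(fineK b1) -!EFinM lee_fin.
    rewrite exprS powR2_natr mulrA -mulrA -!mulrA ler_wpM2l//.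
    rewrite mulrA mulrC ler_wpM2l ?fine_ge0// -exprMn.
    by rewrite -[X in X * _](@powRr1 R 2)// -powRD ?pnatr_eq0 ?implybT.
apply/integrableP; split; first by apply/measurable_EFinP; exact: measurable_levy_weight.
under eq_integral do rewrite /= ger0_norm ?levy_weight_ge0//.
apply: (@le_lt_trans _ _ (\int[nu]_u ((Num.min 1 (enorm u ^+ 2))%:E +
   (enorm u * \1_(tail 1) u)%:E))%E).
  apply: ge0_le_integral => //.
  - by move=> u _; rewrite lee_fin levy_weight_ge0.
  - by apply/measurable_EFinP; exact: measurable_levy_weight.
  - apply: emeasurable_funD; apply/measurable_EFinP => //.
    by apply: measurable_funM; [exact: measurable_enorm|exact: measurable_indic].
  - move=> u _; rewrite -EFinD lee_fin /levy_weight indicE.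
    have u0 := enorm_ge0 u; have [u1|u1] := leP 1 (enorm u).
      by rewrite mem_set//= mulr1 lerDr.
    rewrite memNset ?mulr0 ?addr0; last by rewrite /tail /= leNgt u1.
    by rewrite -expr2 le_min lexx andbT expr_le1// ltW.
rewrite ge0_integralD//; last 4 first.
- by move=> u _; rewrite lee_fin.
- exact/measurable_EFinP.
- by move=> u _; rewrite lee_fin mulr_ge0// enorm_ge0.
- apply/measurable_EFinP; apply: measurable_funM; first exact: measurable_enorm.
  exact: measurable_indic.
apply: lte_add_pinfty; first by case: hnu => -[].
rewrite (_ : (\int[nu]_u _)%E = (\int[nu]_(u in tail 1%R) (enorm u)%:E)%E)//.
rewrite [RHS]integral_mkcond; apply: eq_integral => u _.
by rewrite patchE indicE; case: ifP => _; rewrite ?mulr1 ?mulr0.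
Qed.

Lemma levy_sigma_finite : sigma_finite setT nu.
Proof.
(* Index 0 is reserved for the origin, which is nu-null; the index k'+1 gives the complement of the
   open ball of radius 1/(k'+1), of finite measure. *)
exists (fun k => if k is k'.+1 then tail k'.+1%:R^-1 else [set u | enorm u = 0]).
  apply/seteqP; split => // u _; have := enorm_ge0 u; rewrite le_eqVlt => /predU1P[u0|u0].
    by exists 0%N.
  exists (Num.bound (enorm u)^-1).+1 => //=; rewrite /tail/= invf_ple ?posrE//.
  rewrite (le_trans (ltW (archi_boundP _)))// ?invr_ge0 ?(ltW u0)//.
  by rewrite ler_nat.
have m0 : measurable [set u : 'rV[R]_d | enorm u = 0].
  rewrite -[X in measurable X]setTI.
  by have := @measurable_enorm R d measurableT [set 0]; apply.
move=> [|k]; split => //.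
  rewrite (_ : [set u : 'rV[R]_d | enorm u = 0] = [set 0]).
    by case: hnu => -[-> _] _.
  apply/seteqP; split => u /=.
    by move=> u0; apply/eqP; rewrite -normr_le0 -[leRHS]u0 norm_le_enorm.
  by move=> ->; rewrite /enorm /dotp big1 ?sqrtr0// => i _; rewrite mxE mul0r.
by apply: levy_tail_lty; rewrite invr_gt0 ltr0Sn/= invf_le1 ?ler1n.
Qed.

End levy_measures.

(** * Differentiation under the integral sign *)

Lemma cos_norm_le1 (R : realType) (t : R) : `|cos t| <= 1.
Proof. by rewrite ler_norml cos_geN1 cos_le1. Qed.

Lemma sin_norm_le1 (R : realType) (t : R) : `|sin t| <= 1.
Proof. by rewrite ler_norml sin_geN1 sin_le1. Qed.

Section derivative_of_integral.
Context dT (T : measurableType dT) (R : realType) (m : {measure set T -> \bar R}).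
Variables (phi psi G : T -> R) (g g' : R -> R).
Hypothesis dg : forall t : R, is_derive t 1 g (g' t).
Hypothesis ig : forall s, m.-integrable setT (EFin \o (fun x => g (phi x + s * psi x))).
Hypothesis gG : forall s x, `|s| < 1 -> `|g' (phi x + s * psi x) * psi x| <= G x.
Hypothesis iG : m.-integrable setT (EFin \o G).

(** Dominated differentiation at 0, with a majorant required only for |s| < 1. It serves for
    frequency derivatives under both mu and nu. *)
Lemma is_derive_integral_shift : is_derive (0 : R) 1
  (fun s : R => \int[m]_x g (phi x + s * psi x)) (\int[m]_x (g' (phi x) * psi x)).
Proof.
have daff (a b s : R) : is_derive s 1 (fun s : R => a + s * b) b.
  have := @is_deriveD _ _ _ (cst a) (id * cst b) s 1 0 _ (is_derive_cst _ _ _)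
    (@is_deriveM _ _ id (cst b) s 1 1 0 _ _).
  by move=> /(_ _ _)/is_derive_eq; apply; rewrite scaler0 !add0r [LHS]mulr1.
pose f (s : R) x := g (phi x + s * psi x).
have df (s : R) x : is_derive s (1 : R) (f^~ x) (g' (phi x + s * psi x) * psi x).
  by apply: (@is_derive1_comp _ g (fun s : R => phi x + s * psi x)).
have d1f s x : partial1of2 f s x = g' (phi x + s * psi x) * psi x.
  by rewrite partial1of2E; exact: derive_val.
have G0 x : 0 <= G x.
  by have := @gG 0 x; rewrite normr0 ltr01 => /(_ isT); exact: le_trans.
have I0 : `](-1 : R), 1[%classic (0 : R) by rewrite /= in_itv/= ltrN10 ltr01.
have ub s x : `](-1 : R), 1[%classic s -> setT x -> `|partial1of2 f s x| <= G x.
  by rewrite /= in_itv/= => s1 _; rewrite d1f gG// ltr_norml.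
have der (s : R) x : `](-1 : R), 1[%classic s -> setT x -> derivable (f^~ x) s 1.
  by move=> _ _; case: (df s x).
have dd := derivable_under_integral measurableT I0 (fun s _ => ig s) der G0 iG ub.
have de := differentiation_under_integral measurableT I0 (fun s _ => ig s) der G0 iG ub.
apply: DeriveDef => //; rewrite -derive1E de.
by apply: eq_Rintegral => x _ /=; rewrite d1f mul0r addr0.
Qed.

End derivative_of_integral.

Lemma le_levy_weight (R : realType) d (u : 'rV[R]_d) (t A B : R) : 0 <= A -> 0 <= B ->
  (1 <= enorm u -> t <= A * enorm u) -> (enorm u <= 1 -> t <= B * enorm u ^+ 2) ->
  t <= (A + B) * levy_weight u.
Proof.
move=> A0 B0 h1 h2; rewrite /levy_weight.
have u0 := enorm_ge0 u; have [u1|u1] := leP 1 (enorm u).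
  by rewrite mulr1 (le_trans (h1 u1))// ler_wpM2r// lerDl.
by rewrite -expr2 (le_trans (h2 (ltW u1)))// ler_wpM2r ?sqr_ge0// lerDr.
Qed.

(** * Fourier identities for the stable law *)

Section stable_law_identities.
Context {R : realType} {d : nat} (nu : {measure set 'rV[R]_d -> \bar R})
  (sigma lambda1 : {finite_measure set 'rV[R]_d -> \bar R})
  (mu : probability 'rV[R]_d R) (alpha : R).
Hypotheses (a1 : 1 < alpha) (a2 : alpha < 2).
Hypotheses (hnu : stable_levy_measure alpha nu) (hlaw : stable_law nu mu)
  (hspec : spectral_measure alpha sigma mu lambda1).
Implicit Types xi : 'rV[R]_d.

(** The function psi such that the characteristic function of mu is exp(-psi). *)
Definition spectral_exponent xi : R :=
  \int[lambda1]_(y in sphere) `|dotp y xi| `^ alpha.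

Lemma spectral_exponent_ge0 xi : 0 <= spectral_exponent xi.
Proof. by apply: Rintegral_ge0 => y _; exact: powR_ge0. Qed.

Lemma law_cos xi : \int[mu]_x cos (dotp x xi) = expR (- spectral_exponent xi).
Proof.
have [_ _ _ /(_ xi) /(congr1 (@complex.Re R))] := hspec.
rewrite /= cos0 mulr1 => <-.
by apply: eq_Rintegral => x _; rewrite /= expR0 mul1r.
Qed.

Lemma law_sin xi : \int[mu]_x sin (dotp x xi) = 0.
Proof.
have [_ _ _ /(_ xi) /(congr1 (@complex.Im R))] := hspec.
rewrite /= sin0 mulr0 => <-.
by apply: eq_Rintegral => x _; rewrite /= expR0 mul1r.
Qed.

Let ilevy (f : 'rV[R]_d -> R) (C : R) : measurable_fun setT f ->
  (forall u, `|f u| <= C * levy_weight u) -> nu.-integrable setT (EFin \o f).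
Proof.
move=> mf fC; apply: (integrable_dominated mf fC).
exact: integrableZl (levy_integrable a1 hnu).
Qed.

Let measurable_cosd xi c : measurable_fun setT (fun x : 'rV[R]_d => cos (dotp x xi + c)).
Proof. exact: bounded_lipschitz_measurable (bounded_lipschitz_cos xi c). Qed.

Let measurable_sind xi c : measurable_fun setT (fun x : 'rV[R]_d => sin (dotp x xi + c)).
Proof.
rewrite (_ : (fun _ => _) = (fun x => cos (dotp x xi + (c - pi / 2)))); first exact: measurable_cosd.
by apply/funext => x; rewrite addrA cosBpihalf.
Qed.

Let S xi : R := \sum_i `|xi ord0 i|.
Let S0 xi : 0 <= S xi. Proof. exact: sumr_ge0. Qed.

Let i1cos xi : nu.-integrable setT (EFin \o (fun u => 1 - cos (dotp u xi))).
Proof.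
apply: (@ilevy _ (2 + S xi ^+ 2)).
  apply: measurable_funB => //; have := measurable_cosd xi 0.
  by under eq_fun do rewrite addr0.
move=> u; have /andP[c0 c1] := one_sub_cos_bound (dotp u xi).
rewrite ger0_norm//; apply: le_levy_weight => // [|u1|_]; first exact: sqr_ge0.
  by have := cos_geN1 (dotp u xi); lra.
rewrite (le_trans c1)// -exprMn -(real_normK (num_real (dotp _ _))).
by rewrite lerXn2r ?nnegrE ?mulr_ge0 ?enorm_ge0// dotp_enorm_le.
Qed.

(** Both formulas for the characteristic function have the same modulus. Squared moduli eliminate
    the imaginary part b, and injectivity of the exponential identifies the real exponents. *)
Lemma levy_exponent xi : \int[nu]_u (1 - cos (dotp u xi)) = spectral_exponent xi.
Proof.
have := hlaw xi; have [_ _ _ /(_ xi) ->] := hspec; rewrite /cintegral.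
set z := (X in cexp (X +i* _)%C = _); set a := Rintegral _ _ _; set b := Rintegral _ _ _.
move=> E; have := congr1 (@complex.Re R) E; have := congr1 (@complex.Im R) E.
rewrite /= sin0 cos0 mulr1 mulr0 => Ei Er.
have zE : z = a.
  have : expR z ^+ 2 = expR a ^+ 2.
    have -> : expR a ^+ 2 = (expR a * cos b) ^+ 2 + (expR a * sin b) ^+ 2.
      by rewrite !exprMn -mulrDr cos2Dsin2 mulr1.
    by rewrite -Er -Ei expr0n addr0.
  move=> /eqP; rewrite eqrXn2 ?expR_ge0// => /eqP.
  exact: expR_inj.
have aE : a = - \int[nu]_u (1 - cos (dotp u xi)).
  rewrite -mulN1r -RintegralZl//; apply: eq_Rintegral => u _ /=.
  by rewrite expR0 mul1r; ring.
by rewrite -[LHS]opprK -aE -zE opprK.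
Qed.

Lemma measurable_sphere : measurable (@sphere R d).
Proof.
rewrite -[X in measurable X]setTI.
by have := @measurable_enorm R d measurableT [set 1]; apply.
Qed.

Lemma spectral_integrable xi :
  lambda1.-integrable sphere (EFin \o (fun y => `|dotp y xi| `^ alpha)).
Proof.
have al0 : 0 <= alpha by rewrite ltW// (lt_trans ltr01).
have mS := measurable_sphere.
apply: (@integrable_dominated_in _ _ _ _ _ _ (fun=> S xi `^ alpha)) => //.
- apply: measurable_funTS; apply: (measurableT_comp (measurable_powR alpha)).
  by apply: measurableT_comp => //; exact: measurable_dotp.
- move=> y /= y1; rewrite ger0_norm ?powR_ge0//.
  apply: ge0_ler_powR; rewrite ?nnegrE//.
  by rewrite (le_trans (dotp_enorm_le _ _))// y1 mulr1.
- exact: finite_measure_integrable_cst.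
Qed.

Lemma spectral_exponentZ (c : R) xi : 0 <= c ->
  spectral_exponent (c *: xi) = c `^ alpha * spectral_exponent xi.
Proof.
move=> c0; have mS := measurable_sphere.
rewrite -RintegralZl//; last exact: spectral_integrable.
by apply: eq_Rintegral => y _; rewrite dotpZr normrM (ger0_norm c0) powRM.
Qed.

(** By homogeneity of psi, the variable <.,xi> under mu has characteristic function exp(-psi(xi)
    t^alpha) for t > 0. *)
Lemma stable_law_moment (q : R) xi : 0 < q < alpha ->
  (\int[mu]_x (`|dotp x xi| `^ q)%:E =
   (spectral_exponent xi `^ (q / alpha) * stable_moment alpha q)%:E)%E.
Proof.
move=> /andP[q0 qa]; apply: stable_abs_moment => //.
- exact: measurable_dotp.
- exact: spectral_exponent_ge0.
move=> t t0; rewrite mulrC -spectral_exponentZ ?(ltW t0)// -law_cos.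
by apply: eq_Rintegral => x _; rewrite dotpZr.
Qed.

Lemma law_moment_integrable (q : R) xi : 0 < q < alpha ->
  mu.-integrable setT (EFin \o (fun x => `|dotp x xi| `^ q)).
Proof.
move=> qa; apply/integrableP; split.
  apply/measurable_EFinP; apply: (measurableT_comp (measurable_powR q)).
  by apply: measurableT_comp => //; exact: measurable_dotp.
under eq_integral do rewrite /= ger0_norm ?powR_ge0//.
by rewrite stable_law_moment// ltry.
Qed.

Lemma law_coord_integrable j : mu.-integrable setT (EFin \o (fun x => x ord0 j)).
Proof.
have h1 : 0 < (1 : R) < alpha by rewrite ltr01.
apply: (integrable_dominated _ _ (law_moment_integrable (delta_mx ord0 j) h1)).
  exact: measurable_coord.
by move=> x; rewrite dotp_delta powRr1.
Qed.

Let ibounded (f : 'rV[R]_d -> R) (M : R) : measurable_fun setT f ->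
  (forall x, `|f x| <= M) -> mu.-integrable setT (EFin \o f).
Proof.
by move=> mf fM; apply: (integrable_bounded _ mf fM); rewrite -ge0_fin_numE// fin_num_measure.
Qed.

Let dotp_shift x xi j (s : R) :
  dotp x (xi + s *: delta_mx ord0 j) = dotp x xi + s * x ord0 j.
Proof. by rewrite dotpDr dotpZr dotp_delta. Qed.

Let e_ j : 'rV[R]_d := delta_mx ord0 j.

(** The j-th partial derivative of psi at xi, obtained by differentiating the Levy form of psi. *)
Definition levy_sine_moment j xi : R := \int[nu]_u (sin (dotp u xi) * u ord0 j).

Let Smax xi j : R := S xi + S (e_ j).

Let S_shift xi j (s : R) : `|s| < 1 -> S (xi + s *: e_ j) <= Smax xi j.
Proof.
move=> s1; rewrite /Smax /S -big_split/=; apply: ler_sum => i _.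
rewrite !mxE (le_trans (ler_normD _ _))// lerD2l normrM.
by rewrite ler_piMl// ltW.
Qed.

Let is_derive_spectral j xi :
  is_derive (0 : R) 1 (fun s : R => spectral_exponent (xi + s *: e_ j))
    (levy_sine_moment j xi).
Proof.
have -> : (fun s : R => spectral_exponent (xi + s *: e_ j)) =
    (fun s : R => \int[nu]_u (1 - cos (dotp u xi + s * u ord0 j))).
  apply/funext => s; rewrite -levy_exponent.
  by apply: eq_Rintegral => u _; rewrite dotp_shift.
apply: (@is_derive_integral_shift _ _ _ nu (fun u => dotp u xi) (fun u => u ord0 j)
  (fun u => (1 + Smax xi j) * levy_weight u) (fun t => 1 - cos t) sin).
- move=> t; have : is_derive t 1 (cst 1 - @cos R) (0 - - sin t) by apply: is_deriveB.
  by rewrite opprK add0r.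
- by move=> s; under eq_fun do rewrite -dotp_shift; exact: i1cos.
- move=> s u s1; rewrite normrM; apply: le_levy_weight => //.
  + by rewrite addr_ge0.
  + move=> _; rewrite mul1r -[leRHS]mul1r ler_pM ?enorm_coord//.
    by rewrite ler_norml sin_geN1 sin_le1.
  + move=> _; rewrite expr2 mulrA ler_pM ?enorm_coord//.
    have := sin_lipschitz (dotp u xi + s * u ord0 j) 0.
    rewrite sin0 !subr0 -dotp_shift => /le_trans; apply.
    by rewrite (le_trans (dotp_enorm_le _ _))// ler_wpM2r ?enorm_ge0// S_shift.
- exact: integrableZl (levy_integrable a1 hnu).
Qed.

Let is_derive_law j xi (g g' : R -> R) : (forall t : R, is_derive t 1 g (g' t)) ->
  measurable_fun setT g -> (forall t, `|g t| <= 1) -> (forall t, `|g' t| <= 1) ->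
  is_derive (0 : R) 1 (fun s : R => \int[mu]_x g (dotp x (xi + s *: e_ j)))
    (\int[mu]_x (g' (dotp x xi) * x ord0 j)).
Proof.
move=> dg mg g1 g'1.
have -> : (fun s : R => \int[mu]_x g (dotp x (xi + s *: e_ j))) =
    (fun s : R => \int[mu]_x g (dotp x xi + s * x ord0 j)).
  by apply/funext => s; apply: eq_Rintegral => x _; rewrite dotp_shift.
apply: (@is_derive_integral_shift _ _ _ mu (fun u => dotp u xi) (fun u => u ord0 j)
  (fun x => `|x ord0 j|) g g') => //.
- move=> s; under eq_fun do rewrite -dotp_shift.
  apply: (@ibounded _ 1) => //; apply: measurableT_comp => //; exact: measurable_dotp.
- by move=> s x _; rewrite normrM ler_piMl.
- exact: integrable_norm (law_coord_integrable j).
Qed.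

(** Differentiate in the direction e_j the identity between the mu-integral of cos<x,xi> and
    exp(-psi(xi)). *)
Lemma law_coord_sin j xi : \int[mu]_x (x ord0 j * sin (dotp x xi)) =
  expR (- spectral_exponent xi) * levy_sine_moment j xi.
Proof.
have nsin1 (t : R) : `|- sin t| <= 1 by rewrite normrN sin_norm_le1.
have d1 := is_derive_law j xi (@is_derive_cos R)
  (continuous_measurable_fun (@continuous_cos R)) (@cos_norm_le1 R) nsin1.
have d2 : is_derive (0 : R) 1 (fun s : R => expR (- spectral_exponent (xi + s *: e_ j)))
    (expR (- spectral_exponent (xi + 0 *: e_ j)) * - levy_sine_moment j xi).
  apply: (@is_derive1_comp _ expR (fun s : R => - spectral_exponent (xi + s *: e_ j))).
  exact: is_deriveN (is_derive_spectral j xi).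
rewrite scale0r addr0 in d2.
have E : (fun s : R => \int[mu]_x cos (dotp x (xi + s *: e_ j))) =
    (fun s : R => expR (- spectral_exponent (xi + s *: e_ j))).
  by apply/funext => s; exact: law_cos.
rewrite E in d1.
have := @derive_val _ _ _ _ _ _ _ d1; rewrite (@derive_val _ _ _ _ _ _ _ d2).
rewrite mulrN => dE; rewrite -[RHS]opprK dE -mulN1r -RintegralZl//.
  by apply: eq_Rintegral => x _; ring.
apply: (integrable_dominated _ _ (integrable_norm (law_coord_integrable j))).
  apply: measurable_funM; last exact: measurable_coord.
  apply: measurableT_comp => //; apply: (measurableT_comp _ (measurable_dotp _)).
  exact: continuous_measurable_fun (@continuous_sin R).
by move=> x; rewrite normrM normrN ler_piMl// sin_norm_le1.
Qed.

Lemma law_coord_cos j xi : \int[mu]_x (x ord0 j * cos (dotp x xi)) = 0.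
Proof.
have d1 := is_derive_law j xi (@is_derive_sin R)
  (continuous_measurable_fun (@continuous_sin R)) (@sin_norm_le1 R) (@cos_norm_le1 R).
have E : (fun s : R => \int[mu]_x sin (dotp x (xi + s *: e_ j))) = cst 0.
  by apply/funext => s; exact: law_sin.
rewrite E in d1; have := @derive_val _ _ _ _ _ _ _ d1; rewrite derive_cst => ->.
by apply: eq_Rintegral => x _; rewrite mulrC.
Qed.

(** A partial derivative of an alpha-homogeneous function is (alpha-1)-homogeneous: s -> psi(c (xi +
    s e_j)) is differentiated in two ways. *)
Lemma levy_sine_momentZ j (c : R) xi : 0 < c ->
  levy_sine_moment j (c *: xi) = c `^ (alpha - 1) * levy_sine_moment j xi.
Proof.
move=> c0.
have d1 : is_derive (0 : R) 1 (fun s : R => spectral_exponent (c *: (xi + s *: e_ j)))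
    (c `^ alpha *: levy_sine_moment j xi).
  rewrite (_ : (fun _ => _) = c `^ alpha \*: (fun s : R => spectral_exponent (xi + s *: e_ j))).
    exact: is_deriveZ (is_derive_spectral j xi).
  by apply/funext => s; rewrite spectral_exponentZ ?ltW.
have dc (s : R) : is_derive s 1 (fun s : R => c * s) c.
  have : is_derive s 1 (c \*: (@id R)) (c *: 1) by apply: is_deriveZ.
  by rewrite [c *: 1]mulr1.
have d2 : is_derive (0 : R) 1 (fun s : R => spectral_exponent (c *: xi + (c * s) *: e_ j))
    (levy_sine_moment j (c *: xi) * c).
  apply: (@is_derive1_comp _ (fun s : R => spectral_exponent (c *: xi + s *: e_ j))
    (fun s => c * s)) => //.
  by rewrite mulr0; exact: is_derive_spectral.
have E : (fun s : R => spectral_exponent (c *: (xi + s *: e_ j))) =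
    (fun s : R => spectral_exponent (c *: xi + (c * s) *: e_ j)).
  by apply/funext => s; rewrite scalerDr scalerA.
rewrite E in d1.
have := @derive_val _ _ _ _ _ _ _ d1; rewrite (@derive_val _ _ _ _ _ _ _ d2) => h.
apply: (mulIf (lt0r_neq0 c0)); rewrite h.
have al0 : 0 < alpha by exact: lt_trans a1.
by rewrite -(mulr_powRB1 (ltW c0) al0) mulrAC [c * _]mulrC.
Qed.

(** * Integration by parts for the stable law *)

Section integration_by_parts.
Variables (b c : R) (j : 'I_d).
Hypotheses (b0 : 0 < b) (c0 : 0 < c).

(** In the application b = (1 - e^(-alpha t))^(1/alpha) and c = e^(-t): this is then the j-th
    coordinate of the fractional gradient, in x, of the integrand of the semigroup. *)
Definition levy_gradient (f : 'rV[R]_d -> R) (y : 'rV[R]_d) : R :=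
  \int[nu]_u (2^-1 * (f (b *: y + c *: u) - f (b *: y - c *: u)) * u ord0 j).

Let gbound M L (f : 'rV[R]_d -> R) (y u : 'rV[R]_d) : bounded_lipschitz M L f ->
  `|2^-1 * (f (b *: y + c *: u) - f (b *: y - c *: u)) * u ord0 j| <=
  (`|M| + `|L| * c) * levy_weight u.
Proof.
move=> [fM fL].
have u0 := enorm_ge0 u.
rewrite normrM; apply: le_levy_weight => //; first by rewrite mulr_ge0// ltW.
  move=> _; rewrite ler_pM ?enorm_coord// normrM gtr0_norm ?invr_gt0//.
  rewrite mulrC ler_pdivrMr// (le_trans (ler_normB _ _))// mulr_natr mulr2n.
  by rewrite lerD// (le_trans (fM _))// ler_norm.
move=> _; rewrite expr2 mulrA ler_pM ?enorm_coord// normrM gtr0_norm ?invr_gt0//.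
rewrite mulrC ler_pdivrMr// (le_trans (fL _ _))//.
have -> : b *: y + c *: u - (b *: y - c *: u) = (c *+ 2) *: u.
  by rewrite opprD opprK addrACA subrr add0r mulr2n scalerDl.
rewrite normrZ ger0_norm ?mulrn_wge0 ?(ltW c0)//.
have -> : `|L| * c * enorm u * 2 = `|L| * (c *+ 2 * enorm u) by ring.
apply: (@le_trans _ _ (`|L| * (c *+ 2 * `|u|))).
  by rewrite ler_wpM2r ?ler_norm// mulr_ge0 ?mulrn_wge0 ?(ltW c0).
by rewrite ler_wpM2l// ler_wpM2l ?norm_le_enorm ?mulrn_wge0 ?(ltW c0).
Qed.

Let gmeas M L (f : 'rV[R]_d -> R) (y : 'rV[R]_d) : bounded_lipschitz M L f -> measurable_fun setT
  (fun u : 'rV[R]_d => 2^-1 * (f (b *: y + c *: u) - f (b *: y - c *: u)) * u ord0 j).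
Proof.
move=> /bounded_lipschitz_measurable mf.
apply: measurable_funM; last exact: measurable_coord.
apply: measurable_funM => //; apply: measurable_funB; apply: (measurableT_comp mf).
  by apply: measurable_rowD => //; apply: measurable_rowZ.
apply: measurable_rowD => //; under eq_fun do rewrite -scaleNr.
by apply: measurable_rowZ.
Qed.

Let gint M L (f : 'rV[R]_d -> R) (y : 'rV[R]_d) : bounded_lipschitz M L f -> nu.-integrable setT (EFin \o
  (fun u : 'rV[R]_d => 2^-1 * (f (b *: y + c *: u) - f (b *: y - c *: u)) * u ord0 j)).
Proof. by move=> fML; apply: ilevy (gmeas y fML) (fun u => gbound y u fML). Qed.

Let W := \int[nu]_u levy_weight u.

Let levy_gradient_bound M L (f : 'rV[R]_d -> R) (y : 'rV[R]_d) : bounded_lipschitz M L f ->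
  `|levy_gradient f y| <= (`|M| + `|L| * c) * W.
Proof.
move=> fML; have iw := levy_integrable a1 hnu.
rewrite (le_trans (le_normr_Rintegral _ (gint y fML)))// -RintegralZl//.
apply: le_Rintegral => //.
- exact: integrable_norm (gint y fML).
- exact: integrableZl iw.
- by move=> u _; exact: gbound.
Qed.

Let right_integrable M L (f : 'rV[R]_d -> R) : bounded_lipschitz M L f ->
  mu.-integrable setT (EFin \o (fun y : 'rV[R]_d => y ord0 j * f (b *: y))).
Proof.
move=> fML; have mf := bounded_lipschitz_measurable fML.
apply: (@integrable_dominated _ _ _ _ _ (fun y : 'rV[R]_d => M * `|y ord0 j|)).
- apply: measurable_funM; first exact: measurable_coord.
  by apply: (measurableT_comp mf); apply: measurable_rowZ.
- by move=> y; rewrite normrM mulrC ler_wpM2r//; exact: fML.1.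
- exact: integrableZl (integrable_norm (law_coord_integrable j)).
Qed.

Let ibp (f : 'rV[R]_d -> R) := \int[mu]_y levy_gradient f y =
  (c / b) `^ (alpha - 1) * \int[mu]_y (y ord0 j * f (b *: y)).

(** Bounds and measurability are part of the class, so that both sides of the identity are honest
    integrals and linearity may be used. *)
Let V (f : 'rV[R]_d -> R) := exists M L,
  [/\ bounded_lipschitz M L f, measurable_fun setT (levy_gradient f) & ibp f].

Let V_integrable f : V f -> mu.-integrable setT (EFin \o levy_gradient f).
Proof. by move=> [M [L [fML mg _]]]; apply: (ibounded mg) => y; exact: levy_gradient_bound fML. Qed.

Let V_lin (r : R) f g : V f -> V g -> V (fun x => r * f x + g x).
Proof.
move=> Vf Vg; have If := V_integrable Vf; have Ig := V_integrable Vg.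
case: Vf Vg => [M [L [fML mf fE]]] [M' [L' [gML mg gE]]].
have DE : levy_gradient (fun x => r * f x + g x) =
    (fun y => r * levy_gradient f y + levy_gradient g y).
  apply/funext => y; rewrite /levy_gradient -Rintegral_lin; [|exact: gint fML|exact: gint gML].
  by apply: eq_Rintegral => u _; ring.
exists (`|r| * M + M'), (`|r| * L + L'); split.
- split => [x|x y].
    by rewrite (le_trans (ler_normD _ _))// lerD ?normrM ?ler_wpM2l//; [exact: fML.1|exact: gML.1].
  rewrite (_ : _ - _ = r * (f x - f y) + (g x - g y)); last by ring.
  rewrite (le_trans (ler_normD _ _))// mulrDl lerD ?normrM//; last exact: gML.2.
  by rewrite -mulrA ler_wpM2l//; exact: fML.2.
- by rewrite DE; apply: measurable_funD => //; apply: measurable_funM.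
- rewrite /ibp DE Rintegral_lin// fE gE.
  rewrite (_ : \int[mu]_y (y ord0 j * (r * f (b *: y) + g (b *: y))) =
     \int[mu]_y (r * (y ord0 j * f (b *: y)) + y ord0 j * g (b *: y))); last first.
    by apply: eq_Rintegral => y _; ring.
  by rewrite Rintegral_lin; [ring|exact: right_integrable fML|exact: right_integrable gML].
Qed.

(** For a cosine, [levy_gradient] is - d_j psi(c xi) sin(<y, b xi> + A). Integrating against mu,
    both sides are multiples of - sin A exp(-psi(b xi)), with coefficients d_j psi(c xi) and
    (c/b)^(alpha-1) d_j psi(b xi), equal by homogeneity. *)
Let V_cos xi (A : R) : V (fun x => cos (dotp x xi + A)).
Proof.
pose P (y : 'rV[R]_d) := dotp y (b *: xi) + A.
have isin (zeta : 'rV[R]_d) :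
    nu.-integrable setT (EFin \o (fun u => sin (dotp u zeta) * u ord0 j)).
  apply: (@ilevy _ (1 + S zeta)).
    apply: measurable_funM; last exact: measurable_coord.
    by have := measurable_sind zeta 0; under eq_fun do rewrite addr0.
  move=> u; rewrite normrM; apply: le_levy_weight => // _.
    by rewrite ler_pM ?enorm_coord// sin_norm_le1.
  rewrite expr2 mulrA ler_pM ?enorm_coord//.
  have := sin_lipschitz (dotp u zeta) 0; rewrite sin0 !subr0 => /le_trans; apply.
  exact: dotp_enorm_le.
have DE : levy_gradient (fun x => cos (dotp x xi + A)) =
    (fun y => - levy_sine_moment j (c *: xi) * sin (P y)).
  apply/funext => y; rewrite /levy_gradient mulNr mulrC -mulNr -RintegralZl//.
  apply: eq_Rintegral => u _.
  rewrite /P !dotpDl -(scaleN1r (c *: u)) !dotpZl !dotpZr.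
  rewrite (_ : b * dotp y xi + c * dotp u xi + A = (b * dotp y xi + A) + c * dotp u xi); last by ring.
  rewrite (_ : b * dotp y xi + -1 * (c * dotp u xi) + A = (b * dotp y xi + A) - c * dotp u xi); last by ring.
  by rewrite cosD cosB; field.
have mP : measurable_fun setT (fun y => sin (P y)) by exact: measurable_sind.
have bl := bounded_lipschitz_cos xi A.
have mc0 (zeta : 'rV[R]_d) : measurable_fun setT (fun x : 'rV[R]_d => cos (dotp x zeta)).
  by have := measurable_cosd zeta 0; under eq_fun do rewrite addr0.
have ms0 (zeta : 'rV[R]_d) : measurable_fun setT (fun x : 'rV[R]_d => sin (dotp x zeta)).
  by have := measurable_sind zeta 0; under eq_fun do rewrite addr0.
have ijg (g : 'rV[R]_d -> R) : measurable_fun setT g -> (forall x, `|g x| <= 1) ->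
    mu.-integrable setT (EFin \o (fun x : 'rV[R]_d => x ord0 j * g x)).
  move=> mg g1; apply: (integrable_dominated _ _ (integrable_norm (law_coord_integrable j))).
    by apply: measurable_funM => //; exact: measurable_coord.
  by move=> x; rewrite normrM ler_piMr.
exists 1, (\sum_i `|xi ord0 i|); split => //.
  by rewrite DE; apply: measurable_funM.
rewrite /ibp DE RintegralZl//; last first.
  by apply: (ibounded mP) => y; exact: sin_norm_le1.
have -> : \int[mu]_y sin (P y) = sin A * expR (- spectral_exponent (b *: xi)).
  rewrite (_ : \int[mu]_y sin (P y) =
    \int[mu]_y (cos A * sin (dotp y (b *: xi)) + sin A * cos (dotp y (b *: xi)))); last first.
    by apply: eq_Rintegral => y _; rewrite /P sinD; ring.
  rewrite RintegralD//; last 2 first.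
  - apply: (@integrableZl _ _ _ mu _ _ _ (fun y => (sin (dotp y (b *: xi)))%:E)) => //.
    by apply: (ibounded (ms0 _)) => y; exact: sin_norm_le1.
  - apply: (@integrableZl _ _ _ mu _ _ _ (fun y => (cos (dotp y (b *: xi)))%:E)) => //.
    by apply: (ibounded (mc0 _)) => y; exact: cos_norm_le1.
  rewrite !RintegralZl//; last 2 first.
  - by apply: (ibounded (mc0 _)) => y; exact: cos_norm_le1.
  - by apply: (ibounded (ms0 _)) => y; exact: sin_norm_le1.
  by rewrite law_sin law_cos mulr0 add0r.
have -> : \int[mu]_y (y ord0 j * cos (dotp (b *: y) xi + A)) =
    - sin A * (expR (- spectral_exponent (b *: xi)) * levy_sine_moment j (b *: xi)).
  rewrite (_ : \int[mu]_y _ = \int[mu]_y (cos A * (y ord0 j * cos (dotp y (b *: xi))) +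
      - sin A * (y ord0 j * sin (dotp y (b *: xi))))); last first.
    by apply: eq_Rintegral => y _; rewrite dotpZl -dotpZr cosD; ring.
  have i1 := ijg _ (mc0 (b *: xi)) (fun x => cos_norm_le1 _).
  have i2 := ijg _ (ms0 (b *: xi)) (fun x => sin_norm_le1 _).
  rewrite Rintegral_lin//; last exact: integrableZl i2.
  by rewrite law_coord_cos mulr0 add0r RintegralZl// law_coord_sin.
have -> : c *: xi = (c / b) *: (b *: xi) by rewrite scalerA divfK ?gt_eqF.
by rewrite (levy_sine_momentZ j (b *: xi) (divr_gt0 c0 b0)); ring.
Qed.

(** The Stein identity of the stable law: the nonlocal gradient is traded for multiplication by y_j.
    It extends from cosines by trigonometric induction; the limits are dominated by a multiple of
    [levy_weight] under nu, and by a constant and M |y_j| under mu. *)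
Lemma levy_gradient_ibp M L f : bounded_lipschitz M L f ->
  \int[mu]_y levy_gradient f y =
  (c / b) `^ (alpha - 1) * \int[mu]_y (y ord0 j * f (b *: y)).
Proof.
suff : bounded_lipschitz M L f -> V f by move=> h fML; have [? [? []]] := h fML.
apply: trigonometric_induction => {M L f}; [exact: V_lin|exact: V_cos|].
move=> M L f_ f Vf bf cf.
have fML : bounded_lipschitz M L f.
  split => [x|x y].
    by apply: (cvgr_to_le (cvg_norm (cf x))); apply: nearW => n; exact: (bf n).1.
  by apply: (cvgr_to_le (cvg_norm (cvgB (cf x) (cf y)))); apply: nearW => n; exact: (bf n).2.
have iw := levy_integrable a1 hnu.
have cg y : levy_gradient (f_ n) y @[n --> \oo] --> levy_gradient f y.
  apply: (@Rintegral_dominated_cvg _ _ _ nu _ _ (fun u => (`|M| + `|L| * c) * levy_weight u) _ _ _ _).2.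
  - by move=> n; exact: gmeas (bf n).
  - move=> u; apply: cvgM; last exact: cvg_cst.
    apply: cvgM; first exact: cvg_cst.
    by apply: cvgB; exact: cf.
  - exact: integrableZl iw.
  - by move=> n u; exact: gbound (bf n).
have mg_ n : measurable_fun setT (levy_gradient (f_ n)) by case: (Vf n) => ? [? []].
have mg : measurable_fun setT (levy_gradient f).
  by apply: (measurable_fun_cvg mg_) => y _; exact: cg.
exists M, L; split => //.
have icst : mu.-integrable setT (EFin \o (fun=> (`|M| + `|L| * c) * W)).
  exact: finite_measure_integrable_cst.
have [_ c1] := Rintegral_dominated_cvg mg_ cg icst (fun n y => levy_gradient_bound y (bf n)).
have iM : mu.-integrable setT (EFin \o (fun y : 'rV[R]_d => M * `|y ord0 j|)).
  exact: integrableZl (integrable_norm (law_coord_integrable j)).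
have mr n : measurable_fun setT (fun y : 'rV[R]_d => y ord0 j * f_ n (b *: y)).
  exact: integrable_measurable (right_integrable (bf n)).
have cr (y : 'rV[R]_d) : y ord0 j * f_ n (b *: y) @[n --> \oo] --> y ord0 j * f (b *: y).
  by apply: cvgM; [exact: cvg_cst|exact: cf].
have br n (y : 'rV[R]_d) : `|y ord0 j * f_ n (b *: y)| <= M * `|y ord0 j|.
  by rewrite normrM mulrC ler_wpM2r//; exact: (bf n).1.
have [_ c2] := Rintegral_dominated_cvg mr cr iM br.
have c3 : (c / b) `^ (alpha - 1) * \int[mu]_y (y ord0 j * f_ n (b *: y)) @[n --> \oo] -->
    (c / b) `^ (alpha - 1) * \int[mu]_y (y ord0 j * f (b *: y)).
  by apply: cvgM; [exact: cvg_cst|exact: c2].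
rewrite (_ : (fun n => \int[mu]_y levy_gradient (f_ n) y) =
  (fun n => (c / b) `^ (alpha - 1) * \int[mu]_y (y ord0 j * f_ n (b *: y)))) in c1; last first.
  by apply/funext => n; case: (Vf n) => ? [? []].
exact: (cvg_unique _ c1 c3).
Qed.

End integration_by_parts.

End stable_law_identities.

(** * Sigma-finite products and Fubini for real integrals *)

Section sigma_finite_structure.
Context d (T : measurableType d) (R : realType) (m : {measure set T -> \bar R}).

(** An alias of m indexed by a proof of sigma-finiteness, to which the corresponding structure can
    be attached. *)
Definition sigma_finite_copy (sf : sigma_finite setT m) : set T -> \bar R := m.

Variable sf : sigma_finite setT m.
HB.instance Definition _ := Measure.copy (sigma_finite_copy sf) m.
HB.instance Definition _ := @Measure_isSigmaFinite.Build _ _ _ (sigma_finite_copy sf) sf.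

End sigma_finite_structure.

Section product_sigma_finite.
Context d1 d2 (T1 : measurableType d1) (T2 : measurableType d2) (R : realType).
Variables (m1 : {sigma_finite_measure set T1 -> \bar R})
  (m2 : {sigma_finite_measure set T2 -> \bar R}).

Lemma sigma_finite_product : sigma_finite setT (m1 \x m2)%E.
Proof.
have /sigma_finiteP[F [FT Fnd Ffin]] := sigma_finiteT m1.
have /sigma_finiteP[G [GT Gnd Gfin]] := sigma_finiteT m2.
exists (fun n => F n `*` G n).
  apply/seteqP; split => // -[x y] _.
  have [i _ Fi] : (\bigcup_i F i) x by rewrite -FT.
  have [k _ Gk] : (\bigcup_i G i) y by rewrite -GT.
  exists (maxn i k) => //; split => /=.
    by have /subsetPset := Fnd _ _ (leq_maxl i k); apply.
  by have /subsetPset := Gnd _ _ (leq_maxr i k); apply.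
move=> k; have [mF Fo] := Ffin k; have [mG Go] := Gfin k.
split; first exact: measurableX.
by rewrite product_measure1E// lte_mul_pinfty// ge0_fin_numE.
Qed.


(** The product bundled with its sigma-finiteness, so that products can be iterated over time, law
    and Levy measure. *)
Definition product_measure_sf : {sigma_finite_measure set (T1 * T2)%type -> \bar R} :=
  sigma_finite_copy sigma_finite_product.
Local Notation M := product_measure_sf.

Lemma ge0_fubini1 (F : T1 * T2 -> \bar R) : measurable_fun setT F ->
  (forall z, 0 <= F z)%E -> (\int[M]_z F z = \int[m1]_x \int[m2]_y F (x, y))%E.
Proof. by move=> mF F0; exact: (fubini_tonelli1 F mF F0). Qed.

Lemma Rintegral_fubini1 (F : T1 * T2 -> R) : M.-integrable setT (EFin \o F) ->
  (forall x, m2.-integrable setT (EFin \o (fun y => F (x, y)))) ->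
  \int[m1]_x \int[m2]_y F (x, y) = \int[M]_z F z.
Proof.
move=> iF i2; transitivity (fine (\int[(m1 \x m2)%E]_z (F z)%:E)%E) => //.
rewrite -integral12_prod_meas1//; congr fine; apply: eq_integral => x _.
rewrite /fubini_F /Rintegral fineK//.
by apply: integrable_fin_num => //; exact: i2.
Qed.

Lemma Rintegral_fubini2 (F : T1 * T2 -> R) : M.-integrable setT (EFin \o F) ->
  (forall y, m1.-integrable setT (EFin \o (fun x => F (x, y)))) ->
  \int[m2]_y \int[m1]_x F (x, y) = \int[M]_z F z.
Proof.
move=> iF i2; transitivity (fine (\int[(m1 \x m2)%E]_z (F z)%:E)%E) => //.
rewrite -integral21_prod_meas1//; congr fine; apply: eq_integral => x _.
rewrite /fubini_G /Rintegral fineK//.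
by apply: integrable_fin_num => //; exact: i2.
Qed.

Lemma integrable_Rintegral1 (F : T1 * T2 -> R) : M.-integrable setT (EFin \o F) ->
  (forall x, m2.-integrable setT (EFin \o (fun y => F (x, y)))) ->
  m1.-integrable setT (EFin \o (fun x => \int[m2]_y F (x, y))).
Proof.
move=> iF i2; have := @integrable_fubini_F _ _ _ _ _ m1 m2 _ iF.
apply: eq_integrable => // x _; rewrite /fubini_F /= /Rintegral fineK//.
by apply: integrable_fin_num => //; exact: i2.
Qed.

Lemma integrable_tensor (f : T1 -> R) (g : T2 -> R) :
  m1.-integrable setT (EFin \o f) -> m2.-integrable setT (EFin \o g) ->
  M.-integrable setT (EFin \o (fun z => f z.1 * g z.2)).
Proof.
move=> fi gi; have mf := integrable_measurable fi; have mg := integrable_measurable gi.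
apply/(integrable12ltyP m1 m2) => /=.
  apply/measurable_EFinP; apply: measurable_funM.
    by apply: (measurableT_comp mf).
  by apply: (measurableT_comp mg).
under eq_integral => x _.
  under eq_integral do rewrite normrM EFinM.
  rewrite ge0_integralZl//; last by do 2 apply: measurableT_comp => //.
  over.
move/integrableP : fi => [_ fi]; move/integrableP : gi => [_ gi].
rewrite ge0_integralZr//.
- by rewrite lte_mul_pinfty// ?integral_ge0// ge0_fin_numE// integral_ge0.
- by do 2 apply: measurableT_comp => //.
- exact: integral_ge0.
Qed.

End product_sigma_finite.

(** * Invariance of mu under the Ornstein-Uhlenbeck semigroup *)

Section self_decomposition.
Context {R : realType} {d : nat} (nu : {measure set 'rV[R]_d -> \bar R})
  (sigma lambda1 : {finite_measure set 'rV[R]_d -> \bar R})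
  (mu : probability 'rV[R]_d R) (alpha : R).
Hypotheses (a1 : 1 < alpha) (a2 : alpha < 2).
Hypotheses (hnu : stable_levy_measure alpha nu) (hlaw : stable_law nu mu)
  (hspec : spectral_measure alpha sigma mu lambda1).
Implicit Types xi : 'rV[R]_d.

Definition OU_point (t : R) (x y : 'rV[R]_d) : 'rV[R]_d :=
  expR (- t) *: x + (1 - expR (- (alpha * t))) `^ alpha^-1 *: y.

Let measurable_cosd xi c : measurable_fun setT (fun x : 'rV[R]_d => cos (dotp x xi + c)).
Proof. exact: bounded_lipschitz_measurable (bounded_lipschitz_cos xi c). Qed.

Let ibounded dT (T : measurableType dT) (P : probability T R) (f : T -> R) :
  measurable_fun setT f -> (forall x, `|f x| <= 1) -> P.-integrable setT (EFin \o f).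
Proof.
by move=> mf fM; apply: (integrable_bounded _ mf fM); rewrite -ge0_fin_numE// fin_num_measure.
Qed.

Lemma law_cos_shift xi c : \int[mu]_x cos (dotp x xi + c) =
  cos c * expR (- spectral_exponent lambda1 alpha xi).
Proof.
have ic : mu.-integrable setT (EFin \o (fun x => cos (dotp x xi))).
  apply: ibounded => [|x]; last exact: cos_norm_le1.
  by have := measurable_cosd xi 0; under eq_fun do rewrite addr0.
have is_ : mu.-integrable setT (EFin \o (fun x => sin (dotp x xi))).
  apply: ibounded => [|x]; last exact: sin_norm_le1.
  by have := measurable_cosd xi (- (pi / 2)); under eq_fun do rewrite cosBpihalf.
rewrite (_ : \int[mu]_x _ = \int[mu]_x (cos c * cos (dotp x xi) +
    - sin c * sin (dotp x xi))); last first.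
  by apply: eq_Rintegral => x _; rewrite cosD; ring.
rewrite Rintegral_lin//; last exact: integrableZl is_.
by rewrite (law_cos hspec) RintegralZl// (law_sin hspec) mulr0 addr0.
Qed.

Lemma measurable_OU_point dT (T : measurableType dT) (t : T -> R) (x y : T -> 'rV[R]_d) :
  measurable_fun setT t -> measurable_fun setT x -> measurable_fun setT y ->
  measurable_fun setT (fun w => OU_point (t w) (x w) (y w)).
Proof.
move=> mt mx my; apply: measurable_rowD; apply: measurable_rowZ => //.
  by apply: measurableT_comp => //; apply: measurableT_comp.
apply: (measurableT_comp (measurable_powR alpha^-1)).
apply: measurable_funB => //; apply: measurableT_comp => //; apply: measurableT_comp => //.
exact: measurable_funM.
Qed.

(** By alpha-homogeneity the exponents add up: e^(-alpha t) psi + (1 - e^(-alpha t)) psi = psi. *)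
Let OU_cos t xi c : 0 <= t -> \int[mu]_x \int[mu]_y cos (dotp (OU_point t x y) xi + c) =
  \int[mu]_x cos (dotp x xi + c).
Proof.
move=> t0; set e := expR (- t); set b := (1 - expR (- (alpha * t))) `^ alpha^-1.
have al0 : 0 < alpha by exact: lt_trans a1.
have Lam0 := spectral_exponent_ge0 lambda1 alpha xi.
transitivity (\int[mu]_x (expR (- spectral_exponent lambda1 alpha (b *: xi)) *
    cos (dotp x (e *: xi) + c))).
  apply: eq_Rintegral => x _; rewrite mulrC -law_cos_shift.
  apply: eq_Rintegral => y _; congr cos.
  by rewrite /OU_point dotpDl !dotpZl !dotpZr [RHS]addrC addrAC.
rewrite RintegralZl//; last by apply: ibounded => // x; exact: cos_norm_le1.
rewrite !law_cos_shift !(spectral_exponentZ lambda1 a1) ?expR_ge0 ?powR_ge0//.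
rewrite mulrCA; congr (_ * _); rewrite -expRD; congr expR.
have -> : e `^ alpha = expR (- (alpha * t)) by rewrite /e -expRM mulNr mulrC.
have -> : b `^ alpha = 1 - expR (- (alpha * t)).
  rewrite /b -powRrM mulVf ?gt_eqF// powRr1// subr_ge0 -expR0 ler_expR oppr_le0.
  by rewrite mulr_ge0// ltW.
by ring.
Qed.

(** The image of mu x mu under [OU_point] has the same cosine integrals as mu, so the two measures
    agree by Fourier uniqueness. *)
Lemma OU_invariant (t : R) (g : 'rV[R]_d -> \bar R) : 0 <= t ->
  measurable_fun setT g -> (forall x, 0 <= g x)%E ->
  (\int[mu]_x \int[mu]_y g (OU_point t x y) = \int[mu]_x g x)%E.
Proof.
move=> t0 mg g0.
pose phi (z : 'rV[R]_d * 'rV[R]_d) := OU_point t z.1 z.2.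
have mphi : measurable_fun setT phi by apply: measurable_OU_point.
pose pf : {measure set 'rV[R]_d -> \bar R} :=
  measure_function_pushforward__canonical__measure_function_Measure (product_measure_sf mu mu) mphi.
have pfE (h : 'rV[R]_d -> \bar R) : measurable_fun setT h -> (forall x, 0 <= h x)%E ->
    (\int[pf]_x h x = \int[mu]_x \int[mu]_y h (OU_point t x y))%E.
  move=> mh h0; rewrite /pf ge0_integral_pushforward//.
  rewrite preimage_setT ge0_fubini1//; first exact: measurableT_comp.
  by move=> z; exact: h0.
have mu1 : (mu setT < +oo)%E by rewrite -ge0_fin_numE// fin_num_measure.
have mumu1 : ((product_measure_sf mu mu) setT < +oo)%E.
  have -> : product_measure_sf mu mu setT = (mu \x mu)%E (setT `*` setT) by rewrite setXTT.
  rewrite product_measure1E//.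
  by rewrite lte_mul_pinfty// fin_num_measure.
have pf1 : (pf setT < +oo)%E.
  by rewrite (_ : pf setT = (product_measure_sf mu mu) setT)// /pf/= /pushforward preimage_setT.
rewrite -pfE//; apply: eq_measure_integral => A mA _.
apply: (fourier_unique pf1 mu1) => // xi c.
rewrite -(OU_cos xi c t0).
have mc := measurable_cosd xi c.
have mcphi : measurable_fun setT (fun z => cos (dotp (phi z) xi + c)) by exact: measurableT_comp mc mphi.
have ic : (product_measure_sf mu mu).-integrable setT (EFin \o (fun z => cos (dotp (phi z) xi + c))).
  by apply: (integrable_bounded mumu1 mcphi) => z; exact: cos_norm_le1.
rewrite /Rintegral integral_pushforward//; last exact/measurable_EFinP.
rewrite preimage_setT; apply: esym; apply: (Rintegral_fubini1 ic) => x.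
apply: ibounded => [|y]; last exact: cos_norm_le1.
by apply: (measurableT_comp mc); rewrite /phi/=; exact: measurable_OU_point.
Qed.

End self_decomposition.

(** * Integrability of the Bessel weight and of K *)

Section riesz_kernel.
Context {R : realType}.
Local Notation leb := (@lebesgue_measure R).
Local Notation pos := (`]0%R, +oo[%classic : set R).

Lemma integrable_expN_powR (f : R -> R) (C a : R) : 0 < a -> measurable_fun pos f ->
  (forall t, 0 < t -> `|f t| <= C * (expR (- t) * t `^ (a - 1))) ->
  leb.-integrable pos (EFin \o f).
Proof.
move=> a0 mf fC.
(* For t >= 1, t^(a-1) = t^(a+1) t^(-2), and t^(a+1) <= (1 + t)^n <= K e^t for an integer n >= a +
   1, which leaves the decay t^(-2). *)
have [K K0 eK] := expR_dominates (Num.bound (a + 1)) (@ltr01 R).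
have fC' t : 0 < t -> `|f t| <= `|C| * (expR (- t) * t `^ (a - 1)).
  move=> t0; rewrite (le_trans (fC t t0))// ler_wpM2r ?ler_norm//.
  by rewrite mulr_ge0 ?expR_ge0 ?powR_ge0.
apply: (@integrable_pos_powR _ f (`|C| * Num.max 1 K) a 1) => // t.
  move=> /andP[t0 t1]; rewrite (le_trans (fC' t t0))// -mulrA ler_wpM2l//.
  rewrite ler_wpM2r ?powR_ge0// le_max -[X in _ <= X]expR0 ler_expR oppr_le0.
  by rewrite (ltW t0).
move=> t1; have t0 : 0 < t by exact: lt_le_trans t1.
rewrite (le_trans (fC' t t0))// -mulrA ler_wpM2l//.
apply: (@le_trans _ _ (K * t `^ (- 1 - 1))); last first.
  by rewrite ler_wpM2r ?powR_ge0// le_max lexx orbT.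
have -> : t `^ (a - 1) = t `^ (a + 1) * t `^ (- 1 - 1).
  by rewrite -powRD ?(gt_eqF t0) ?implybT//; congr powR; lra.
rewrite mulrA ler_wpM2r ?powR_ge0// expRN mulrC ler_pdivrMr ?expR_gt0//.
rewrite -[in leRHS](mul1r t); apply: le_trans (eK t (ltW t0)).
apply: (@le_trans _ _ (t ^+ Num.bound (a + 1))).
  rewrite -powR_mulrn ?(ltW t0)// ler_powR//.
  by rewrite ltW// (archi_boundP _)// addr_ge0// ltW.
by rewrite lerXn2r ?nnegrE ?addr_ge0 ?(ltW t0)// lerDr.
Qed.

Lemma Gamma_ge0 (s : R) : 0 <= Gamma s.
Proof. by apply: Rintegral_ge0 => t _; rewrite mulr_ge0 ?powR_ge0 ?expR_ge0. Qed.

Section kernel.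
Variables (alpha r : R).
Hypotheses (a1 : 1 < alpha) (hr : r_min alpha < r).

Let al0 : 0 < alpha. Proof. exact: lt_trans a1. Qed.

Let b_gt0 (t : R) : 0 < t -> 0 < 1 - expR (- (alpha * t)).
Proof. by move=> t0; rewrite subr_gt0 expR_lt1 oppr_lt0 mulr_gt0. Qed.

Lemma K_kernel_ge0 (t : R) : 0 <= K_kernel alpha r t.
Proof.
apply: mulr_ge0; first by rewrite invr_ge0 mulr_ge0 ?Gamma_ge0.
by rewrite divr_ge0 ?expR_ge0// mulr_ge0 ?powR_ge0.
Qed.

Lemma r_gt0 : 0 < r.
Proof.
apply: le_lt_trans hr; rewrite /r_min divr_ge0 ?mulr_ge0 ?(ltW al0)//.
by rewrite subr_ge0 ltW.
Qed.

Definition riesz_weight (t : R) : R := expR (- t) / t `^ (1 - r / 2).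

Lemma riesz_weight_ge0 t : 0 <= riesz_weight t.
Proof. by rewrite divr_ge0 ?expR_ge0 ?powR_ge0. Qed.

Let measurable_expN (c : R) : measurable_fun setT (fun t : R => expR (- (c * t))).
Proof.
apply: measurableT_comp => //; exact: measurableT_comp.
Qed.

Let measurable_invpowR (f : R -> R) (c : R) : measurable_fun setT f ->
  (forall t, pos t -> 0 < f t) -> measurable_fun pos (fun t => (f t `^ c)^-1).
Proof.
move=> mf f0; apply: (eq_measurable_fun (fun t => f t `^ (- c))).
  by move=> t; rewrite inE => tp; rewrite powRN.
apply: measurable_funTS; exact: (measurableT_comp (measurable_powR _)).
Qed.

Lemma measurable_riesz_weight : measurable_fun pos riesz_weight.
Proof.
apply: measurable_funM.
  by have := measurable_expN 1; under eq_fun do rewrite mul1r; apply: measurable_funTS.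
by apply: measurable_invpowR => // t /=; rewrite in_itv/= andbT.
Qed.

Lemma integrable_riesz_weight : leb.-integrable pos (EFin \o riesz_weight).
Proof.
apply: (@integrable_expN_powR _ 1 (r / 2)).
- by rewrite divr_gt0// r_gt0.
- exact: measurable_riesz_weight.
- move=> t t0; rewrite ger0_norm ?riesz_weight_ge0// mul1r /riesz_weight.
  by rewrite -powRN opprB.
Qed.

Lemma measurable_K_kernel : measurable_fun pos (K_kernel alpha r).
Proof.
apply: measurable_funM => //; apply: measurable_funM.
  exact: measurable_funTS.
apply: (eq_measurable_fun (fun t : R => (t `^ (1 - r / 2))^-1 *
    ((1 - expR (- (alpha * t))) `^ (1 - alpha^-1))^-1)).
  by move=> t _; rewrite [in RHS]invfM.
apply: measurable_funM; apply: measurable_invpowR => //.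
- by move=> t /=; rewrite in_itv/= andbT.
- by apply: measurable_funB.
- by move=> t /=; rewrite in_itv/= andbT; exact: b_gt0.
Qed.

(* [1 - exp(-x) >= x exp(-x)] shows that the singularity of [K] at [0] is
   [t^(r/2 - 1 - (1 - 1/alpha))], integrable because [r_min alpha < r]. *)
Lemma integrable_K_kernel : leb.-integrable pos (EFin \o K_kernel alpha r).
Proof.
set th := 1 - alpha^-1.
have th0 : 0 <= th by rewrite subr_ge0 invf_le1// ltW.
have ath : alpha * th = alpha - 1 by rewrite mulrBr mulr1 divff ?gt_eqF.
apply: (@integrable_expN_powR _ ((2 * Gamma (r / 2))^-1 * alpha `^ (- th)) (r / 2 - th)).
- rewrite subr_gt0; have : alpha * (2 * th) < alpha * r.
    by rewrite mulrCA ath; move: hr; rewrite /r_min ltr_pdivrMr// [r * _]mulrC.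
  by rewrite ltr_pM2l// mulrC -ltr_pdivlMr.
- exact: measurable_K_kernel.
move=> t t0; rewrite ger0_norm ?K_kernel_ge0// /K_kernel -mulrA.
rewrite ler_wpM2l ?invr_ge0 ?mulr_ge0 ?Gamma_ge0//.
set E := expR (- (alpha * t)).
have E0 : 0 < E by exact: expR_gt0.
have at0 : 0 < alpha * t by exact: mulr_gt0.
have lb : alpha * t * E <= 1 - E.
  have := expR_ge1Dx (alpha * t); rewrite -(ler_pM2r E0).
  by rewrite /E -expRD subrr expR0 mulrDl mul1r => h; rewrite lerBrDl.
have E_th : E `^ th = expR (- (alpha - 1) * t).
  by rewrite /E -expRM -ath; congr expR; ring.
have -> : t `^ (r / 2 - th - 1) = (t `^ (1 - r / 2))^-1 * t `^ (- th).
  by rewrite -powRN -powRD ?(gt_eqF t0) ?implybT//; congr powR; ring.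
rewrite -/th invfM.
have -> : alpha `^ (- th) * (expR (- t) * ((t `^ (1 - r / 2))^-1 * t `^ (- th))) =
  (t `^ (1 - r / 2))^-1 * (E * (alpha * t * E) `^ (- th)).
  rewrite !powRM ?mulr_ge0 ?(ltW al0) ?(ltW t0) ?(ltW E0)//.
  rewrite [E `^ _]powRN E_th -(expRN (- (alpha - 1) * t)).
  have -> : expR (- t) = E * expR (- (- (alpha - 1) * t)) by rewrite /E -expRD; congr expR; ring.
  by ring.
rewrite mulrCA ler_wpM2l ?invr_ge0 ?powR_ge0// ler_wpM2l ?(ltW E0)//.
rewrite powRN lef_pV2 ?posrE ?powR_gt0 ?b_gt0 ?mulr_gt0//.
by rewrite ge0_ler_powR ?nnegrE ?mulr_ge0 ?(ltW E0) ?(ltW at0)// ltW// b_gt0.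
Qed.

End kernel.
End riesz_kernel.

Section measurable_integral.
Context d1 d2 (T1 : measurableType d1) (T2 : measurableType d2) (R : realType)
  (m2 : {sigma_finite_measure set T2 -> \bar R}).

Lemma measurable_fun_Rintegral (F : T1 * T2 -> R) : measurable_fun setT F ->
  measurable_fun setT (fun x => \int[m2]_y F (x, y)).
Proof.
move=> mF; have mE : measurable_fun setT (EFin \o F) by exact/measurable_EFinP.
apply: (measurableT_comp (fine_measurable measurableT)).
have h := emeasurable_funB
  (measurable_fun_fubini_tonelli_F (m2 := m2) _ (measurable_funepos mE) (funepos_ge0 _))
  (measurable_fun_fubini_tonelli_F (m2 := m2) _ (measurable_funeneg mE) (funeneg_ge0 _)).
apply: (eq_measurable_fun _ _ h) => x _; rewrite [RHS]integralE.
by congr (_ - _)%E; apply: eq_integral => y _; rewrite ?funeposE ?funenegE.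
Qed.

End measurable_integral.

Lemma Rintegral_sum dT (T : measurableType dT) (R : realType) (m : {measure set T -> \bar R})
    (I : Type) (s : seq I) (c : I -> R) (F : I -> T -> R) :
  (forall i, m.-integrable setT (EFin \o F i)) ->
  m.-integrable setT (EFin \o (fun x => \sum_(i <- s) c i * F i x)) /\
  \int[m]_x (\sum_(i <- s) c i * F i x) = \sum_(i <- s) c i * \int[m]_x F i x.
Proof.
move=> iF; elim: s => [|i s [IHi IHe]].
  under eq_fun do rewrite big_nil.
  by split; [exact: integrable0|rewrite /Rintegral integral0 big_nil].
under eq_fun do rewrite big_cons.
by split; [exact: integrable_lin|rewrite Rintegral_lin// IHe big_cons].
Qed.

Lemma sqr_enorm (R : realType) d (x : 'rV[R]_d) : enorm x ^+ 2 = dotp x x.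
Proof. by rewrite sqr_sqrtr// dotp_ge0. Qed.

Lemma enorm_delta (R : realType) d (j : 'I_d) : enorm (delta_mx ord0 j : 'rV[R]_d) = 1.
Proof. by rewrite /enorm dotp_delta mxE !eqxx sqrtr1. Qed.

(** * L^p bound for transforms given by a time kernel *)

Section kernel_transform.
Context {R : realType} {d : nat}
  (sigma lambda1 : {finite_measure set 'rV[R]_d -> \bar R})
  (mu : probability 'rV[R]_d R) (alpha : R).
Hypotheses (a1 : 1 < alpha) (hspec : spectral_measure alpha sigma mu lambda1).
Local Notation RT := (measurableTypeR R).
Variables (leb : {sigma_finite_measure set RT -> \bar R}) (k : R -> R).
Local Notation M := (product_measure_sf leb mu).
Hypotheses (k0 : forall t, 0 <= k t) (kpos : forall t, t < 0 -> k t = 0)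
  (ki : leb.-integrable setT (EFin \o k)).

Implicit Types f : 'rV[R]_d -> R.

Let mk : measurable_fun setT k := integrable_measurable ki.

Definition kernel_transform (f : 'rV[R]_d -> R) (x : 'rV[R]_d) : 'rV[R]_d :=
  \row_j \int[M]_z (k z.1 * (z.2 ord0 j * f (OU_point alpha z.1 x z.2))).

Let mOU (f : 'rV[R]_d -> R) dT (T : measurableType dT) (t : T -> R) (x y : T -> 'rV[R]_d) :
  measurable_fun setT f -> measurable_fun setT t -> measurable_fun setT x ->
  measurable_fun setT y -> measurable_fun setT (fun w => f (OU_point alpha (t w) (x w) (y w))).
Proof.
by move=> mf mt mx my; apply: (measurableT_comp mf); exact: measurable_OU_point.
Qed.

Lemma measurable_kernel_transform f : measurable_fun setT f ->
  measurable_fun setT (kernel_transform f).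
Proof.
move=> mf; apply: measurable_row => j; under eq_fun do rewrite /kernel_transform mxE.
apply: (@measurable_fun_Rintegral _ _ _ _ _ M
  (fun w => k w.2.1 * (w.2.2 ord0 j * f (OU_point alpha w.2.1 w.1 w.2.2)))).
have m22 : measurable_fun setT (fun w : 'rV[R]_d * (RT * 'rV[R]_d) => w.2.2).
  by apply: measurableT_comp.
have m21 : measurable_fun setT (fun w : 'rV[R]_d * (RT * 'rV[R]_d) => w.2.1).
  by apply: measurableT_comp.
apply: measurable_funM; first exact: (measurableT_comp mk).
apply: measurable_funM; first exact: (measurableT_comp (measurable_coord j)).
exact: mOU.
Qed.

Section bound.
Variables (p q g : R).
Hypotheses (p1 : 1 < p) (pq : p^-1 + q^-1 = 1) (q0 : 0 < q) (g0 : 0 <= g).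
Hypothesis hg : forall z : 'rV[R]_d, enorm z = 1 ->
  (\int[mu]_y (`|dotp y z| `^ q)%:E <= (g `^ q)%:E)%E.

Let p0 : 0 < p. Proof. exact: lt_trans p1. Qed.

Let l := \int[leb]_t k t.
Let lE : (\int[leb]_t (k t)%:E = l%:E)%E.
Proof. by rewrite /l /Rintegral fineK// (integrable_fin_num _ ki). Qed.
Let l0 : 0 <= l. Proof. exact: Rintegral_ge0. Qed.

(** The p-th power of the factor of Hoelder's inequality which contains f. *)
Definition kernel_energy (f : 'rV[R]_d -> R) (x : 'rV[R]_d) : \bar R :=
  (\int[M]_z (k z.1 * `|f (OU_point alpha z.1 x z.2)| `^ p)%:E)%E.

Let menergy f : measurable_fun setT f ->
  measurable_fun setT (fun w : 'rV[R]_d * (RT * 'rV[R]_d) =>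
    (k w.2.1 * `|f (OU_point alpha w.2.1 w.1 w.2.2)| `^ p)%:E).
Proof.
move=> mf; apply/measurable_EFinP.
have m22 : measurable_fun setT (fun w : 'rV[R]_d * (RT * 'rV[R]_d) => w.2.2).
  by apply: measurableT_comp.
have m21 : measurable_fun setT (fun w : 'rV[R]_d * (RT * 'rV[R]_d) => w.2.1).
  by apply: measurableT_comp.
apply: measurable_funM; first exact: (measurableT_comp mk).
apply: (measurableT_comp (measurable_powR p)); apply: measurableT_comp => //.
exact: mOU.
Qed.

Let energy0 (f : 'rV[R]_d -> R) t x y : (0 <= (k t * `|f (OU_point alpha t x y)| `^ p)%:E)%E.
Proof. by rewrite lee_fin mulr_ge0 ?powR_ge0. Qed.

Lemma kernel_energy_ge0 f x : (0 <= kernel_energy f x)%E.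
Proof. by apply: integral_ge0 => z _; exact: energy0. Qed.

Lemma measurable_kernel_energy f : measurable_fun setT f ->
  measurable_fun setT (kernel_energy f).
Proof.
move=> mf; apply: (@measurable_fun_fubini_tonelli_F _ _ _ _ _ M _ (menergy mf)).
by move=> w; exact: energy0.
Qed.

(** Tonelli brings the time integral outside; at each fixed time, invariance of mu removes the
    semigroup. *)
Lemma integral_kernel_energy f : measurable_fun setT f ->
  (\int[mu]_x kernel_energy f x = l%:E * \int[mu]_x (`|f x| `^ p)%:E)%E.
Proof.
move=> mf; have mfp := @measurable_norm_powR _ _ _ p _ mf.
have m3 : measurable_fun setT (fun w : ('rV[R]_d * RT) * 'rV[R]_d =>
    (k w.1.2 * `|f (OU_point alpha w.1.2 w.1.1 w.2)| `^ p)%:E).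
  have mphi : measurable_fun setT (fun w : ('rV[R]_d * RT) * 'rV[R]_d => (w.1.1, (w.1.2, w.2))).
    by apply: measurable_fun_pair; [exact: measurableT_comp|apply: measurable_fun_pair => //; exact: measurableT_comp].
  exact: (measurableT_comp (menergy mf) mphi).
have m2 x : measurable_fun setT (fun w : RT * 'rV[R]_d =>
    (k w.1 * `|f (OU_point alpha w.1 x w.2)| `^ p)%:E).
  have mphi : measurable_fun setT (fun w : RT * 'rV[R]_d => (x, w)) by exact: measurable_fun_pair.
  exact: (measurableT_comp (menergy mf) mphi).
transitivity (\int[mu]_x \int[leb]_t \int[mu]_y
    (k t * `|f (OU_point alpha t x y)| `^ p)%:E)%E.
  apply: eq_integral => x _; rewrite /kernel_energy ge0_fubini1//; exact: m2.
rewrite (@fubini_tonelli _ _ _ _ _ mu leb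
  (fun w => \int[mu]_y (k w.2 * `|f (OU_point alpha w.2 w.1 y)| `^ p)%:E)%E); last 2 first.
- apply: (measurable_fun_fubini_tonelli_F (m2 := mu) _ m3) => w; exact: energy0.
- by move=> w; apply: integral_ge0 => y _; exact: energy0.
transitivity (\int[leb]_t ((k t)%:E * \int[mu]_x (`|f x| `^ p)%:E))%E.
  (* Invariance is available for t >= 0 only; at negative times the kernel vanishes. *)
  apply: eq_integral => t _; have [t0|t0] := ltP t 0.
    rewrite kpos// mul0e; apply: integral0_eq => x _; apply: integral0_eq => y _.
    by rewrite mul0r.
  rewrite -(OU_invariant a1 hspec t0 mfp); last by move=> x; rewrite lee_fin powR_ge0.
  have mt : measurable_fun setT (fun w : 'rV[R]_d * 'rV[R]_d => (`|f (OU_point alpha t w.1 w.2)| `^ p)%:E).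
    by apply: measurable_norm_powR; apply: mOU.
  rewrite -ge0_integralZl ?lee_fin//; last 2 first.
  - have pos (w : 'rV[R]_d * 'rV[R]_d) : (0 <= (`|f (OU_point alpha t w.1 w.2)| `^ p)%:E)%E.
      by rewrite lee_fin powR_ge0.
    exact: (measurable_fun_fubini_tonelli_F (m2 := mu) _ mt pos).
  - by move=> x _; apply: integral_ge0 => y _; rewrite lee_fin powR_ge0.
  apply: eq_integral => x _; rewrite -ge0_integralZl ?lee_fin//.
  by apply: measurable_norm_powR; apply: mOU.
rewrite ge0_integralZr//; last by apply: integral_ge0 => x _; rewrite lee_fin powR_ge0.
- by rewrite lE.
- exact/measurable_EFinP.
- by move=> t _; rewrite lee_fin.
Qed.

Let kpq t : k t `^ q^-1 * k t `^ p^-1 = k t.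
Proof.
have [->|kt] := eqVneq (k t) 0; first by rewrite powR0 ?mul0r ?invr_eq0 ?gt_eqF.
by rewrite -powRD ?kt ?implybT// [q^-1 + _]addrC pq powRr1.
Qed.

Let powRVK (e a b : R) : 0 < e -> 0 <= a -> 0 <= b -> `|a `^ e^-1 * b| `^ e = a * b `^ e.
Proof.
move=> e0 a0 b0; rewrite ger0_norm ?mulr_ge0 ?powR_ge0// powRM ?powR_ge0//.
by rewrite -powRrM mulVf ?gt_eqF// powRr1.
Qed.

Let m2nd : measurable_fun setT (fun w : RT * 'rV[R]_d => w.2). Proof. exact: measurable_snd. Qed.
Let m1st : measurable_fun setT (fun w : RT * 'rV[R]_d => w.1). Proof. exact: measurable_fst. Qed.

(** Hoelder with k = k^(1/q) k^(1/p) shared between <y,z> and f. The first factor is at most (l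
    g^q)^(1/q), uniformly in x and z. *)
Lemma kernel_hoelder f x z : measurable_fun setT f -> enorm z = 1 ->
  (\int[M]_w (k w.1 * (`|dotp w.2 z| * `|f (OU_point alpha w.1 x w.2)|))%:E <=
   (l `^ q^-1 * g)%:E * kernel_energy f x `^ p^-1)%E.
Proof.
move=> mf z1.
have md : measurable_fun setT (fun w : RT * 'rV[R]_d => `|dotp w.2 z|).
  by apply: measurableT_comp => //; apply: (measurableT_comp (measurable_dotp z)).
have mF1 : measurable_fun setT (fun w : RT * 'rV[R]_d => k w.1 `^ q^-1 * `|dotp w.2 z|).
  apply: measurable_funM => //; apply: (measurableT_comp (measurable_powR _)).
  exact: (measurableT_comp mk).
have mF2 : measurable_fun setT (fun w : RT * 'rV[R]_d =>
    k w.1 `^ p^-1 * `|f (OU_point alpha w.1 x w.2)|).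
  apply: measurable_funM.
    apply: (measurableT_comp (measurable_powR _)); exact: (measurableT_comp mk).
  by apply: measurableT_comp => //; apply: mOU.
have := hoelder M mF1 mF2 q0 p0 (etrans (addrC _ _) pq).
rewrite Lnorm1 !Lnorm_EFin.
under eq_integral => w _.
  rewrite /= mulrACA kpq ger0_norm ?mulr_ge0//; over.
move=> /le_trans; apply; apply: lee_pmul; rewrite ?poweR_ge0//.
- have -> : (l `^ q^-1 * g)%:E = ((l * g `^ q)%:E `^ q^-1)%E.
    by rewrite poweR_EFin powRM ?powR_ge0// -powRrM mulfV ?gt_eqF// powRr1.
  apply: gt0_ler_poweR; rewrite ?invr_ge0 ?(ltW q0)// ?in_itv/= ?leey ?andbT.
  + by apply: integral_ge0 => w _; rewrite lee_fin powR_ge0.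
  + by rewrite lee_fin mulr_ge0 ?powR_ge0.
  under eq_integral do rewrite powRVK//.
  have mdq : measurable_fun setT (fun y : 'rV[R]_d => (`|dotp y z| `^ q)%:E).
    by apply: measurable_norm_powR; exact: measurable_dotp.
  have mw : measurable_fun setT (fun w : RT * 'rV[R]_d => (k w.1 * `|dotp w.2 z| `^ q)%:E).
    apply/measurable_EFinP; apply: measurable_funM; first exact: (measurableT_comp mk).
    exact: (measurableT_comp (measurable_powR q)).
  have w0 (w : RT * 'rV[R]_d) : (0 <= (k w.1 * `|dotp w.2 z| `^ q)%:E)%E.
    by rewrite lee_fin mulr_ge0 ?powR_ge0.
  rewrite ge0_fubini1//.
  apply: (@le_trans _ _ (\int[leb]_t ((k t)%:E * (g `^ q)%:E))%E).
    apply: ge0_le_integral => //.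
    + by move=> t _; apply: integral_ge0 => y _; rewrite lee_fin mulr_ge0 ?powR_ge0.
    + exact: (measurable_fun_fubini_tonelli_F (m2 := mu) _ mw w0).
    + by apply/measurable_EFinP; apply: measurable_funM.
    + move=> t _; under eq_integral do rewrite /= EFinM.
      by rewrite ge0_integralZl ?lee_fin// lee_wpmul2l ?lee_fin ?hg.
  rewrite ge0_integralZr ?lE// ?lee_fin ?powR_ge0//; first exact/measurable_EFinP.
  by move=> t _; rewrite lee_fin.
- rewrite /kernel_energy; under eq_integral do rewrite powRVK//.
  by [].
Qed.

Lemma kernel_transform_integrable f x j : measurable_fun setT f ->
  (kernel_energy f x < +oo)%E -> M.-integrable setT
    (EFin \o (fun w : RT * 'rV[R]_d => k w.1 * (w.2 ord0 j * f (OU_point alpha w.1 x w.2)))).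
Proof.
move=> mf ef; apply/integrableP; split.
  apply/measurable_EFinP; apply: measurable_funM; first exact: (measurableT_comp mk).
  apply: measurable_funM; first exact: (measurableT_comp (measurable_coord j)).
  exact: mOU.
apply: le_lt_trans (_ : (_ <= (l `^ q^-1 * g)%:E * kernel_energy f x `^ p^-1)%E) _.
  have := kernel_hoelder x mf (enorm_delta R j); congr (_ <= _)%E.
  apply: eq_integral => w _; rewrite dotp_delta /= !normrM.
  by rewrite (ger0_norm (k0 _)).
by rewrite lte_mul_pinfty ?lee_fin ?mulr_ge0 ?powR_ge0// poweR_lty.
Qed.

(** Duality: the norm of V is its inner product with z = V / |V|, so the scalar Hoelder bound
    applies with no loss depending on the dimension. The case V = 0 is separate. *)
Lemma enorm_kernel_transform_le f x : measurable_fun setT f ->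
  (kernel_energy f x < +oo)%E -> ((enorm (kernel_transform f x))%:E <=
    (l `^ q^-1 * g)%:E * kernel_energy f x `^ p^-1)%E.
Proof.
move=> mf ef; set V := kernel_transform f x.
have [V0|V0] := eqVneq (enorm V) 0.
  by rewrite V0 mule_ge0 ?lee_fin ?mulr_ge0 ?powR_ge0 ?poweR_ge0.
pose z := (enorm V)^-1 *: V.
have z1 : enorm z = 1 by rewrite enormZ ger0_norm ?invr_ge0 ?enorm_ge0// mulVf.
have Vz : enorm V = dotp V z.
  by rewrite dotpZr -sqr_enorm expr2 mulKf.
pose F j (w : RT * 'rV[R]_d) := k w.1 * (w.2 ord0 j * f (OU_point alpha w.1 x w.2)).
have iF j : M.-integrable setT (EFin \o F j) by exact: kernel_transform_integrable.
have [iS Se] := Rintegral_sum (index_enum 'I_d) (fun j => z ord0 j) iF.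
have SE w : \sum_(j <- index_enum 'I_d) z ord0 j * F j w =
    k w.1 * (dotp w.2 z * f (OU_point alpha w.1 x w.2)).
  rewrite /dotp mulr_suml mulr_sumr; apply: eq_bigr => j _; rewrite /F; ring.
have -> : enorm V = `|\int[M]_w (k w.1 * (dotp w.2 z * f (OU_point alpha w.1 x w.2)))|.
  rewrite -[LHS]ger0_norm ?enorm_ge0// Vz; congr (`|_|).
  under eq_Rintegral do rewrite -SE.
  by rewrite Se; apply: eq_bigr => j _; rewrite mxE mulrC.
have iG : M.-integrable setT (EFin \o
    (fun w : RT * 'rV[R]_d => k w.1 * (dotp w.2 z * f (OU_point alpha w.1 x w.2)))).
  by move: iS; congr (M.-integrable setT _); apply/funext => w /=; rewrite SE.
have -> : (`|\int[M]_w (k w.1 * (dotp w.2 z * f (OU_point alpha w.1 x w.2)))|%:E =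
    `|\int[M]_w (k w.1 * (dotp w.2 z * f (OU_point alpha w.1 x w.2)))%:E|)%E.
  by rewrite -abse_EFin /Rintegral fineK// (integrable_fin_num _ iG).
apply: le_trans (kernel_hoelder x mf z1).
apply: le_trans (le_abse_integral M measurableT (measurable_int _ iG)) _.
rewrite le_eqVlt; apply/orP; left; apply/eqP; apply: eq_integral => w _.
by rewrite abse_EFin !normrM (ger0_norm (k0 _)).
Qed.

(** The energy is mu-integrable, hence finite almost everywhere; at such points the integral
    defining the transform converges. *)
Lemma kernel_energy_lty f : measurable_fun setT f -> ('N[mu]_(p%:E)[EFin \o f] < +oo)%E ->
  {ae mu, forall x, (kernel_energy f x < +oo)%E}.
Proof.
move=> mf fp; have me := measurable_kernel_energy mf.
have ie : mu.-integrable setT (kernel_energy f).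
  apply/integrableP; split => //.
  under eq_integral do rewrite gee0_abs ?kernel_energy_ge0//.
  rewrite integral_kernel_energy// lte_mul_pinfty ?lee_fin//.
  exact: Lnorm_lty fp.
have := integrable_ae measurableT ie; apply: filterS => x /(_ I).
by rewrite ge0_fin_numE// kernel_energy_ge0.
Qed.

(** Raise the pointwise bound to the power p and integrate: the factors l^(1/q) and l^(1/p) combine
    into l. *)
Lemma vLnorm_kernel_transform f : measurable_fun setT f ->
  ('N[mu]_(p%:E)[EFin \o f] < +oo)%E ->
  (vLnorm mu p (kernel_transform f) <= (g * l)%:E * 'N[mu]_(p%:E)[EFin \o f])%E.
Proof.
move=> mf fp; have me := measurable_kernel_energy mf.
rewrite /vLnorm !Lnorm_EFin.
have mfp := @measurable_norm_powR _ _ _ p _ mf.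
have I0 : (0 <= \int[mu]_x (`|f x| `^ p)%:E)%E.
  by apply: integral_ge0 => x _; rewrite lee_fin powR_ge0.
have le1 : (\int[mu]_x (`|enorm (kernel_transform f x)| `^ p)%:E <=
    \int[mu]_x (((l `^ q^-1 * g) `^ p)%:E * kernel_energy f x))%E.
  apply: ae_ge0_le_integral => //.
  - apply: measurable_norm_powR; apply: (measurableT_comp (@measurable_enorm R d)).
    exact: measurable_kernel_transform.
  - by move=> x _; rewrite mule_ge0 ?kernel_energy_ge0 ?lee_fin ?powR_ge0.
  - exact: emeasurable_funM.
  have := kernel_energy_lty mf fp; apply: filterS => x ef _.
  have := enorm_kernel_transform_le mf ef.
  move: ef; have := kernel_energy_ge0 f x; case: (kernel_energy f x) => [e| |]//.
  rewrite lee_fin => e0 _; rewrite poweR_EFin -EFinM !lee_fin => le.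
  rewrite ger0_norm ?enorm_ge0//.
  have -> : (l `^ q^-1 * g) `^ p * e = (l `^ q^-1 * g * e `^ p^-1) `^ p.
    by rewrite [RHS]powRM ?mulr_ge0 ?powR_ge0// -powRrM mulVf ?gt_eqF// powRr1.
  by apply: ge0_ler_powR; rewrite ?nnegrE ?(ltW p0) ?mulr_ge0 ?powR_ge0 ?enorm_ge0.
have p'0 : 0 <= p^-1 by rewrite invr_ge0 ltW.
apply: le_trans (_ : (((l `^ q^-1 * g) `^ p * l)%:E * \int[mu]_x (`|f x| `^ p)%:E) `^ p^-1 <= _)%E.
  apply: gt0_ler_poweR; rewrite ?in_itv/= ?leey ?andbT//.
  - by apply: integral_ge0 => x _; rewrite lee_fin powR_ge0.
  - by rewrite mule_ge0 ?lee_fin ?mulr_ge0 ?powR_ge0.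
  rewrite (le_trans le1)// ge0_integralZl ?lee_fin ?powR_ge0//; last first.
    by move=> x _; exact: kernel_energy_ge0.
  by rewrite integral_kernel_energy// muleA.
rewrite poweRM ?lee_fin ?mulr_ge0 ?powR_ge0// poweR_EFin.
have -> : ((l `^ q^-1 * g) `^ p * l) `^ p^-1 = g * l.
  have h0 : 0 <= l `^ q^-1 * g by rewrite mulr_ge0 ?powR_ge0.
  rewrite powRM ?powR_ge0// -powRrM mulfV ?gt_eqF// (powRr1 h0).
  (* Adding exponents requires a nonzero base; for l = 0 both sides vanish. *)
  have [->|l'0] := eqVneq l 0; first by rewrite !powR0 ?mulr0 ?invr_eq0 ?gt_eqF.
  by rewrite mulrAC -powRD ?l'0 ?implybT// [q^-1 + _]addrC pq powRr1// mulrC.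
by [].
Qed.

End bound.
End kernel_transform.

(** The terms in g x cancel in the symmetrisation. The factors 1 and -1 are written explicitly so
    that both hypotheses are instances of a single statement for [|s| = 1]. *)
Lemma frac_grad_coord (R : realType) d (nu : {measure set 'rV[R]_d -> \bar R})
    (g : 'rV[R]_d -> R) x j :
  nu.-integrable setT (EFin \o (fun u => (g (x + 1 *: u) - g x) * u ord0 j)) ->
  nu.-integrable setT (EFin \o (fun u => (g (x + -1 *: u) - g x) * u ord0 j)) ->
  frac_grad nu g x ord0 j = \int[nu]_u (2^-1 * (g (x + u) - g (x - u)) * u ord0 j).
Proof.
move=> ip im; rewrite /frac_grad !mxE.
have -> : \int[nu]_u ((g (x + u) - g x) * u ord0 j) =
    \int[nu]_u ((g (x + 1 *: u) - g x) * u ord0 j).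
  by apply: eq_Rintegral => u _; rewrite scale1r.
have -> : \int[nu]_u ((g (x - u) - g x) * u ord0 j) =
    \int[nu]_u ((g (x + -1 *: u) - g x) * u ord0 j).
  by apply: eq_Rintegral => u _; rewrite scaleN1r.
rewrite -RintegralB// -RintegralZl//; last exact: integrableB ip im.
by apply: eq_Rintegral => u _; rewrite scale1r scaleN1r; ring.
Qed.

(** * The integral formula for the fractional Riesz transform *)

Section riesz_representation.
Context {R : realType} {d : nat} (nu : {measure set 'rV[R]_d -> \bar R})
  (sigma lambda1 : {finite_measure set 'rV[R]_d -> \bar R})
  (mu : probability 'rV[R]_d R) (alpha r : R).
Hypotheses (a1 : 1 < alpha) (a2 : alpha < 2) (hr : r_min alpha < r)
  (hnu : stable_levy_measure alpha nu) (hlaw : stable_law nu mu)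
  (hspec : spectral_measure alpha sigma mu lambda1).
Local Notation pos := (`]0%R, +oo[%classic : set R).

Local Notation RT := (measurableTypeR R).

Definition leb : {sigma_finite_measure set RT -> \bar R} := @lebesgue_measure R.

(** Extension by zero lets the time variable range over the whole line in the product measures. *)
Definition riesz_kernel : R -> R := (fun t => 2 * K_kernel alpha r t) \_ pos.

Let al0 : 0 < alpha. Proof. exact: lt_trans a1. Qed.

Let posE (t : R) : pos t = (0 < t) :> Prop.
Proof. by rewrite /= in_itv/= andbT. Qed.

Let patchP (f : R -> R) t : (f \_ pos) t = if 0 < t then f t else 0.
Proof. by rewrite patchE; congr (if _ then _ else _); apply/idP/idP; rewrite inE posE. Qed.

Lemma riesz_kernel_ge0 t : 0 <= riesz_kernel t.
Proof. by rewrite /riesz_kernel patchP; case: ifP => // _; rewrite mulr_ge0 ?K_kernel_ge0. Qed.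

Lemma riesz_kernel_neg t : t < 0 -> riesz_kernel t = 0.
Proof. by move=> t0; rewrite /riesz_kernel patchP ltNge ltW. Qed.

Let ipatch (f : R -> R) : leb.-integrable pos (EFin \o f) ->
  leb.-integrable setT (EFin \o (f \_ pos)).
Proof.
by move=> fi; rewrite -restrict_EFin; have [] := @integrable_mkcond _ _ _ leb pos (EFin \o f); auto.
Qed.

Lemma integrable_riesz_kernel : leb.-integrable setT (EFin \o riesz_kernel).
Proof.
apply: ipatch; have iK : leb.-integrable pos (EFin \o K_kernel alpha r).
  exact: integrable_K_kernel.
by have := (@integrableZl _ _ _ leb pos _ 2 (EFin \o K_kernel alpha r) iK); apply.
Qed.

Let w0 : R -> R := (riesz_weight r) \_ pos.
Let c0 : R := (Gamma (r / 2))^-1.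
Let w (t : R) : R := c0 * w0 t.

Let c0_ge0 : 0 <= c0. Proof. by rewrite invr_ge0 Gamma_ge0. Qed.

Let w_ge0 t : 0 <= w t.
Proof. by rewrite mulr_ge0// /w0 patchP; case: ifP => // _; exact: riesz_weight_ge0. Qed.

Let w_neg t : t <= 0 -> w t = 0.
Proof. by move=> t0; rewrite /w /w0 patchP ltNge t0 mulr0. Qed.

Let iw0 : leb.-integrable setT (EFin \o w0).
Proof.
apply: ipatch; exact: integrable_riesz_weight a1 hr.
Qed.

Let iw : leb.-integrable setT (EFin \o w).
Proof. exact: (@integrableZl _ _ _ leb _ _ c0 _ iw0). Qed.

Let mw : measurable_fun setT w := integrable_measurable iw.

Local Notation M2 := (product_measure_sf leb mu).

Let i1 : mu.-integrable setT (EFin \o cst 1).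
Proof. exact: finite_measure_integrable_cst. Qed.

Let iwG (v : R -> R) (G : RT * 'rV[R]_d -> R) (C : R) :
  leb.-integrable setT (EFin \o v) -> (forall t, 0 <= v t) ->
  measurable_fun setT G -> (forall z, `|G z| <= C) ->
  M2.-integrable setT (EFin \o (fun z => v z.1 * G z)).
Proof.
move=> iv v0 mG GC.
apply: (@integrable_dominated _ _ _ M2 _ (fun z => C * (v z.1 * 1))).
- by apply: measurable_funM => //; apply: (measurableT_comp (integrable_measurable iv)).
- by move=> z; rewrite normrM (ger0_norm (v0 _)) mulr1 mulrC ler_wpM2r.
- exact: (@integrableZl _ _ _ M2 _ _ C _ (integrable_tensor iv i1)).
Qed.

Let ibounded (f : 'rV[R]_d -> R) (C : R) : measurable_fun setT f ->
  (forall x, `|f x| <= C) -> mu.-integrable setT (EFin \o f).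
Proof.
by move=> mf fM; apply: (integrable_bounded _ mf fM); rewrite -ge0_fin_numE// fin_num_measure.
Qed.

Section bounded_lipschitz_function.
Variables (f : 'rV[R]_d -> R) (M L : R).
Hypothesis fML : bounded_lipschitz M L f.

Let mf := bounded_lipschitz_measurable fML.

Let mfOU dT (T : measurableType dT) (t : T -> R) (x y : T -> 'rV[R]_d) :
  measurable_fun setT t -> measurable_fun setT x -> measurable_fun setT y ->
  measurable_fun setT (fun s => f (OU_point alpha (t s) (x s) (y s))).
Proof. by move=> mt mx my; apply: (measurableT_comp mf); exact: measurable_OU_point. Qed.

Let bessel_productE x : bessel_potential alpha r mu f x =
  \int[M2]_z (w z.1 * f (OU_point alpha z.1 x z.2)).
Proof.
have mz : measurable_fun setT (fun z : RT * 'rV[R]_d => f (OU_point alpha z.1 x z.2)).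
  by apply: mfOU.
have w00 t : 0 <= w0 t by rewrite /w0 patchP; case: ifP => // _; exact: riesz_weight_ge0.
have i0 := iwG iw0 w00 mz (fun z => fML.1 _).
transitivity (c0 * \int[M2]_z (w0 z.1 * f (OU_point alpha z.1 x z.2))); last first.
  by rewrite -RintegralZl//; apply: eq_Rintegral => z _; rewrite /w mulrA.
have i0t (t : R) : mu.-integrable setT (EFin \o (fun y => f (OU_point alpha t x y))).
  by apply: ibounded (fun z => fML.1 _); apply: mfOU.
rewrite -Rintegral_fubini1//; last first.
  by move=> t; exact: (@integrableZl _ _ _ mu _ _ (w0 t) _ (i0t t)).
congr (_ * _); rewrite Rintegral_mkcond; apply: eq_Rintegral => t _.
rewrite [RHS](_ : _ = w0 t * \int[mu]_y f (OU_point alpha t x y)); last first.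
  by rewrite -RintegralZl.
by rewrite /w0 !patchP; case: ifP => // _; rewrite [RHS]mul0r.
Qed.

Let W := \int[leb]_t w t.

Let W_int : \int[M2]_z w z.1 = W.
Proof.
have -> : \int[M2]_z w z.1 = \int[M2]_z (w z.1 * 1) by apply: eq_Rintegral => z _; rewrite mulr1.
rewrite -(Rintegral_fubini1 (F := fun z : RT * 'rV[R]_d => w z.1 * 1)); last 2 first.
- exact: (integrable_tensor iw i1).
- by move=> t; exact: (@integrableZl _ _ _ mu _ _ (w t) _ i1).
by apply: eq_Rintegral => t _; rewrite [LHS](Rintegral_probability_cst mu (w t * 1)) mulr1.
Qed.

Let OU_dist t x x' y : 0 < t ->
  `|f (OU_point alpha t x y) - f (OU_point alpha t x' y)| <= `|L| * `|x - x'|.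
Proof.
move=> t0; rewrite (le_trans (fML.2 _ _))//.
have -> : OU_point alpha t x y - OU_point alpha t x' y = expR (- t) *: (x - x').
  by rewrite /OU_point opprD addrACA subrr addr0 scalerBr.
rewrite normrZ ger0_norm ?expR_ge0//.
apply: (@le_trans _ _ (`|L| * (expR (- t) * `|x - x'|))).
  by rewrite ler_wpM2r ?ler_norm// mulr_ge0 ?expR_ge0.
by rewrite ler_wpM2l// ler_piMl// -[leRHS]expR0 ler_expR oppr_le0 ltW.
Qed.

Let w_dist t x x' y :
  `|w t * (f (OU_point alpha t x y) - f (OU_point alpha t x' y))| <= w t * (`|L| * `|x - x'|).
Proof.
rewrite normrM (ger0_norm (w_ge0 t)).
have [t0|t0] := ltP 0 t; first by rewrite ler_wpM2l ?OU_dist.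
by rewrite w_neg// !mul0r.
Qed.

Let g := bessel_potential alpha r mu f.

Let i_f x : M2.-integrable setT (EFin \o (fun z => w z.1 * f (OU_point alpha z.1 x z.2))).
Proof. by apply: (iwG iw w_ge0 _ (fun z => fML.1 _)); apply: mfOU. Qed.

Let iwcst (C : R) : M2.-integrable setT (EFin \o (fun z => w z.1 * C)).
Proof. by apply: (@iwG w (cst C) `|C|). Qed.

Let int_wcst (C : R) : \int[M2]_z (w z.1 * C) = W * C.
Proof.
have iw1 : M2.-integrable setT (EFin \o (fun z => w z.1)).
  by have := iwcst 1; under eq_fun do rewrite mulr1.
by rewrite mulrC -W_int -RintegralZl//; apply: eq_Rintegral => z _; rewrite mulrC.
Qed.

Let g_dist x x' : g x - g x' = \int[M2]_z (w z.1 *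
  (f (OU_point alpha z.1 x z.2) - f (OU_point alpha z.1 x' z.2))).
Proof.
rewrite /g !bessel_productE -RintegralB//.
by apply: eq_Rintegral => z _; rewrite mulrBr.
Qed.

Let m_dist x x' : measurable_fun setT (fun z : RT * 'rV[R]_d =>
  f (OU_point alpha z.1 x z.2) - f (OU_point alpha z.1 x' z.2)).
Proof. by apply: measurable_funB; apply: mfOU. Qed.

Let f_dist_le a b : `|f a - f b| <= `|M| + `|M|.
Proof. by rewrite (le_trans (ler_normB _ _))// lerD// (le_trans (fML.1 _))// ler_norm. Qed.

(** The potential inherits boundedness and Lipschitz continuity from f, because x ->
    [OU_point alpha t x y] contracts by e^(-t) and the weight w has finite mass W. *)
Let g_lipschitz : bounded_lipschitz (W * `|M|) (W * `|L|) g.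
Proof.
split => [x|x x'].
  rewrite /g bessel_productE (le_trans (le_normr_Rintegral _ (i_f x)))// -int_wcst.
  apply: le_Rintegral => //; first exact: integrable_norm (i_f x).
  move=> z _; rewrite normrM (ger0_norm (w_ge0 _)) ler_wpM2l//.
  by rewrite (le_trans (fML.1 _))// ler_norm.
have id := iwG iw w_ge0 (m_dist x x') (fun z => f_dist_le _ _).
rewrite g_dist (le_trans (le_normr_Rintegral _ id))// -mulrA -int_wcst.
apply: le_Rintegral => //; exact: integrable_norm id.
Qed.

Let ilevy (h : 'rV[R]_d -> R) (C : R) : measurable_fun setT h ->
  (forall u, `|h u| <= C * levy_weight u) -> nu.-integrable setT (EFin \o h).
Proof.
move=> mh hC; apply: (integrable_dominated mh hC).
exact: (@integrableZl _ _ _ nu _ _ C _ (levy_integrable a1 hnu)).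
Qed.

Let shift_le (M' L' : R) (h : 'rV[R]_d -> R) (a b u : 'rV[R]_d) j : bounded_lipschitz M' L' h ->
  `|a - b| <= `|u| -> `|(h a - h b) * u ord0 j| <= ((`|M'| + `|M'|) + `|L'|) * levy_weight u.
Proof.
move=> [hM hL] abu; rewrite normrM; apply: le_levy_weight; [exact: addr_ge0|by []|move=> _|move=> _].
- rewrite ler_pM ?enorm_coord// (le_trans (ler_normB _ _))//.
  by rewrite lerD// (le_trans (hM _))// ler_norm.
- rewrite expr2 mulrA ler_pM ?enorm_coord// (le_trans (hL _ _))//.
  apply: (@le_trans _ _ (`|L'| * `|a - b|)); first by rewrite ler_wpM2r ?ler_norm.
  by rewrite ler_wpM2l// (le_trans abu)// norm_le_enorm.
Qed.

Let g_shift_integrable (s : R) x j : `|s| = 1 -> nu.-integrable setT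
  (EFin \o (fun u => (g (x + s *: u) - g x) * u ord0 j)).
Proof.
move=> s1; apply: (@ilevy _ ((`|W * `|M| | + `|W * `|M| |) + `|W * `|L| |)).
  have mg := bounded_lipschitz_measurable g_lipschitz.
  apply: measurable_funM; last exact: measurable_coord.
  have ms : measurable_fun setT (fun u : 'rV[R]_d => x + s *: u).
    by apply: measurable_rowD => //; apply: measurable_rowZ.
  exact: (measurable_funB (measurableT_comp mg ms) (measurable_cst (g x))).
move=> u; apply: (shift_le j g_lipschitz).
by rewrite addrAC subrr add0r normrZ s1 mul1r.
Qed.

Let frac_gradE x j : frac_grad nu g x ord0 j =
  \int[nu]_u (2^-1 * (g (x + u) - g (x - u)) * u ord0 j).
Proof. exact: (frac_grad_coord (g_shift_integrable x j (normr1 R)) (g_shift_integrable x j (normrN1 R))). Qed.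

Let nu' : {sigma_finite_measure set 'rV[R]_d -> \bar R} :=
  sigma_finite_copy (levy_sigma_finite hnu).
Local Notation M3 := (product_measure_sf M2 nu').

Let E x j (t : R) (y u : 'rV[R]_d) : R :=
  2^-1 * (f (OU_point alpha t (x + u) y) - f (OU_point alpha t (x - u) y)) * u ord0 j.

Let C : R := `|M| + `|L|.

Let half_diff_le a b : `|2^-1 * (f a - f b)| <= `|M|.
Proof. by rewrite normrM gtr0_norm ?invr_gt0// ler_pdivrMl// mulr_natl mulr2n f_dist_le. Qed.

Let E_le x j t y u : 0 < t -> `|E x j t y u| <= C * levy_weight u.
Proof.
move=> t0; rewrite normrM; apply: le_levy_weight => //.
  by move=> _; rewrite ler_pM ?enorm_coord// half_diff_le.
move=> _; rewrite expr2 mulrA ler_pM ?enorm_coord//.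
rewrite normrM gtr0_norm ?invr_gt0// ler_pdivrMl// (le_trans (OU_dist _ _ _ t0))//.
have -> : x + u - (x - u) = 2 *: u by rewrite opprD opprK addrACA subrr add0r scaler_nat mulr2n.
by rewrite normrZ ger0_norm// mulrCA ler_wpM2l// ler_wpM2l// norm_le_enorm.
Qed.

Let mE x j dT (T : measurableType dT) (t : T -> R) (y u : T -> 'rV[R]_d) :
  measurable_fun setT t -> measurable_fun setT y -> measurable_fun setT u ->
  measurable_fun setT (fun s => E x j (t s) (y s) (u s)).
Proof.
move=> mt my mu_; apply: measurable_funM; last exact: (measurableT_comp (measurable_coord j)).
apply: measurable_funM => //; apply: measurable_funB; apply: mfOU => //.
  exact: measurable_rowD.
apply: measurable_rowD => //.
have : measurable_fun setT (fun s => -1 *: u s) by apply: measurable_rowZ.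
by apply: eq_measurable_fun => s _; rewrite scaleN1r.
Qed.

(** The joint integrand in time, law variable and jump. It is dominated by w(t) times a multiple of
    [levy_weight], which justifies every exchange of integrals. *)
Let F x j (s : (RT * 'rV[R]_d) * 'rV[R]_d) : R := w s.1.1 * E x j s.1.1 s.1.2 s.2.

Let F_le x j s : `|F x j s| <= (w s.1.1 * 1) * (C * levy_weight s.2).
Proof.
rewrite normrM (ger0_norm (w_ge0 _)) mulr1.
have [t0|t0] := ltP 0 s.1.1; first by rewrite ler_wpM2l// E_le.
by rewrite w_neg// !mul0r.
Qed.

Let mF x j : measurable_fun setT (F x j).
Proof.
have m11 : measurable_fun setT (fun s : (RT * 'rV[R]_d) * 'rV[R]_d => s.1.1).
  by apply: measurableT_comp.
have m12 : measurable_fun setT (fun s : (RT * 'rV[R]_d) * 'rV[R]_d => s.1.2).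
  by apply: measurableT_comp.
apply: measurable_funM; first exact: (measurableT_comp mw).
exact: (mE x j m11 m12 measurable_snd).
Qed.

Let iC : nu'.-integrable setT (EFin \o (fun u => C * levy_weight u)).
Proof. exact: (@integrableZl _ _ _ nu _ _ C _ (levy_integrable a1 hnu)). Qed.

Let iF x j : M3.-integrable setT (EFin \o F x j).
Proof.
apply: (@integrable_dominated _ _ _ M3 _ (fun s => (w s.1.1 * 1) * (C * levy_weight s.2))).
- exact: mF.
- exact: F_le.
- exact: (integrable_tensor (integrable_tensor iw i1) iC).
Qed.

Let iFu x j z : nu'.-integrable setT (EFin \o (fun u => F x j (z, u))).
Proof.
apply: (@integrable_dominated _ _ _ nu' _ (fun u => (w z.1 * 1) * (C * levy_weight u))).
- rewrite /F /=; apply: measurable_funM; first exact: measurable_cst.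
  have mid : measurable_fun setT (fun u : 'rV[R]_d => u) by exact: measurable_id.
  have mt : measurable_fun setT (fun _ : 'rV[R]_d => (z.1 : R)) by exact: measurable_cst.
  have my : measurable_fun setT (fun _ : 'rV[R]_d => z.2) by exact: measurable_cst.
  exact: (mE x j mt my mid).
- by move=> u; exact: F_le.
- exact: (@integrableZl _ _ _ nu' _ _ (w z.1 * 1) _ iC).
Qed.

Let iFz x j u : M2.-integrable setT (EFin \o (fun z => F x j (z, u))).
Proof.
apply: (@iwG w (fun z => E x j z.1 z.2 u) (`|M| * `|u ord0 j|) iw w_ge0).
  exact: (mE x j measurable_fst measurable_snd (measurable_cst u)).
by move=> z; rewrite /E normrM ler_wpM2r// half_diff_le.
Qed.

Let H x j z : R := \int[nu']_u F x j (z, u).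

Let H_le x j z : `|H x j z| <= w z.1 * \int[nu']_u (C * levy_weight u).
Proof.
rewrite (le_trans (le_normr_Rintegral _ (iFu x j z)))// -RintegralZl//.
apply: le_Rintegral => //.
- exact: integrable_norm (iFu x j z).
- exact: (@integrableZl _ _ _ nu' _ _ (w z.1) _ iC).
- by move=> u _; have := F_le x j (z, u); rewrite mulr1.
Qed.

Let mH x j : measurable_fun setT (H x j).
Proof. exact: (@measurable_fun_Rintegral _ _ _ _ _ nu' _ (mF x j)). Qed.

Let H_iter x j : \int[leb]_t \int[mu]_y H x j (t, y) = \int[M2]_z H x j z.
Proof.
apply: Rintegral_fubini1 => [|t].
  exact: (integrable_Rintegral1 (iF x j) (iFu x j)).
apply: (@ibounded _ (w t * \int[nu']_u (C * levy_weight u))) => [|y]; last exact: H_le.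
by apply: (measurableT_comp (mH x j)); apply: measurable_fun_pair.
Qed.

Let b (t : R) : R := (1 - expR (- (alpha * t))) `^ alpha^-1.

Let shift_lipschitz (v : 'rV[R]_d) : bounded_lipschitz M L (fun y => f (v + y)).
Proof.
split => [y|y y']; first exact: fML.1.
by rewrite (le_trans (fML.2 _ _))// opprD addrACA subrr add0r.
Qed.

Let J x j t y : R := \int[nu']_u E x j t y u.

Let iE x j t y : 0 < t -> nu'.-integrable setT (EFin \o E x j t y).
Proof.
move=> t0; apply: (@integrable_dominated _ _ _ nu' _ (fun u => C * levy_weight u)) => //.
  have mid : measurable_fun setT (fun u : 'rV[R]_d => u) by exact: measurable_id.
  exact: (mE x j (measurable_cst t) (measurable_cst y) mid).
by move=> u; exact: E_le.
Qed.

(** At fixed t the jump u is contracted by e^(-t), and the point e^(-t) x is absorbed as a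
    translation of f. *)
Let J_gradient x j t y :
  J x j t y = levy_gradient nu (b t) (expR (- t)) j (fun v => f (expR (- t) *: x + v)) y.
Proof.
apply: eq_Rintegral => u _; congr (2^-1 * (f _ - f _) * _).
  by rewrite /OU_point scalerDr -addrA [expR _ *: u + _]addrC.
by rewrite /OU_point scalerBr -addrA [- _ + _]addrC.
Qed.

Let J_integrable x j t : 0 < t -> mu.-integrable setT (EFin \o J x j t).
Proof.
move=> t0; apply: (@ibounded _ (\int[nu']_u (C * levy_weight u))) => [|y].
  apply: (@measurable_fun_Rintegral _ _ _ _ _ nu' (fun s => E x j t s.1 s.2)).
  have mt : measurable_fun setT (fun _ : 'rV[R]_d * 'rV[R]_d => t) by exact: measurable_cst.
  exact: (mE x j mt measurable_fst measurable_snd).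
rewrite (le_trans (le_normr_Rintegral _ (iE x j y t0)))//.
apply: le_Rintegral => //.
- exact: integrable_norm (iE x j y t0).
- by move=> u _; exact: E_le.
Qed.

Let H_int x j t : 0 < t -> \int[mu]_y H x j (t, y) = w t * \int[mu]_y J x j t y.
Proof.
move=> t0; rewrite -RintegralZl//; last exact: J_integrable.
by apply: eq_Rintegral => y _; rewrite -RintegralZl//; exact: iE.
Qed.

Let coord_f_integrable x j t :
  mu.-integrable setT (EFin \o (fun y : 'rV[R]_d => y ord0 j * f (OU_point alpha t x y))).
Proof.
apply: (@integrable_dominated _ _ _ mu _ (fun y : 'rV[R]_d => M * `|y ord0 j|)).
- apply: measurable_funM; first exact: measurable_coord.
  by apply: mfOU.
- by move=> y; rewrite normrM mulrC ler_wpM2r//; exact: fML.1.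
- exact: integrableZl (integrable_norm (law_coord_integrable a1 a2 hspec j)).
Qed.

Let kernel_integrable x j : M2.-integrable setT
  (EFin \o (fun z : RT * 'rV[R]_d => riesz_kernel z.1 * (z.2 ord0 j * f (OU_point alpha z.1 x z.2)))).
Proof.
apply: (@integrable_dominated _ _ _ M2 _
  (fun z : RT * 'rV[R]_d => riesz_kernel z.1 * (M * `|z.2 ord0 j|))).
- apply: measurable_funM.
    exact: (measurableT_comp (integrable_measurable integrable_riesz_kernel)).
  apply: measurable_funM; first exact: (measurableT_comp (measurable_coord j)).
  by apply: mfOU.
- move=> z; rewrite !normrM (ger0_norm (riesz_kernel_ge0 _)) ler_wpM2l ?riesz_kernel_ge0//.
  by rewrite mulrC ler_wpM2r//; exact: fML.1.
- have iM : mu.-integrable setT (EFin \o (fun y : 'rV[R]_d => M * `|y ord0 j|)).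
    exact: integrableZl (integrable_norm (law_coord_integrable a1 a2 hspec j)).
  exact: (integrable_tensor integrable_riesz_kernel iM).
Qed.

(** The powers combine as e^(-t) e^(-(alpha-1) t) = e^(-alpha t) and b^(-(alpha-1)) = (1 - e^(-alpha
    t))^(-(1 - 1/alpha)); the factor 2 offsets the one in K. *)
Let kernel_ratio t : 0 < t ->
  w t * (expR (- t) / b t) `^ (alpha - 1) = riesz_kernel t.
Proof.
move=> t0; have e0 : 0 < 1 - expR (- (alpha * t)).
  by rewrite subr_gt0 expR_lt1 oppr_lt0 mulr_gt0.
rewrite /w /w0 /riesz_kernel !patchP t0 /riesz_weight /K_kernel /b /c0.
rewrite powRM ?expR_ge0 ?invr_ge0 ?powR_ge0//; set X := 1 - expR (- (alpha * t)).
have -> : expR (- t) `^ (alpha - 1) = expR (- (alpha * t)) / expR (- t).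
  by rewrite -expRM -expRN -expRD; congr expR; ring.
have -> : (X `^ alpha^-1)^-1 `^ (alpha - 1) = (X `^ (1 - alpha^-1))^-1.
  by rewrite -!powRN -powRrM; congr powR; field; rewrite gt_eqF.
rewrite !invfM; have et : expR (- t) != 0 by rewrite gt_eqF ?expR_gt0.
have two : 2 * 2^-1 = 1 :> R by rewrite mulfV.
by move: (_^-1) (X `^ _)^-1 (t `^ _)^-1 => G X' t'; field.
Qed.

(** Write the gradient of the potential as a triple integral, integrate over jumps first, then
    integrate by parts in y at each fixed t > 0. *)
Lemma frac_riesz_kernel_transform x :
  frac_riesz alpha r nu mu f x = kernel_transform mu alpha leb riesz_kernel f x.
Proof.
apply/rowP => j; have -> : (0 : 'I_1) = ord0 by exact: val_inj.
rewrite [RHS]mxE.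
transitivity (\int[nu']_u \int[M2]_z F x j (z, u)).
  rewrite [LHS]frac_gradE; apply: eq_Rintegral => u _.
  rewrite g_dist mulrAC -RintegralZl//; last first.
    exact: (iwG iw w_ge0 (m_dist _ _) (fun z => f_dist_le _ _)).
  by apply: eq_Rintegral => z _; rewrite /F /E; ring.
rewrite (Rintegral_fubini2 (iF x j) (iFz x j)) -(Rintegral_fubini1 (iF x j) (iFu x j)).
rewrite -[LHS]/(\int[M2]_z H x j z) -H_iter.
rewrite -(Rintegral_fubini1 (kernel_integrable x j)); last first.
  by move=> t; exact: (@integrableZl _ _ _ mu _ _ (riesz_kernel t) _ (coord_f_integrable x j t)).
apply: eq_Rintegral => t _.
rewrite [RHS](_ : _ = riesz_kernel t * \int[mu]_y (y ord0 j * f (OU_point alpha t x y))); last first.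
  by rewrite -RintegralZl.
(* For t <= 0 both sides vanish, since w and [riesz_kernel] live on the open half-line. *)
have [t0|t0] := ltP 0 t; last first.
  rewrite /riesz_kernel patchP ltNge t0 mul0r.
  have -> : \int[mu]_y H x j (t, y) = \int[mu]_(y in setT) (cst 0 : 'rV[R]_d -> R) y.
    apply: eq_Rintegral => y _; rewrite /H.
    have -> : (fun u => F x j ((t, y), u)) = cst 0 by apply/funext => u; rewrite /F w_neg// mul0r.
    by rewrite /Rintegral integral0.
  by rewrite /Rintegral integral0.
have b0 : 0 < b t by rewrite powR_gt0// subr_gt0 expR_lt1 oppr_lt0 mulr_gt0.
rewrite H_int// -kernel_ratio// -mulrA; congr (_ * _).
transitivity (\int[mu]_y levy_gradient nu (b t) (expR (- t)) j
    (fun v => f (expR (- t) *: x + v)) y).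
  by apply: eq_Rintegral => y _; exact: J_gradient.
exact: (levy_gradient_ibp a1 a2 hnu hlaw hspec j b0 (expR_gt0 _) (shift_lipschitz _)).
Qed.

End bounded_lipschitz_function.
End riesz_representation.

(** * Uniqueness of the continuous extension *)

Lemma Lfun_measurable_lty dT (T : measurableType dT) (R : realType)
    (m : {measure set T -> \bar R}) (p : \bar R) (f : T -> R) :
  (f \in Lfun m p) <-> (measurable_fun setT f /\ ('N[m]_p[EFin \o f] < +oo)%E).
Proof.
split; first by rewrite inE => /andP[]; rewrite inE => mf; rewrite inE.
by move=> [mf Nf]; rewrite inE; apply/andP; split; rewrite inE.
Qed.

Lemma le_Lnorm_ae dT (T : measurableType dT) (R : realType)
    (m : {measure set T -> \bar R}) (p : R) (f g : T -> R) : 0 < p ->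
  measurable_fun setT f -> measurable_fun setT g ->
  {ae m, forall x, `|f x| <= `|g x|} ->
  ('N[m]_(p%:E)[EFin \o f] <= 'N[m]_(p%:E)[EFin \o g])%E.
Proof.
move=> p0 mf mg fg; rewrite !Lnorm_EFin.
apply: gt0_ler_poweR; rewrite ?in_itv/= ?leey ?andbT ?invr_ge0 ?(ltW p0)//.
- by apply: integral_ge0 => x _; rewrite lee_fin powR_ge0.
- by apply: integral_ge0 => x _; rewrite lee_fin powR_ge0.
apply: ae_ge0_le_integral => //.
- exact: measurable_norm_powR.
- exact: measurable_norm_powR.
apply: filterS fg => x fg _; rewrite lee_fin ge0_ler_powR ?nnegrE//; exact: ltW.
Qed.

(** A crude triangle inequality from the parallelogram law; the factor 2 is harmless because it is
    only used to show that a norm is zero. *)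
Lemma enormD_le (R : realType) d (x y : 'rV[R]_d) : enorm (x + y) <= 2 * (enorm x + enorm y).
Proof.
rewrite -ler_sqr ?nnegrE ?mulr_ge0 ?addr_ge0 ?enorm_ge0// exprMn !sqrrD !sqr_enorm.
have h : dotp (x + y) (x + y) + dotp (x - y) (x - y) = 2 * (dotp x x + dotp y y).
  by rewrite -[- y]scaleN1r !dotpDl !dotpDr !dotpZl !dotpZr; ring.
have := dotp_ge0 (x - y); have := mulr_ge0 (enorm_ge0 x) (enorm_ge0 y).
have := dotp_ge0 x; have := dotp_ge0 y; lra.
Qed.

Lemma enorm_eq0 (R : realType) d (x : 'rV[R]_d) : enorm x = 0 -> x = 0.
Proof.
move=> x0; apply/rowP => j; rewrite mxE; apply/eqP; rewrite -normr_le0.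
by have := enorm_coord x j; rewrite x0.
Qed.

Section extension_uniqueness.
Context {R : realType} {d : nat} (mu : probability 'rV[R]_d R) (p : R).
Hypothesis p1 : 1 <= p.

Let p0 : 0 < p. Proof. exact: lt_le_trans p1. Qed.

Lemma schwartz_Lfun g : schwartz g -> g \in Lfun mu p%:E.
Proof.
move=> /schwartz_bounded_lipschitz[M [L gML]]; have mg := bounded_lipschitz_measurable gML.
apply/Lfun_measurable_lty; split => //; rewrite Lnorm_EFin poweR_lty//.
have mgp : measurable_fun setT (fun x => `|g x| `^ p).
  by apply/measurable_EFinP; exact: measurable_norm_powR.
have mu1 : (mu setT < +oo)%E by rewrite -ge0_fin_numE// fin_num_measure.
have /integrableP[_] : mu.-integrable setT (EFin \o (fun x => `|g x| `^ p)).
  apply: (@integrable_bounded _ _ _ mu _ (`|M| `^ p)) => // x.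
  rewrite ger0_norm ?powR_ge0// ge0_ler_powR ?nnegrE// ?(ltW p0)//.
  by rewrite (le_trans (gML.1 x))// ler_norm.
by congr (_ < _)%E; apply: eq_integral => x _; rewrite /= ger0_norm ?powR_ge0.
Qed.

Lemma measurable_enormB (F G : 'rV[R]_d -> 'rV[R]_d) :
  measurable_fun setT F -> measurable_fun setT G ->
  measurable_fun setT (fun x => enorm (F x - G x)).
Proof.
move=> mF mG; apply: (measurableT_comp (@measurable_enorm R d)).
have mNG : measurable_fun setT (fun x => -1 *: G x) by apply: measurable_rowZ.
by under eq_fun do rewrite -scaleN1r; exact: measurable_rowD.
Qed.

(** Near f choose a Schwartz g within both moduli of continuity; T g and T' g agree almost
    everywhere, so T' f - T f has arbitrarily small norm. *)
Lemma continuous_extension_unique (T0 T T' : ('rV[R]_d -> R) -> 'rV[R]_d -> 'rV[R]_d) :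
  continuous_extension mu p T0 T -> continuous_extension mu p T0 T' ->
  forall f, f \in Lfun mu p%:E -> {ae mu, forall x, T' f x = T f x}.
Proof.
move=> [TL TS Tc] [T'L T'S T'c] f fL.
have [mTf _] := TL f fL; have [mT'f _] := T'L f fL.
have mD := measurable_enormB mT'f mTf.
have small (e : R) : 0 < e -> (vLnorm mu p (T' f \- T f)%R <= (2 * (e + e))%:E)%E.
  move=> e0; have [d1 d10 h1] := Tc f fL e e0; have [d2 d20 h2] := T'c f fL e e0.
  have m0 : 0 < Num.min d1 d2 by rewrite lt_min d10.
  have [g gS gf] := schwartz_dense p1 fL m0.
  have gL := schwartz_Lfun gS.
  have [mTg _] := TL g gL; have [mT'g _] := T'L g gL.
  pose A x := enorm (T g x - T f x); pose B x := enorm (T' g x - T' f x).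
  have mA : measurable_fun setT A by exact: measurable_enormB.
  have mB : measurable_fun setT B by exact: measurable_enormB.
  have NA : ('N[mu]_(p%:E)[EFin \o A] < e%:E)%E.
    by apply: (h1 g gL); rewrite (lt_le_trans gf)// lee_fin ge_min lexx.
  have NB : ('N[mu]_(p%:E)[EFin \o B] < e%:E)%E.
    by apply: (h2 g gL); rewrite (lt_le_trans gf)// lee_fin ge_min lexx orbT.
  have mAB : measurable_fun setT (fun x => A x + B x) by exact: measurable_funD.
  apply: (@le_trans _ _ ('N[mu]_(p%:E)[EFin \o (fun x => 2 * (A x + B x))%R])%E).
    apply: le_Lnorm_ae => //; first exact: measurable_funM.
    apply: filterS2 (TS g gS) (T'S g gS) => x Tg T'g.
    rewrite !ger0_norm ?mulr_ge0 ?addr_ge0 ?enorm_ge0//=.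
    have -> : T' f x - T f x = (T g x - T f x) + -1 *: (T' g x - T' f x).
      by rewrite Tg T'g scaleN1r opprB [RHS]addrC [RHS]addrA subrK.
    by rewrite (le_trans (enormD_le _ _))// enormZ normrN1 mul1r.
  rewrite Lnorm_scale// ger0_norm// EFinM lee_pmul2l ?fin_numE ?lte_fin//.
  apply: (le_trans (minkowski_EFin mu mA mB p1)).
  by rewrite EFinD; apply: leeD; exact: ltW.
have N0 : ('N[mu]_(p%:E)[EFin \o (fun x => enorm (T' f x - T f x))])%E = 0%E.
  apply/eqP; rewrite eq_le Lnorm_ge0 andbT; apply/lee_addgt0Pr => e e0.
  by rewrite add0e (le_trans (small (e / 4) _)) ?divr_gt0// lee_fin; lra.
have pE : (0 < p%:E)%E by rewrite lte_fin.
have mDE : measurable_fun setT (EFin \o (fun x => enorm (T' f x - T f x))).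
  exact/measurable_EFinP.
have := Lnorm_eq0_eq0 mDE pE N0.
apply: filterS => x /(_ I) /= [] /enorm_eq0/eqP.
by rewrite subr_eq0 => /eqP.
Qed.

End extension_uniqueness.

(** * Identification of the constants and of the extension *)

Section stable_riesz_transform.
Context {R : realType} {d : nat} (nu : {measure set 'rV[R]_d.+1 -> \bar R})
  (sigma lambda1 : {finite_measure set 'rV[R]_d.+1 -> \bar R})
  (mu : probability 'rV[R]_d.+1 R) (alpha r : R).
Hypotheses (a1 : 1 < alpha) (a2 : alpha < 2) (hr : r_min alpha < r)
  (hnu : stable_levy_measure alpha nu) (hlaw : stable_law nu mu)
  (hspec : spectral_measure alpha sigma mu lambda1).

Let al0 : 0 < alpha. Proof. exact: lt_trans a1. Qed.

Lemma standard_stable_moment dO (O : measurableType dO) (P : probability O R)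
    (Y : {RV P >-> R}) (q : R) : standard_stable alpha Y -> 0 < q < alpha ->
  ('E_P[fun w => (`|Y w| `^ q)%R] = (stable_moment alpha q)%:E)%E.
Proof.
move=> hY /andP[q0 qa].
have mY : measurable_fun setT (Y : O -> R) by exact: measurable_funPT.
have hc (t : R) : 0 < t -> \int[P]_w cos (t * Y w) = expR (- (1 * t `^ alpha)).
  move=> t0; have /(congr1 (@complex.Re R)) := hY t.
  rewrite /= (ger0_norm (ltW t0)) mul1r => <-.
  by apply: eq_Rintegral => w _; rewrite /= expR0 mul1r.
have := stable_abs_moment q0 qa a2 mY ler01 hc.
by rewrite powR1 mul1r unlock.
Qed.

Lemma spectral_exponent_bounded : exists B : R, forall z : 'rV[R]_d.+1, enorm z = 1 ->
  spectral_exponent lambda1 alpha z <= B.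
Proof.
(* On the unit sphere |<y,z>| is at most the sum of the |z_i|, hence at most the dimension d + 1. *)
exists (\int[lambda1]_(y in sphere) (d.+1%:R `^ alpha)) => z z1.
have mS := @measurable_sphere R d.+1; apply: le_Rintegral => //.
- exact: (spectral_integrable lambda1 a1).
- exact: finite_measure_integrable_cst.
move=> y y1; apply: ge0_ler_powR; rewrite ?nnegrE ?(ltW al0)//.
rewrite (le_trans (dotp_enorm_le _ _))// y1 mulr1.
rewrite -[d.+1 in leRHS]card_ord -sumr_const ler_sum// => i _.
by rewrite -z1 enorm_coord.
Qed.

(** Under mu, |<y,z>|^q has mean psi(z)^(q/alpha) E|Y|^q, and gamma^q replaces psi(z)^(1/alpha) by
    its supremum over the sphere, which is finite. *)
Lemma gamma_const_real dO (O : measurableType dO) (P : probability O R)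
    (Y : {RV P >-> R}) (q : R) : standard_stable alpha Y -> 0 < q < alpha ->
  exists g : R, [/\ 0 <= g, gamma_const alpha q Y lambda1 = g%:E &
    forall z : 'rV[R]_d.+1, enorm z = 1 ->
      (\int[mu]_y (`|dotp y z| `^ q)%:E <= (g `^ q)%:E)%E].
Proof.
move=> hY qa; have [q0 _] := andP qa.
pose m := stable_moment alpha q.
have m0 : 0 <= m.
  rewrite -lee_fin -(standard_stable_moment hY qa) unlock.
  by apply: integral_ge0 => w _; rewrite lee_fin powR_ge0.
pose Lam := spectral_exponent lambda1 alpha : 'rV[R]_d.+1 -> R.
have mS := @measurable_sphere R d.+1.
have LamE (z : 'rV[R]_d.+1) :
    ((\int[lambda1]_(x in sphere) (`|dotp z x| `^ alpha)%:E) `^ alpha^-1)%E =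
    (Lam z `^ alpha^-1)%:E.
  rewrite -poweR_EFin /Lam /spectral_exponent /Rintegral fineK; last first.
    by apply: integrable_fin_num => //; exact: (spectral_integrable lambda1 a1).
  by congr (_ `^ _)%E; apply: eq_integral => x _; rewrite dotpC.
set S := [set ((\int[lambda1]_(x in sphere) (`|dotp z x| `^ alpha)%:E) `^ alpha^-1)%E
             | z in (@sphere R d.+1)].
have [B LamB] := spectral_exponent_bounded.
(* The dimension is positive, so the sphere is nonempty and the supremum is nonnegative rather than
   minus infinity. *)
have e1 : (@sphere R d.+1) (delta_mx ord0 ord0) by exact: enorm_delta.
have Sub (z : 'rV[R]_d.+1) : enorm z = 1 -> ((Lam z `^ alpha^-1)%:E <= ereal_sup S)%E.
  by move=> z1; apply: ereal_sup_ubound; exists z => //; exact: LamE.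
have S0 : (0 <= ereal_sup S)%E.
  by apply: le_trans (Sub _ e1); rewrite lee_fin powR_ge0.
have Sfin : (ereal_sup S <= (`|B| `^ alpha^-1)%:E)%E.
  apply: ub_ereal_sup => _ [z z1 <-]; rewrite LamE lee_fin.
  apply: ge0_ler_powR; rewrite ?nnegrE ?invr_ge0 ?(ltW al0)//.
    exact: spectral_exponent_ge0.
  by rewrite (le_trans (LamB z z1))// ler_norm.
have SE : (ereal_sup S = (fine (ereal_sup S))%:E)%E.
  by rewrite fineK// ge0_fin_numE// (le_lt_trans Sfin)// ltry.
pose s := fine (ereal_sup S); have s0 : 0 <= s by exact: fine_ge0.
exists (m `^ q^-1 * s); split.
- by rewrite mulr_ge0 ?powR_ge0.
- by rewrite /gamma_const -/S SE (standard_stable_moment hY qa) poweR_EFin EFinM.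
move=> z z1; rewrite (stable_law_moment a1 a2 hspec)// lee_fin.
rewrite powRM ?powR_ge0// -powRrM mulVf ?gt_eqF// powRr1// mulrC ler_wpM2l//.
rewrite [q / alpha]mulrC powRrM ge0_ler_powR ?nnegrE ?powR_ge0 ?(ltW q0)//.
by have := Sub z z1; rewrite SE lee_fin.
Qed.

Lemma K_L1norm_riesz_kernel :
  (2%:E * K_L1norm alpha r = (\int[leb]_t riesz_kernel alpha r t)%:E)%E.
Proof.
have ik := integrable_riesz_kernel a1 hr.
rewrite /Rintegral fineK; last by apply: integrable_fin_num.
have -> : (\int[leb]_t (riesz_kernel alpha r t)%:E =
    \int[leb]_(t in `]0%R, +oo[) (2 * K_kernel alpha r t)%:E)%E.
  by rewrite [RHS]integral_mkcond; apply: eq_integral => t _; rewrite restrict_EFin.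
rewrite /K_L1norm; under [RHS]eq_integral do rewrite EFinM.
have iK := integrable_K_kernel a1 hr.
have -> : (\int[lebesgue_measure]_(t in `]0%R, +oo[) `|(K_kernel alpha r t)%:E| =
    \int[leb]_(t in `]0%R, +oo[) (K_kernel alpha r t)%:E)%E.
  by apply: eq_integral => t _; rewrite gee0_abs ?lee_fin ?K_kernel_ge0.
rewrite -ge0_integralZl//.
- exact: measurable_int iK.
- by move=> t _; rewrite lee_fin K_kernel_ge0.
Qed.

Let T := kernel_transform mu alpha leb (riesz_kernel alpha r).

Section holder_exponents.
Variables (p g : R).
Hypotheses (p1 : 1 < p) (g0 : 0 <= g).
Let q := p / (p - 1).
Hypothesis hg : forall z : 'rV[R]_d.+1, enorm z = 1 ->
  (\int[mu]_y (`|dotp y z| `^ q)%:E <= (g `^ q)%:E)%E.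

Let p0 : 0 < p. Proof. exact: lt_trans p1. Qed.
Let q0 : 0 < q. Proof. by rewrite divr_gt0// subr_gt0. Qed.
Let pq : p^-1 + q^-1 = 1.
Proof. by rewrite /q invf_div; field; rewrite gt_eqF. Qed.

Let k0 := riesz_kernel_ge0 alpha r.
Let kneg (t : R) (t0 : t < 0) := riesz_kernel_neg alpha r t0.
Let ki := integrable_riesz_kernel a1 hr.

Let l := \int[leb]_t riesz_kernel alpha r t.

Lemma vLnorm_riesz_transform f : f \in Lfun mu p%:E ->
  (vLnorm mu p (T f) <= (g * l)%:E * 'N[mu]_(p%:E)[EFin \o f])%E.
Proof.
move=> /Lfun_measurable_lty[mf Nf].
exact: (vLnorm_kernel_transform a1 hspec k0 kneg ki p1 pq q0 g0 hg mf Nf).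
Qed.

(** Linearity holds only at points where both energies are finite, hence almost everywhere. *)
Lemma riesz_transformB f f' : f \in Lfun mu p%:E -> f' \in Lfun mu p%:E ->
  {ae mu, forall x, T f' x - T f x = T (f' \- f) x}.
Proof.
move=> /Lfun_measurable_lty[mf Nf] /Lfun_measurable_lty[mf' Nf'].
have ef := kernel_energy_lty a1 hspec k0 kneg ki p1 mf Nf.
have ef' := kernel_energy_lty a1 hspec k0 kneg ki p1 mf' Nf'.
apply: filterS2 ef ef' => x ef ef'; apply/rowP => j; rewrite !mxE.
have i := kernel_transform_integrable k0 ki p1 pq q0 g0 hg j mf ef.
have i' := kernel_transform_integrable k0 ki p1 pq q0 g0 hg j mf' ef'.
rewrite -RintegralB//; apply: eq_Rintegral => z _ /=; ring.
Qed.

Lemma riesz_transform_extension :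
  continuous_extension mu p (frac_riesz alpha r nu mu) T.
Proof.
have measT f : f \in Lfun mu p%:E -> measurable_fun setT (T f).
  move=> /Lfun_measurable_lty[mf _]; exact: (measurable_kernel_transform mu alpha ki mf).
have l0 : 0 <= l by apply: Rintegral_ge0 => t _; exact: k0.
split.
- move=> f fL; split; first exact: measT.
  apply: le_lt_trans (vLnorm_riesz_transform fL) _.
  have [_ Nf] := (Lfun_measurable_lty mu p%:E f).1 fL.
  by rewrite lte_mul_pinfty ?lee_fin ?mulr_ge0.
- move=> f /schwartz_bounded_lipschitz[M [L fML]]; apply: aeW => x.
  by rewrite (frac_riesz_kernel_transform a1 a2 hr hnu hlaw hspec fML).
(* The transform is bounded with constant g l; adding 1 avoids a division by zero. *)
move=> f fL e e0; exists (e / (g * l + 1)).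
  by rewrite divr_gt0// ltr_wpDl// mulr_ge0.
move=> f' f'L small.
have dL : (f' \- f)%R \in Lfun mu p%:E.
  apply/Lfun_measurable_lty; split.
    have [mf _] := (Lfun_measurable_lty mu p%:E f).1 fL.
    have [mf' _] := (Lfun_measurable_lty mu p%:E f').1 f'L.
    exact: measurable_funB.
  by rewrite (lt_trans small)// ltry.
apply: (@le_lt_trans _ _ (vLnorm mu p (T (f' \- f)%R))).
  apply: le_Lnorm_ae => //.
  - exact: measurable_enormB (measT _ f'L) (measT _ fL).
  - exact: (measurableT_comp (@measurable_enorm R d.+1) (measT _ dL)).
  apply: filterS (riesz_transformB fL f'L) => x TE.
  by rewrite /= -TE.
apply: le_lt_trans (vLnorm_riesz_transform dL) _.
have gl0 : 0 <= g * l by rewrite mulr_ge0.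
apply: (@le_lt_trans _ _ ((g * l)%:E * (e / (g * l + 1))%:E)%E).
  by rewrite lee_wpmul2l ?lee_fin// ltW.
rewrite -EFinM lte_fin mulrA ltr_pdivrMr ?ltr_wpDl// mulrC ltr_pM2l//.
by rewrite ltrDl.
Qed.

End holder_exponents.
End stable_riesz_transform.

Unset Implicit Arguments.

Theorem theorem4p1 (R : realType) (d : nat) (alpha r : R)
    (nu : {measure set 'rV[R]_d.+1 -> \bar R})
    (sigma lambda1 : {finite_measure set 'rV[R]_d.+1 -> \bar R})
    (mu : probability 'rV[R]_d.+1 R)
    (dO : measure_display) (O : measurableType dO) (P : probability O R)
    (Y : {RV P >-> R}) :
  1 < alpha < 2 ->
  r_min alpha < r ->
  symmetric_stable alpha nu sigma ->
  stable_law nu mu ->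
  spectral_measure alpha sigma mu lambda1 ->
  non_degenerate alpha lambda1 ->
  standard_stable alpha Y ->
  forall p : R, alpha / (alpha - 1) < p ->
  exists T : ('rV[R]_d.+1 -> R) -> 'rV[R]_d.+1 -> 'rV[R]_d.+1,
    [/\ continuous_extension mu p (frac_riesz alpha r nu mu) T,
        forall T', continuous_extension mu p (frac_riesz alpha r nu mu) T' ->
          forall f, f \in Lfun mu p%:E -> {ae mu, forall x, T' f x = T f x}
      & forall f, f \in Lfun mu p%:E ->
          (vLnorm mu p (T f) <=
           2%:E * gamma_const alpha (p / (p - 1)) Y lambda1 *
           K_L1norm alpha r * 'N[mu]_(p%:E)[EFin \o f])%E].
Proof.
move=> /andP[a1 a2] hr [hnu _ _ _] hlaw hspec _ hY p hp.
have a10 : 0 < alpha - 1 by rewrite subr_gt0.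
have hp' : alpha < p * (alpha - 1) by rewrite -ltr_pdivrMr.
have p1 : 1 < p.
  by rewrite -(ltr_pM2r a10) mul1r (lt_trans _ hp')// ltrBlDr ltrDl.
have p10 : 0 < p - 1 by rewrite subr_gt0.
(* The assumption on p says exactly that the conjugate exponent is below alpha, where stable moments
   are finite. *)
have qa : 0 < p / (p - 1) < alpha.
  rewrite divr_gt0//=; last exact: lt_trans p1.
  by rewrite ltr_pdivrMr//; move: hp'; rewrite !mulrBr !mulr1 [alpha * p]mulrC; lra.
have [g [g0 gE hg]] := gamma_const_real a1 a2 hspec hY qa.
pose T := kernel_transform mu alpha leb (riesz_kernel alpha r).
have TE := riesz_transform_extension a1 a2 hr hnu hlaw hspec p1 g0 hg.
exists T; split => // [T' T'E|f fL].
  by move=> f fL; apply: (continuous_extension_unique (ltW p1) TE T'E fL).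
(* The bound is gamma times the mass of [riesz_kernel]; that mass is 2 ||K||_1, which is the source
   of the factor 2. *)
have := vLnorm_riesz_transform a1 hr hspec p1 g0 hg fL.
by rewrite gE [(2%:E * _)%E]muleC -[(_ * 2%:E * _)%E]muleA (K_L1norm_riesz_kernel a1 hr) -EFinM.
Qed.
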